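(* Let $N$ be a non-negative integer and let $\mu$ and $\nu$ be arbitrary complex numbers such that $\Re(\mu)+|\Re(\nu)|<2N+1$. Then, for all $z$ with $|\arg z|<\frac\pi2$, $$R_N^{(S')}(z,\mu,\nu)=(-1)^N\frac{2^{\mu+1}}{\Gamma\left(\frac{-\mu+\nu+1}{2}\right)\Gamma\left(\frac{-\mu-\nu+1}{2}\right)}\frac{1}{z^{2N}}\int_0^{+\infty}\frac{t^{2N-\mu+1}K'_\nu(t)}{1+(t/z)^2}\,dt.$$
   Context: Lommel function: for complex $\mu,\nu$, $S_{\mu,\nu}(z)$ (analytic in $|\arg z|<\pi$) is the unique solution of $w''(z)+\frac1z w'(z)+\left(1-\frac{\nu^2}{z^2}\right)w(z)=z^{\mu-1}$ with $S_{\mu,\nu}(z)\sim z^{\mu-1}$ as $z\to\infty$ in $|\arg z|\le\pi-\delta$, for every fixed $\delta>0$. $S'_{\mu,\nu}$ is its derivative in $z$. Powers of $z$ are principal. Coefficients: $a_n(\mu,\nu)=\prod_{k=1}^n\left((\mu+2k-1)^2-\nu^2\right)$ (empty product is $1$) and $b_n(\mu,\nu)=-a_n(\mu,\nu)(\mu+2n+1)$, $n\ge0$. Remainder: for $|\arg z|<\pi$ and an integer $N\ge0$, $R_N^{(S')}(z,\mu,\nu)$ is defined by $$S'_{\mu,\nu}(z)=z^{\mu-2}\left(\sum_{n=0}^{N-1}(-1)^n\frac{b_n(-\mu,\nu)}{z^{2n}}+R_N^{(S')}(z,\mu,\nu)\right)$$ (empty sums are zero). $K_\nu$ is the modified Bessel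 function of the second kind and $K'_\nu$ its derivative. $1/\Gamma$ is the entire reciprocal gamma function, equal to $0$ at non-positive integers. *)

(* Defs.v *)
From Stdlib Require Import Reals Factorial.
From Coquelicot Require Export Coquelicot.

Open Scope R_scope.
Open Scope C_scope.

Definition Cexp (z : C) : C :=
  (exp (Re z) * cos (Im z), exp (Re z) * sin (Im z))%R.

(* Principal argument, in (-PI, PI]; only meaningful for z <> 0. *)
Definition Carg (z : C) : R :=
  if Rlt_dec (Im z) 0 then (- acos (Re z / Cmod z))%R
  else acos (Re z / Cmod z).

Definition Clog (z : C) : C := (ln (Cmod z), Carg z).

(* Principal power z^a, for z <> 0. *)
Definition Cpower (z a : C) : C := Cexp (a * Clog z).

(* f 0 + ... + f (n - 1) *)
Fixpoint Csum (f : nat -> C) (n : nat) : C :=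
  match n with
  | O => 0
  | S m => Csum f m + f m
  end.

(* f 1 * ... * f n *)
Fixpoint Cprod (f : nat -> C) (n : nat) : C :=
  match n with
  | O => 1
  | S m => Cprod f m * f (S m)
  end.

Definition slit_plane (z : C) : Prop := z <> 0 /\ (Rabs (Carg z) < PI)%R.

(* w z ~ g z as z -> oo in |arg z| <= PI - delta, for every fixed delta > 0. *)
Definition sector_equiv (w g : C -> C) : Prop :=
  forall delta : R, (0 < delta)%R ->
  forall eps : R, (0 < eps)%R ->
  exists M : R, forall z : C,
    (M < Cmod z)%R -> (Rabs (Carg z) <= PI - delta)%R ->
    (Cmod (w z / g z - 1) < eps)%R.

(* Euler's limit z (z + 1) ... (z + n) / (n! n^z), which converges to
   1 / Gamma z for every complex z, with value 0 at 0, -1, -2, ... *)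
Definition RGamma_seq (z : C) (n : nat) : C :=
  (z * Cprod (fun k => z + INR k) n) / (INR (fact n) * Cpower (INR n) z).

Definition RGamma (z : C) : C :=
  (real (Lim_seq (fun n => Re (RGamma_seq z n))),
   real (Lim_seq (fun n => Im (RGamma_seq z n)))).

(* The defining properties of the Lommel function S_{mu,nu}.  Derivatives are
   complex; C_derive is the derivative wherever ex_derive holds. *)
Definition is_Lommel (mu nu : C) (w : C -> C) : Prop :=
  (forall z : C, slit_plane z ->
     ex_derive w z /\ ex_derive (C_derive w) z /\
     C_derive (C_derive w) z + 1 / z * C_derive w z
       + (1 - nu ^ 2 / z ^ 2) * w z = Cpower z (mu - 1)) /\
  sector_equiv w (fun z => Cpower z (mu - 1)).

(* The modified Bessel function of the second kind K_nu (principal branch) is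
   the solution of the modified Bessel equation that is recessive at infinity,
   normalized by K_nu z ~ (PI / (2 z))^(1/2) e^(-z) (DLMF 10.25.1, 10.25.3). *)
Definition is_BesselK (nu : C) (w : C -> C) : Prop :=
  (forall z : C, slit_plane z ->
     ex_derive w z /\ ex_derive (C_derive w) z /\
     z ^ 2 * C_derive (C_derive w) z + z * C_derive w z
       - (z ^ 2 + nu ^ 2) * w z = 0) /\
  sector_equiv w (fun z => Cpower (PI / (2 * z)) (1 / 2) * Cexp (- z)).

Definition lommel_a (n : nat) (mu nu : C) : C :=
  Cprod (fun k => (mu + 2 * INR k - 1) ^ 2 - nu ^ 2) n.

Definition lommel_b (n : nat) (mu nu : C) : C :=
  - lommel_a n mu nu * (mu + 2 * INR n + 1).

(* R_N^{(S')}(z, mu, nu), where w stands for S_{mu,nu}: the defining relation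
   w' z = z^(mu - 2) * (sum + R) solved for R. *)
Definition lommel_remainder' (w : C -> C) (N : nat) (z mu nu : C) : C :=
  C_derive w z / Cpower z (mu - 2)
  - Csum (fun n => (- (1)) ^ n * (lommel_b n (- mu) nu / z ^ (2 * n))) N.

(* Main.v *)
(** The operator [theta = z d/dz] turns the Lommel equation into
    [(theta^2 + z^2 - nu^2) w = z^(mu+1)] and the modified Bessel equation into
    [theta^2 K = (t^2 + nu^2) K].  With [a = 2 N - mu], the transform
    [P(z) = z^(1-a) int_0^oo t^a K(t) / (z^2 + t^2) dt] intertwines [theta_z] and
    [theta_t], because its kernel is homogeneous of degree [-1]; hence
    [(theta^2 + z^2 - nu^2) P = z^(1-a) int_0^oo t^a K(t) dt].
    That Mellin transform is computed from its two-term recurrence in [a], Euler's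
    limit for [1/Gamma], the behaviour of [K] at infinity and Wallis' product, and it
    makes the truncated asymptotic series plus a multiple of [P] an exact solution
    [F] of the Lommel equation in the right half-plane.  Then [S - F] solves Bessel's
    equation and grows at most polynomially on the rays [arg z = PI/4] and
    [arg z = - PI/4], on which [K (i z)] and [K (- i z)], in one order or the other,
    decay exponentially: its Wronskians with both of them vanish, so [S = F] and
    [S' = F'].  The formula is [S' = F'], with [theta K] in place of [K] under the
    integral sign. *)
Require Import Defs.
From Stdlib Require Import Reals Lra Lia Factorial ClassicalEpsilon.
From Coquelicot Require Import Coquelicot.
Open Scope R_scope.
Open Scope C_scope.

(** * Limits and derivatives of complex-valued functions *)

(** [K] is known only through its equation and its behaviour at infinity, and [1 / Gamma] only
    through Euler's limit. So two facts have to be extracted. The order of the singularity of [K] at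
    0 comes from a monotone energy of the first-order system, at the price of an arbitrarily small
    loss [d] in the exponent. The value of the Mellin transform is fixed at infinity: raising [a] by
    [2 n] moves the mass of the integrand to [t] near [2 n], where [K] has its asymptotic form, and
    the powers of [n] produced there are exactly those in Euler's limits for the two Gamma factors.
    The identity [A * M = a_N(-mu, nu)] between the prefactor [A], the Mellin transform [M] and the
    first omitted coefficient is never divided by anything, so it covers the poles of Gamma: there
    [A] is 0 and the series terminates. No theorem of complex analysis is used: holomorphic
    functions are only ever restricted to segments and rays. *)

Definition clim {X : Type} (F : (X -> Prop) -> Prop) (f : X -> C) (l : C) : Prop :=
  forall eps : R, (0 < eps)%R -> F (fun x => (Cmod (f x - l) < eps)%R).

Lemma Cmod_minus_sym (a b : C) : Cmod (a - b) = Cmod (b - a).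
Proof. rewrite <- Cmod_opp. f_equal. ring. Qed.

Lemma Cmod_pos (a : C) : a <> 0 -> (0 < Cmod a)%R.
Proof. apply Cmod_gt_0. Qed.

Lemma Cmod_neq_0 (a : C) : (0 < Cmod a)%R -> a <> 0.
Proof. apply Cmod_gt_0. Qed.

Lemma Cmod_triangle_rev (a b : C) : (Cmod a - Cmod b <= Cmod (a - b))%R.
Proof.
  assert (H := Cmod_triangle (a - b) b).
  replace (a - b + b) with a in H by ring. lra.
Qed.

Lemma Cmod_small_0 (a : C) : (forall eps, 0 < eps -> Cmod a < eps)%R -> a = 0.
Proof.
  intros H. apply Cmod_eq_0. destruct (Cmod_ge_0 a) as [h|h]; [|auto].
  specialize (H _ h). lra.
Qed.

Lemma clim_ext {X} (F : (X -> Prop) -> Prop) {FF : Filter F} f g l :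
  F (fun x => f x = g x) -> clim F f l -> clim F g l.
Proof.
  intros H Hf eps He. generalize (filter_and _ _ H (Hf eps He)).
  apply filter_imp. intros x [E Hx]. rewrite <- E; exact Hx.
Qed.

Lemma clim_eq {X} (F : (X -> Prop) -> Prop) (f : X -> C) (l l' : C) :
  l = l' -> clim F f l -> clim F f l'.
Proof. intros ->. auto. Qed.

Lemma clim_const {X} (F : (X -> Prop) -> Prop) {FF : Filter F} (c : C) :
  clim F (fun _ => c) c.
Proof.
  intros eps He. apply filter_forall. intros x.
  replace (c - c) with (RtoC 0) by ring. rewrite Cmod_0. exact He.
Qed.

Lemma clim_plus {X} (F : (X -> Prop) -> Prop) {FF : Filter F} (f g : X -> C) (a b : C) :
  clim F f a -> clim F g b -> clim F (fun x => f x + g x) (a + b).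
Proof.
  intros Hf Hg eps He.
  assert (He2 : (0 < eps / 2)%R) by lra.
  generalize (filter_and _ _ (Hf _ He2) (Hg _ He2)). apply filter_imp.
  intros x [H1 H2]. replace (f x + g x - (a + b)) with ((f x - a) + (g x - b)) by ring.
  eapply Rle_lt_trans; [apply Cmod_triangle|]. lra.
Qed.

Lemma clim_bounded {X} (F : (X -> Prop) -> Prop) {FF : Filter F} (f : X -> C) (a : C) :
  clim F f a -> F (fun x => (Cmod (f x) < Cmod a + 1)%R).
Proof.
  intros Hf. generalize (Hf 1%R Rlt_0_1). apply filter_imp. intros x H.
  assert (H1 := Cmod_triangle_rev (f x) a). lra.
Qed.

Lemma clim_mult {X} (F : (X -> Prop) -> Prop) {FF : Filter F} (f g : X -> C) (a b : C) :
  clim F f a -> clim F g b -> clim F (fun x => f x * g x) (a * b).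
Proof.
  intros Hf Hg eps He.
  set (A := (Cmod a + 1)%R). set (B := (Cmod b + 1)%R).
  assert (HA : (0 < A)%R) by (unfold A; assert (h := Cmod_ge_0 a); lra).
  assert (HB : (0 < B)%R) by (unfold B; assert (h := Cmod_ge_0 b); lra).
  assert (He1 : (0 < eps / (2 * B))%R) by (apply Rdiv_lt_0_compat; lra).
  assert (He2 : (0 < eps / (2 * A))%R) by (apply Rdiv_lt_0_compat; lra).
  generalize (filter_and _ _ (clim_bounded F f a Hf)
    (filter_and _ _ (Hf _ He1) (Hg _ He2))).
  apply filter_imp. intros x [H0 [H1 H2]]. fold A in H0.
  replace (f x * g x - a * b) with (f x * (g x - b) + (f x - a) * b) by ring.
  eapply Rle_lt_trans; [apply Cmod_triangle|]. rewrite !Cmod_mult.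
  assert (h1 : (Cmod (f x) * Cmod (g x - b) <= A * (eps / (2 * A)))%R).
  { apply Rmult_le_compat; try apply Cmod_ge_0; lra. }
  assert (h2 : (Cmod (f x - a) * Cmod b < eps / (2 * B) * B)%R).
  { apply Rle_lt_trans with (eps / (2 * B) * Cmod b)%R.
    - apply Rmult_le_compat_r; [apply Cmod_ge_0|lra].
    - apply Rmult_lt_compat_l; [exact He1|unfold B; lra]. }
  replace (A * (eps / (2 * A)))%R with (eps / 2)%R in h1 by (field; lra).
  replace (eps / (2 * B) * B)%R with (eps / 2)%R in h2 by (field; lra).
  lra.
Qed.

Lemma clim_opp {X} (F : (X -> Prop) -> Prop) {FF : Filter F} (f : X -> C) (a : C) :
  clim F f a -> clim F (fun x => - f x) (- a).
Proof.
  intros Hf eps He. generalize (Hf eps He). apply filter_imp. intros x H.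
  replace (- f x - - a) with (- (f x - a)) by ring. now rewrite Cmod_opp.
Qed.

Lemma clim_minus {X} (F : (X -> Prop) -> Prop) {FF : Filter F} (f g : X -> C) (a b : C) :
  clim F f a -> clim F g b -> clim F (fun x => f x - g x) (a - b).
Proof. intros Hf Hg. apply (clim_plus F); [exact Hf|apply (clim_opp F), Hg]. Qed.

Lemma clim_away {X} (F : (X -> Prop) -> Prop) {FF : Filter F} (f : X -> C) (a : C) :
  a <> 0 -> clim F f a -> F (fun x => (Cmod a / 2 < Cmod (f x))%R).
Proof.
  intros Ha Hf. apply Cmod_pos in Ha.
  assert (He : (0 < Cmod a / 2)%R) by lra.
  generalize (Hf _ He). apply filter_imp. intros x H.
  rewrite Cmod_minus_sym in H. assert (H1 := Cmod_triangle_rev a (f x)). lra.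
Qed.

Lemma clim_inv {X} (F : (X -> Prop) -> Prop) {FF : Filter F} (f : X -> C) (a : C) :
  a <> 0 -> clim F f a -> clim F (fun x => / f x) (/ a).
Proof.
  intros Ha Hf eps He. assert (Ha' := Ha). apply Cmod_pos in Ha'.
  set (A := Cmod a) in *.
  assert (He1 : (0 < eps * (A * A / 2))%R).
  { apply Rmult_lt_0_compat; [lra|]. assert (0 < A * A)%R by (apply Rmult_lt_0_compat; lra). lra. }
  generalize (filter_and _ _ (clim_away F f a Ha Hf) (Hf _ He1)).
  apply filter_imp. intros x [H1 H2]. fold A in H1.
  assert (Hx : f x <> 0) by (apply Cmod_neq_0; lra).
  replace (/ f x - / a) with ((a - f x) * / (a * f x)) by (field; auto).
  rewrite Cmod_mult, Cmod_inv, Cmod_mult by (apply Cmult_neq_0; auto).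
  rewrite Cmod_minus_sym. fold A.
  assert (Hp : (A * A / 2 < A * Cmod (f x))%R).
  { replace (A * A / 2)%R with (A * (A / 2))%R by field. apply Rmult_lt_compat_l; lra. }
  apply Rmult_lt_reg_r with (A * Cmod (f x))%R; [nra|].
  rewrite Rmult_assoc, Rinv_l by nra. rewrite Rmult_1_r.
  eapply Rlt_trans; [exact H2|]. apply Rmult_lt_compat_l; lra.
Qed.

Lemma clim_div {X} (F : (X -> Prop) -> Prop) {FF : Filter F} (f g : X -> C) (a b : C) :
  b <> 0 -> clim F f a -> clim F g b -> clim F (fun x => f x / g x) (a / b).
Proof. intros Hb Hf Hg. apply (clim_mult F); [exact Hf|apply (clim_inv F); auto]. Qed.

Lemma clim_unique {X} (F : (X -> Prop) -> Prop) {FF : ProperFilter F} f a b :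
  clim F f a -> clim F f b -> a = b.
Proof.
  intros Ha Hb. assert (E : a - b = 0).
  { apply Cmod_small_0. intros eps He. assert (He2 : (0 < eps / 2)%R) by lra.
    destruct (filter_ex _ (filter_and _ _ (Ha _ He2) (Hb _ He2))) as [x [H1 H2]].
    replace (a - b) with ((a - f x) + (f x - b)) by ring.
    eapply Rle_lt_trans; [apply Cmod_triangle|].
    rewrite (Cmod_minus_sym a). lra. }
  replace a with (a - b + b) by ring. rewrite E. ring.
Qed.

Lemma clim_Cmod_le {X} (F : (X -> Prop) -> Prop) {FF : ProperFilter F} f a (B : R) :
  clim F f a -> F (fun x => (Cmod (f x) <= B)%R) -> (Cmod a <= B)%R.
Proof.
  intros Ha Hb. apply Rnot_lt_le. intros Hlt.
  assert (He : (0 < Cmod a - B)%R) by lra.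
  destruct (filter_ex _ (filter_and _ _ (Ha _ He) Hb)) as [x [H1 H2]].
  rewrite Cmod_minus_sym in H1. assert (H3 := Cmod_triangle_rev a (f x)). lra.
Qed.

Lemma clim_squeeze {X} (F : (X -> Prop) -> Prop) {FF : Filter F} f a (g : X -> R) :
  F (fun x => (Cmod (f x - a) <= g x)%R) ->
  (forall eps, (0 < eps)%R -> F (fun x => (g x < eps)%R)) -> clim F f a.
Proof.
  intros H Hg eps He. generalize (filter_and _ _ H (Hg eps He)).
  apply filter_imp. intros x [H1 H2]. lra.
Qed.

(* The neighbourhood filter of [x] pulled back from [C] along [io]; used with
   [io] the identity of [C] and with [io] the embedding of [R]. *)
Definition nb {X : Type} (io : X -> C) (x : X) (P : X -> Prop) : Prop :=
  exists d : R, (0 < d)%R /\ forall y, (Cmod (io y - io x) < d)%R -> P y.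

Global Instance nb_filter {X} (io : X -> C) (x : X) : ProperFilter (nb io x).
Proof.
  constructor.
  - intros P [d [Hd H]]. exists x. apply H.
    replace (io x - io x) with (RtoC 0) by ring. now rewrite Cmod_0.
  - constructor.
    + exists 1%R. split; [lra|auto].
    + intros P Q [d [Hd H]] [d' [Hd' H']]. exists (Rmin d d'). split.
      * now apply Rmin_glb_lt.
      * intros y Hy. split; [apply H|apply H'];
          eapply Rlt_le_trans; eauto; [apply Rmin_l|apply Rmin_r].
    + intros P Q HPQ [d [Hd H]]. exists d. split; auto.
Qed.

Lemma nb_self {X} (io : X -> C) (x : X) (P : X -> Prop) : nb io x P -> P x.
Proof.
  intros [d [Hd H]]. apply H.
  replace (io x - io x) with (RtoC 0) by ring. now rewrite Cmod_0.
Qed.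

Lemma clim_io {X} (io : X -> C) (x : X) : clim (nb io x) io (io x).
Proof. intros eps He. exists eps. auto. Qed.

Lemma clim_comp {X Y} (F : (X -> Prop) -> Prop) {FF : Filter F}
  (io : Y -> C) (g : X -> Y) (y : Y) (f : Y -> C) l :
  clim F (fun x => io (g x)) (io y) -> clim (nb io y) f l ->
  clim F (fun x => f (g x)) l.
Proof.
  intros Hg Hf eps He. destruct (Hf eps He) as [d [Hd H]].
  generalize (Hg d Hd). apply filter_imp. intros x Hx. now apply H.
Qed.

(* Caratheodory's form of the derivative; the continuity of [phi] at [x] forces
   [phi x = l]. *)
Definition cder {X : Type} (io : X -> C) (f : X -> C) (x : X) (l : C) : Prop :=
  exists phi : X -> C, clim (nb io x) phi l /\
    nb io x (fun y => f y = f x + phi y * (io y - io x)).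

Definition idC (z : C) : C := z.

Notation cderC := (cder idC).
Notation cderR := (cder RtoC).

Lemma cder_cont {X} (io : X -> C) f x l : cder io f x l -> clim (nb io x) f (f x).
Proof.
  intros [phi [H1 H2]].
  apply (clim_ext (nb io x) (fun y => f x + phi y * (io y - io x))).
  - revert H2. apply filter_imp. auto.
  - apply (clim_eq _ _ (f x + l * (io x - io x))); [ring|].
    apply (clim_plus _); [apply (clim_const _)|]. apply (clim_mult _); [exact H1|].
    apply (clim_minus _); [apply clim_io|apply (clim_const _)].
Qed.

Lemma cder_ext_loc {X} (io : X -> C) f g x l :
  nb io x (fun y => f y = g y) -> cder io f x l -> cder io g x l.
Proof.
  intros E [phi [H1 H2]]. exists phi. split; [exact H1|].
  assert (E0 := nb_self _ _ _ E). cbv beta in E0.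
  generalize (filter_and _ _ E H2). apply filter_imp. intros y [Ey Hy].
  now rewrite <- Ey, <- E0.
Qed.

Lemma cder_ext {X} (io : X -> C) f g x l :
  (forall y, f y = g y) -> cder io f x l -> cder io g x l.
Proof. intros E. apply cder_ext_loc. apply filter_forall. exact E. Qed.

Lemma cder_eq {X} (io : X -> C) f x l l' : l = l' -> cder io f x l -> cder io f x l'.
Proof. intros ->. auto. Qed.

Lemma cder_const {X} (io : X -> C) (c : C) x : cder io (fun _ => c) x 0.
Proof.
  exists (fun _ => 0). split; [apply (clim_const _)|].
  apply filter_forall. intros y. ring.
Qed.

Lemma cder_io {X} (io : X -> C) x : cder io io x 1.
Proof.
  exists (fun _ => 1). split; [apply (clim_const _)|].
  apply filter_forall. intros y. ring.
Qed.

Lemma cder_plus {X} (io : X -> C) (f g : X -> C) x (a b : C) :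
  cder io f x a -> cder io g x b -> cder io (fun y => f y + g y) x (a + b).
Proof.
  intros [p [H1 H2]] [q [H3 H4]]. exists (fun y => p y + q y). split.
  - now apply (clim_plus _).
  - generalize (filter_and _ _ H2 H4). apply filter_imp. intros y [E1 E2].
    rewrite E1, E2. ring.
Qed.

Lemma cder_mult {X} (io : X -> C) (f g : X -> C) x (a b : C) :
  cder io f x a -> cder io g x b ->
  cder io (fun y => f y * g y) x (a * g x + f x * b).
Proof.
  intros Hf Hg. assert (Cg := cder_cont _ _ _ _ Hg).
  destruct Hf as [p [H1 H2]], Hg as [q [H3 H4]].
  exists (fun y => p y * g y + f x * q y). split.
  - apply (clim_plus _); apply (clim_mult _); auto. apply (clim_const _).
  - generalize (filter_and _ _ H2 H4). apply filter_imp. intros y [E1 E2].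
    rewrite E1.
    replace (f x * g x + (p y * g y + f x * q y) * (io y - io x))
      with (f x * (g x + q y * (io y - io x)) + p y * g y * (io y - io x)) by ring.
    rewrite <- E2. ring.
Qed.

Lemma cder_scal {X} (io : X -> C) (c : C) f x a :
  cder io f x a -> cder io (fun y => c * f y) x (c * a).
Proof.
  intros H. eapply cder_eq; [|apply cder_mult; [apply cder_const|exact H]].
  cbv beta. ring.
Qed.

Lemma cder_minus {X} (io : X -> C) (f g : X -> C) x (a b : C) :
  cder io f x a -> cder io g x b -> cder io (fun y => f y - g y) x (a - b).
Proof.
  intros Hf Hg. apply (cder_ext io (fun y => f y + (- (1)) * g y)).
  { intros y. ring. }
  eapply cder_eq; [|apply cder_plus; [exact Hf|apply cder_scal; exact Hg]]. ring.
Qed.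

Lemma cder_inv {X} (io : X -> C) (f : X -> C) x (a : C) :
  f x <> 0 -> cder io f x a -> cder io (fun y => / f y) x (- a / (f x * f x)).
Proof.
  intros Hx Hf. assert (Cf := cder_cont _ _ _ _ Hf).
  destruct Hf as [p [H1 H2]].
  exists (fun y => - p y / (f y * f x)). split.
  - apply (clim_div _); [now apply Cmult_neq_0|now apply (clim_opp _)|].
    apply (clim_mult _); [exact Cf|apply (clim_const _)].
  - generalize (filter_and _ _ H2 (clim_away _ _ _ Hx Cf)). apply filter_imp.
    intros y [E1 E2]. assert (Hy : f y <> 0).
    { apply Cmod_neq_0. assert (h := Cmod_ge_0 (f x)). lra. }
    assert (E : p y * (io y - io x) = f y - f x) by (rewrite E1; ring).
    replace (- p y / (f y * f x) * (io y - io x))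
      with (- (p y * (io y - io x)) / (f y * f x)) by (field; auto).
    rewrite E. field. auto.
Qed.

(** In Caratheodory's form the slope of a composite is the product of the slopes, so no case
    distinction on [g y = g x] arises. The two embeddings let one statement cover curves in [C] as
    well as holomorphic maps. *)
Lemma cder_comp {X Y} (ix : X -> C) (iy : Y -> C) (g : X -> Y) (f : Y -> C) x a b :
  cder ix (fun y => iy (g y)) x a -> cder iy f (g x) b ->
  cder ix (fun y => f (g y)) x (b * a).
Proof.
  intros Hg. assert (Cg := cder_cont _ _ _ _ Hg).
  destruct Hg as [p [H1 H2]]. intros [q [H3 H4]].
  exists (fun y => q (g y) * p y). split.
  - apply (clim_mult _); [|exact H1]. eapply (clim_comp _ iy); eauto.
  - destruct H4 as [d [Hd H4]].
    generalize (filter_and _ _ (Cg d Hd) H2). apply filter_imp. intros y [E1 E2].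
    rewrite (H4 _ E1), E2. ring.
Qed.

Lemma cder_pow {X} (io : X -> C) f x a n :
  cder io f x a -> cder io (fun y => f y ^ n) x (INR n * f x ^ (n - 1) * a).
Proof.
  intros Hf. induction n as [|n IH].
  - simpl. eapply cder_eq; [|apply cder_const]. ring.
  - change (fun y => f y ^ S n) with (fun y => f y * f y ^ n).
    eapply cder_eq; [|apply cder_mult; [exact Hf|exact IH]]. cbv beta.
    replace (S n - 1)%nat with n by lia. rewrite S_INR, RtoC_plus.
    destruct n as [|n].
    + simpl. ring.
    + replace (S n - 1)%nat with n by lia. rewrite Cpow_S. ring.
Qed.

Lemma cder_of_littleo {X} (io : X -> C) f x l :
  (forall eps, (0 < eps)%R -> nb io x (fun y =>
     (Cmod (f y - f x - l * (io y - io x)) <= eps * Cmod (io y - io x))%R)) ->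
  cder io f x l.
Proof.
  intros H.
  (* Where [io y = io x] the difference quotient is 0/0; the value [l] keeps [phi] continuous
     there. *)
  exists (fun y => if Ceq_dec (io y) (io x) then l else (f y - f x) / (io y - io x)).
  split.
  - intros eps He. assert (He2 : (0 < eps / 2)%R) by lra.
    generalize (H _ He2). apply filter_imp. intros y Hy.
    destruct (Ceq_dec (io y) (io x)) as [E|E].
    + replace (l - l) with (RtoC 0) by ring. now rewrite Cmod_0.
    + assert (E' := Cminus_eq_contra _ _ E).
      replace ((f y - f x) / (io y - io x) - l)
        with ((f y - f x - l * (io y - io x)) / (io y - io x)) by (field; auto).
      rewrite Cmod_div by auto. apply Cmod_pos in E'.
      apply Rle_lt_trans with (eps / 2)%R; [|lra].
      apply Rmult_le_reg_r with (Cmod (io y - io x)); [lra|].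
      unfold Rdiv at 1. rewrite Rmult_assoc, Rinv_l by lra. rewrite Rmult_1_r. lra.
  - generalize (H 1%R Rlt_0_1). apply filter_imp. intros y Hy.
    destruct (Ceq_dec (io y) (io x)) as [E|E].
    (* The right side of the estimate is 0 at such a point, so it forces [f y = f x]. *)
    + rewrite E in *. replace (io x - io x) with (RtoC 0) in * by ring.
      rewrite Cmod_0, Rmult_0_r in Hy.
      assert (E0 : f y - f x - l * 0 = 0).
      { apply Cmod_eq_0. apply Rle_antisym; [auto|apply Cmod_ge_0]. }
      replace (f y) with (f y - f x - l * 0 + f x) by ring. rewrite E0. ring.
    + assert (E' := Cminus_eq_contra _ _ E). field. auto.
Qed.

Lemma cderC_is_derive (f : C -> C) (z l : C) : is_derive f z l -> cderC f z l.
Proof.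
  intros [_ H]. apply cder_of_littleo. intros eps He.
  specialize (H z (fun P HP => HP) (mkposreal eps He)).
  destruct H as [d Hd]. exists d. split; [apply cond_pos|].
  intros y Hy. unfold idC in *. specialize (Hd y Hy). simpl in Hd.
  replace (f y - f z - l * (y - z)) with (minus (minus (f y) (f z)) (scal (minus y z) l)).
  - exact Hd.
  - unfold minus, plus, opp, scal; simpl. unfold mult; simpl. ring.
Qed.

Lemma RtoC_cont (f : R -> R) (t : R) :
  clim (nb RtoC t) (fun s => RtoC (f s)) (RtoC (f t)) <-> continuous f t.
Proof.
  split.
  - intros H. apply filterlim_locally. intros eps.
    destruct (H eps (cond_pos eps)) as [d [Hd Hf]].
    exists (mkposreal d Hd). intros y Hy.
    specialize (Hf y). rewrite <- !RtoC_minus, !Cmod_R in Hf. apply Hf. exact Hy.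
  - intros H eps He. apply filterlim_locally with (eps := mkposreal eps He) in H.
    destruct H as [d Hd]. exists d. split; [apply cond_pos|].
    intros y Hy. rewrite <- !RtoC_minus, !Cmod_R in *. apply (Hd y Hy).
Qed.

Lemma cderR_of_is_derive (f : R -> R) (t l : R) :
  is_derive f t l -> cderR (fun s => RtoC (f s)) t (RtoC l).
Proof.
  intros [_ H]. apply cder_of_littleo. intros eps He.
  specialize (H t (fun P HP => HP) (mkposreal eps He)).
  destruct H as [d Hd]. exists d. split; [apply cond_pos|].
  intros y Hy. rewrite <- !RtoC_minus, <- RtoC_mult, <- RtoC_minus, !Cmod_R in *.
  replace (f y - f t - l * (y - t))%R with (minus (minus (f y) (f t)) (scal (minus y t) l)).
  - exact (Hd y Hy).
  - unfold minus, plus, opp, scal; simpl. unfold mult; simpl. ring.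
Qed.

Lemma im_le_Cmod (c : C) : (Rabs (Im c) <= Cmod c)%R.
Proof. eapply Rle_trans; [apply Rmax_r|apply Rmax_Cmod]. Qed.

Lemma Re_minus (a b : C) : Re (a - b) = (Re a - Re b)%R.
Proof. unfold Cminus. now rewrite re_plus, re_opp. Qed.

Lemma Im_minus (a b : C) : Im (a - b) = (Im a - Im b)%R.
Proof. unfold Cminus. now rewrite im_plus, im_opp. Qed.

Lemma clim_Re {X} (F : (X -> Prop) -> Prop) {FF : Filter F} f l :
  clim F f l -> clim F (fun x => RtoC (Re (f x))) (RtoC (Re l)).
Proof.
  intros H eps He. generalize (H eps He). apply filter_imp. intros x Hx.
  rewrite <- RtoC_minus, Cmod_R, <- Re_minus.
  eapply Rle_lt_trans; [apply re_le_Cmod|exact Hx].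
Qed.

Lemma clim_Im {X} (F : (X -> Prop) -> Prop) {FF : Filter F} f l :
  clim F f l -> clim F (fun x => RtoC (Im (f x))) (RtoC (Im l)).
Proof.
  intros H eps He. generalize (H eps He). apply filter_imp. intros x Hx.
  rewrite <- RtoC_minus, Cmod_R, <- Im_minus.
  eapply Rle_lt_trans; [apply im_le_Cmod|exact Hx].
Qed.

Lemma Cmod_le_Re_Im (c : C) : (Cmod c <= Rabs (Re c) + Rabs (Im c))%R.
Proof.
  replace c with (RtoC (Re c) + Ci * RtoC (Im c)) at 1.
  - eapply Rle_trans; [apply Cmod_triangle|].
    rewrite Cmod_mult, Cmod_Ci, !Cmod_R. lra.
  - destruct c as [x y]. unfold RtoC, Ci, Cplus, Cmult; simpl. f_equal; ring.
Qed.

Lemma cderR_is_derive_re_im (f : R -> C) t l : cderR f t l ->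
  is_derive (fun s => Re (f s)) t (Re l) /\ is_derive (fun s => Im (f s)) t (Im l).
Proof.
  intros [p [H1 H2]].
  (* [pr] stands for [Re] or [Im]: a real-linear functional bounded by [Cmod]. *)
  assert (K : forall (pr : C -> R), (forall a b : C, pr (a - b) = (pr a - pr b)%R) ->
      (forall (a : C) (r : R), pr (a * r) = (pr a * r)%R) -> (forall a : C, (Rabs (pr a) <= Cmod a)%R) ->
      is_derive (fun s => pr (f s)) t (pr l)).
  { intros pr Hm Hs Hb. split; [apply is_linear_scal_l|].
    intros x Hx. assert (Ex : t = x) by (apply (is_filter_lim_locally_unique (V := R_NormedModule)); exact Hx). subst x.
    intros eps. destruct (filter_and _ _ H2 (H1 eps (cond_pos eps))) as [d [Hd H]].
    exists (mkposreal d Hd). intros y Hy.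
    destruct (H y) as [E1 E2].
    { rewrite <- RtoC_minus, Cmod_R. exact Hy. }
    assert (E : (minus (minus (pr (f y)) (pr (f t))) (scal (minus y t) (pr l))
      = (pr (p y - l)%C * (y - t)))%R).
    { unfold minus, plus, opp, scal; simpl. unfold mult; simpl.
      rewrite <- Hs. rewrite RtoC_minus.
      replace ((p y - l) * (y - t)) with ((f y - f t) - l * (y - t)) by (rewrite E1; ring).
      rewrite Hm, Hm, <- RtoC_minus, Hs. ring. }
    change (Rabs (minus (minus (pr (f y)) (pr (f t))) (scal (minus y t) (pr l)))
      <= eps * Rabs (y - t))%R.
    rewrite E, Rabs_mult. apply Rmult_le_compat_r; [apply Rabs_pos|].
    left. eapply Rle_lt_trans; [apply Hb|exact E2]. }
  split; apply K.
  - apply Re_minus. - intros; apply re_scal_r. - apply re_le_Cmod.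
  - apply Im_minus. - intros; apply im_scal_r. - apply im_le_Cmod.
Qed.

(** The mean value theorem fails for complex values, so it is applied to [Re] and [Im] separately;
    this costs the factor 2, which is harmless everywhere below. *)
Lemma Cmod_diff_le (f f' : R -> C) (a b B : R) : (a <= b)%R ->
  (forall t, (a <= t <= b)%R -> cderR f t (f' t)) ->
  (forall t, (a <= t <= b)%R -> (Cmod (f' t) <= B)%R) ->
  (Cmod (f b - f a) <= 2 * (B * (b - a)))%R.
Proof.
  intros Hab Hd HB.
  assert (K : forall pr : C -> R, (forall a b : C, pr (a - b) = (pr a - pr b)%R) ->
    (forall a : C, (Rabs (pr a) <= Cmod a)%R) ->
    (forall t, (a <= t <= b)%R -> is_derive (fun s => pr (f s)) t (pr (f' t))) ->
    (Rabs (pr (f b - f a)%C) <= B * (b - a))%R).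
  { intros pr Hm Hb Hdd.
    destruct (MVT_gen (fun s => pr (f s)) a b (fun t => pr (f' t))) as [c [Hc E]].
    - intros x Hx. rewrite Rmin_left, Rmax_right in Hx by lra. apply Hdd. lra.
    - intros x Hx. rewrite Rmin_left, Rmax_right in Hx by lra.
      apply continuity_pt_filterlim. apply (ex_derive_continuous (V := R_NormedModule)).
      eexists. apply Hdd. lra.
    - rewrite Rmin_left, Rmax_right in Hc by lra.
      rewrite Hm, E, Rabs_mult, (Rabs_pos_eq (b - a)) by lra.
      apply Rmult_le_compat_r; [lra|]. eapply Rle_trans; [apply Hb|apply HB; auto]. }
  eapply Rle_trans; [apply Cmod_le_Re_Im|].
  assert (H1 := K Re Re_minus re_le_Cmod (fun t Ht => proj1 (cderR_is_derive_re_im _ _ _ (Hd t Ht)))).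
  assert (H2 := K Im Im_minus im_le_Cmod (fun t Ht => proj2 (cderR_is_derive_re_im _ _ _ (Hd t Ht)))).
  lra.
Qed.

Lemma Ceq_of_Cmod_le_0 (a b : C) : (Cmod (a - b) <= 0)%R -> a = b.
Proof. intros H. apply Ceq_minus, Cmod_eq_0, Rle_antisym; [exact H|apply Cmod_ge_0]. Qed.

Lemma cder_0_const (f : R -> C) (a b : R) : (a <= b)%R ->
  (forall t, (a <= t <= b)%R -> cderR f t 0) -> f b = f a.
Proof.
  intros Hab H. apply Ceq_of_Cmod_le_0.
  replace 0%R with (2 * (0 * (b - a)))%R by ring.
  apply (Cmod_diff_le f (fun _ => 0)); auto. intros t _. rewrite Cmod_0. lra.
Qed.

(** * Complex exponential, logarithm and powers *)

Lemma C_eq (a b : C) : Re a = Re b -> Im a = Im b -> a = b.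
Proof. destruct a, b; unfold Re, Im; simpl. now intros -> ->. Qed.

Lemma Cexp_plus (a b : C) : Cexp (a + b) = Cexp a * Cexp b.
Proof.
  destruct a as [a1 a2], b as [b1 b2].
  unfold Cexp, Cplus, Cmult, Re, Im; simpl.
  rewrite exp_plus, cos_plus, sin_plus. f_equal; ring.
Qed.

Lemma Cexp_RtoC (x : R) : Cexp (RtoC x) = RtoC (exp x).
Proof.
  unfold Cexp. rewrite re_RtoC, im_RtoC, cos_0, sin_0.
  apply C_eq; unfold Re, Im, RtoC; simpl; ring.
Qed.

Lemma Cexp_0 : Cexp 0 = 1.
Proof. rewrite Cexp_RtoC, exp_0. reflexivity. Qed.

Lemma Cmod_Cexp (z : C) : Cmod (Cexp z) = exp (Re z).
Proof.
  unfold Cmod, Cexp; simpl fst; simpl snd.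
  replace ((exp (Re z) * cos (Im z)) ^ 2 + (exp (Re z) * sin (Im z)) ^ 2)%R
    with (exp (Re z) ^ 2 * (Rsqr (sin (Im z)) + Rsqr (cos (Im z))))%R by (unfold Rsqr; ring).
  rewrite sin2_cos2, Rmult_1_r. apply sqrt_pow2. left. apply exp_pos.
Qed.

Lemma Cexp_neq_0 (z : C) : Cexp z <> 0.
Proof. apply Cmod_neq_0. rewrite Cmod_Cexp. apply exp_pos. Qed.

Lemma Cexp_opp (z : C) : Cexp (- z) = / Cexp z.
Proof.
  assert (H := Cexp_neq_0 z).
  assert (E : Cexp (- z) * Cexp z = 1).
  { rewrite <- Cexp_plus. replace (- z + z) with (RtoC 0) by ring. apply Cexp_0. }
  replace (Cexp (- z)) with (Cexp (- z) * Cexp z / Cexp z) by (field; auto).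
  rewrite E. field. auto.
Qed.

Lemma real_littleo (f : R -> R) (l : R) : is_derive f 0 l ->
  forall eps, (0 < eps)%R -> exists d, (0 < d)%R /\
    forall x, (Rabs x < d -> Rabs (f x - f 0 - l * x) <= eps * Rabs x)%R.
Proof.
  intros [_ H] eps He.
  specialize (H 0%R (fun P HP => HP) (mkposreal eps He)).
  destruct H as [d Hd]. exists d. split; [apply cond_pos|]. intros x Hx.
  assert (Hx' : (Rabs (x - 0) < d)%R) by (now rewrite Rminus_0_r).
  specialize (Hd x Hx').
  change (Rabs (minus (minus (f x) (f 0)) (scal (minus x 0) l)) <= eps * Rabs (x - 0))%R in Hd.
  replace (Rabs x) with (Rabs (x - 0)) by (now rewrite Rminus_0_r).
  replace (f x - f 0 - l * x)%R with (minus (minus (f x) (f 0)) (scal (minus x 0) l)).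
  - exact Hd.
  - unfold minus, plus, opp, scal; simpl. unfold mult; simpl. ring.
Qed.

(** With [h = x + i y], the remainder is a polynomial in the first-order remainders [u], [v], [w] of
    the real functions [exp], [cos], [sin], each of size at most [e |h|]. *)
Lemma Cexp_littleo (eps : R) : (0 < eps)%R -> exists d : R, (0 < d)%R /\
  forall h : C, (Cmod h < d)%R -> (Cmod (Cexp h - 1 - h) <= eps * Cmod h)%R.
Proof.
  (* The bounds [B1] and [B2] below add up to at most [9 e |h|]; [e <= 1] absorbs the products of
     remainders. *)
  intros He. set (e := Rmin 1 (eps / 16)).
  assert (Hee : (0 < e)%R) by (apply Rmin_glb_lt; lra).
  assert (He1 : (e <= 1)%R) by apply Rmin_l.
  assert (He8 : (e <= eps / 16)%R) by apply Rmin_r.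
  clearbody e.
  assert (D1 : is_derive exp 0 1).
  { apply is_derive_Reals, derivable_pt_lim_exp_0. }
  assert (D2 : is_derive cos 0 0).
  { apply is_derive_Reals. replace 0%R with (- sin 0)%R at 2 by (rewrite sin_0; ring).
    apply derivable_pt_lim_cos. }
  assert (D3 : is_derive sin 0 1).
  { apply is_derive_Reals. rewrite <- cos_0. apply derivable_pt_lim_sin. }
  destruct (real_littleo _ _ D1 _ Hee) as [d1 [Hd1 H1]].
  destruct (real_littleo _ _ D2 _ Hee) as [d2 [Hd2 H2]].
  destruct (real_littleo _ _ D3 _ Hee) as [d3 [Hd3 H3]].
  exists (Rmin (Rmin d1 d2) (Rmin d3 e)).
  split; [repeat apply Rmin_glb_lt; auto|].
  intros h Hh.
  apply Rmin_Rgt_l in Hh as [Hh Hh']. apply Rmin_Rgt_l in Hh as [Hh1 Hh2].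
  apply Rmin_Rgt_l in Hh' as [Hh3 Hh4]. clear D1 D2 D3.
  assert (Hx := re_le_Cmod h). assert (Hy := im_le_Cmod h).
  specialize (H1 (Re h) (Rle_lt_trans _ _ _ Hx Hh1)).
  specialize (H2 (Im h) (Rle_lt_trans _ _ _ Hy Hh2)).
  specialize (H3 (Im h) (Rle_lt_trans _ _ _ Hy Hh3)).
  rewrite exp_0 in H1. rewrite cos_0 in H2. rewrite sin_0 in H3.
  set (x := Re h) in *. set (y := Im h) in *. set (m := Cmod h) in *.
  set (u := (exp x - 1 - 1 * x)%R) in *. set (v := (cos y - 1 - 0 * y)%R) in *.
  set (w := (sin y - 0 - 1 * y)%R) in *.
  assert (Hxe := Rle_trans _ _ _ Hx (Rlt_le _ _ Hh4)).
  assert (Hm : (0 <= m)%R) by apply Cmod_ge_0.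
  assert (Bu : (Rabs u <= e * m)%R).
  { eapply Rle_trans; [exact H1|]. apply Rmult_le_compat_l; lra. }
  assert (Bv : (Rabs v <= e * m)%R).
  { eapply Rle_trans; [exact H2|]. apply Rmult_le_compat_l; lra. }
  assert (Bw : (Rabs w <= e * m)%R).
  { eapply Rle_trans; [exact H3|]. apply Rmult_le_compat_l; lra. }
  assert (Hm1 : (m <= 1)%R) by lra.
  assert (Bux : (Rabs (u + x) <= 2 * e)%R).
  { eapply Rle_trans; [apply Rabs_triang|]. nra. }
  assert (Bem : (e * m <= m)%R).
  { rewrite <- (Rmult_1_l m) at 2. apply Rmult_le_compat_r; auto. }
  eapply Rle_trans; [apply Cmod_le_Re_Im|].
  assert (E1 : Re (Cexp h - 1 - h) = (u + v + (u + x) * v)%R).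
  { rewrite !Re_minus. unfold Cexp, Re, Im, u, v, x, y; simpl. unfold Re, Im. ring. }
  assert (E2 : Im (Cexp h - 1 - h) = (w + (u + x) * (w + y))%R).
  { rewrite !Im_minus. unfold Cexp, Re, Im, u, w, x, y; simpl. unfold Re, Im. ring. }
  rewrite E1, E2.
  assert (B1 : (Rabs (u + v + (u + x) * v) <= e * m + e * m + 2 * e * m)%R).
  { eapply Rle_trans; [apply Rabs_triang|]. apply Rplus_le_compat.
    - eapply Rle_trans; [apply Rabs_triang|]. lra.
    - rewrite Rabs_mult. apply Rmult_le_compat; try apply Rabs_pos; lra. }
  assert (B2 : (Rabs (w + (u + x) * (w + y)) <= e * m + 2 * e * (e * m + m))%R).
  { eapply Rle_trans; [apply Rabs_triang|]. apply Rplus_le_compat; [exact Bw|].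
    rewrite Rabs_mult. apply Rmult_le_compat; try apply Rabs_pos; auto.
    eapply Rle_trans; [apply Rabs_triang|]. lra. }
  assert (B3 : (e * (e * m) <= e * m)%R) by (apply Rmult_le_compat_l; lra).
  assert (B4 : (e * m <= eps / 16 * m)%R) by (apply Rmult_le_compat_r; auto).
  assert (0 <= e * m)%R by (apply Rmult_le_pos; lra).
  lra.
Qed.

Lemma cder_Cexp (z : C) : cderC Cexp z (Cexp z).
Proof.
  apply cder_of_littleo. intros eps He.
  assert (Hp : (0 < Cmod (Cexp z))%R) by apply Cmod_pos, Cexp_neq_0.
  assert (He' : (0 < eps / Cmod (Cexp z))%R) by now apply Rdiv_lt_0_compat.
  destruct (Cexp_littleo _ He') as [d [Hd H]].
  exists d. split; [exact Hd|]. unfold idC. intros y Hy. specialize (H _ Hy).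
  replace (Cexp y) with (Cexp z * Cexp (y - z)).
  2: { rewrite <- Cexp_plus. f_equal. ring. }
  replace (Cexp z * Cexp (y - z) - Cexp z - Cexp z * (y - z))
    with (Cexp z * (Cexp (y - z) - 1 - (y - z))) by ring.
  rewrite Cmod_mult.
  apply Rle_trans with (Cmod (Cexp z) * (eps / Cmod (Cexp z) * Cmod (y - z)))%R.
  - apply Rmult_le_compat_l; [lra|exact H].
  - right. field. lra.
Qed.

Lemma Re_div_Cmod_bound (z : C) : z <> 0 -> (-1 <= Re z / Cmod z <= 1)%R.
Proof.
  intros Hz. apply Cmod_pos in Hz. assert (H := re_le_Cmod z).
  apply Rabs_le_between in H. split.
  - apply Rmult_le_reg_r with (Cmod z); [exact Hz|].
    unfold Rdiv. rewrite Rmult_assoc, Rinv_l by lra. lra.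
  - apply Rmult_le_reg_r with (Cmod z); [exact Hz|].
    unfold Rdiv. rewrite Rmult_assoc, Rinv_l by lra. lra.
Qed.

Lemma cos_Carg (z : C) : z <> 0 -> cos (Carg z) = (Re z / Cmod z)%R.
Proof.
  intros Hz. assert (H := Re_div_Cmod_bound z Hz). unfold Carg.
  destruct (Rlt_dec (Im z) 0); rewrite ?cos_neg, cos_acos; auto.
Qed.

Lemma sin_Carg (z : C) : z <> 0 -> sin (Carg z) = (Im z / Cmod z)%R.
Proof.
  intros Hz. assert (H := Re_div_Cmod_bound z Hz).
  assert (Hp := Cmod_pos _ Hz).
  assert (E : sqrt (1 - (Re z / Cmod z)²) = (Rabs (Im z) / Cmod z)%R).
  { replace (1 - (Re z / Cmod z)²)%R with (Rsqr (Rabs (Im z) / Cmod z)).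
    - apply sqrt_Rsqr. apply Rmult_le_pos; [apply Rabs_pos|].
      left. now apply Rinv_0_lt_compat.
    - rewrite !Rsqr_div', <- Rsqr_abs.
      assert (E := Cmod2_alt z).
      assert (E' : (Rsqr (Cmod z) = Rsqr (Re z) + Rsqr (Im z))%R) by (unfold Rsqr; lra).
      assert (Rsqr (Cmod z) <> 0)%R by (unfold Rsqr; nra).
      apply Rmult_eq_reg_r with (Rsqr (Cmod z)); [|auto].
      field_simplify; [lra| |]; lra. }
  unfold Carg. destruct (Rlt_dec (Im z) 0); rewrite ?sin_neg, sin_acos, E by auto.
  - rewrite Rabs_left by auto. field. lra.
  - rewrite Rabs_pos_eq by lra. reflexivity.
Qed.

Lemma Cexp_Clog (z : C) : z <> 0 -> Cexp (Clog z) = z.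
Proof.
  intros Hz. assert (Hp := Cmod_pos _ Hz).
  unfold Clog, Cexp. apply C_eq; unfold Re at 1, Im at 1; simpl.
  - change (Im (ln (Cmod z), Carg z)) with (Carg z).
    change (Re (ln (Cmod z), Carg z)) with (ln (Cmod z)).
    rewrite exp_ln, cos_Carg by auto. field. lra.
  - change (Im (ln (Cmod z), Carg z)) with (Carg z).
    change (Re (ln (Cmod z), Carg z)) with (ln (Cmod z)).
    rewrite exp_ln, sin_Carg by auto. field. lra.
Qed.

Lemma Rabs_Carg (z : C) : Rabs (Carg z) = acos (Re z / Cmod z).
Proof.
  destruct (acos_bound (Re z / Cmod z)) as [B1 B2]. unfold Carg.
  destruct (Rlt_dec (Im z) 0); rewrite ?Rabs_Ropp; apply Rabs_pos_eq; lra.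
Qed.

Lemma Carg_lt_PI2 (z : C) : z <> 0 -> (Rabs (Carg z) < PI / 2)%R <-> (0 < Re z)%R.
Proof.
  intros Hz. assert (Hp := Cmod_pos _ Hz). assert (H := Re_div_Cmod_bound z Hz).
  assert (EA := Rabs_Carg z). rewrite EA. destruct (acos_bound (Re z / Cmod z)) as [B1 B2].
  assert (C1 := cos_acos _ H). assert (HPI := PI_RGT_0).
  split; intros Hh.
  - assert (0 < Re z / Cmod z)%R by (rewrite <- C1; apply cos_gt_0; lra).
    replace (Re z) with (Re z / Cmod z * Cmod z)%R by (field; lra). nra.
  - apply Rnot_le_lt. intros Hle.
    assert (Hc : (cos (acos (Re z / Cmod z)) <= 0)%R) by (apply cos_le_0; lra).
    rewrite C1 in Hc.
    replace (Re z) with (Re z / Cmod z * Cmod z)%R in Hh by (field; lra). nra.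
Qed.

Lemma Re_pos_neq_0 (z : C) : (0 < Re z)%R -> z <> 0.
Proof. intros H E. rewrite E, re_RtoC in H. lra. Qed.

Lemma Carg_atan (z : C) : (0 < Re z)%R -> Carg z = atan (Im z / Re z).
Proof.
  intros H. assert (Hz := Re_pos_neq_0 _ H). assert (Hp := Cmod_pos _ Hz).
  assert (B := proj2 (Carg_lt_PI2 z Hz) H). apply Rabs_def2 in B.
  rewrite <- (atan_tan (Carg z)) by lra. f_equal.
  unfold tan. rewrite sin_Carg, cos_Carg by auto. field. lra.
Qed.

Lemma Carg_pos_real (t : R) : (0 < t)%R -> Carg (RtoC t) = 0%R.
Proof.
  intros H. rewrite Carg_atan by (rewrite re_RtoC; auto).
  rewrite im_RtoC. unfold Rdiv. rewrite Rmult_0_l. apply atan_0.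
Qed.

Lemma Clog_pos_real (t : R) : (0 < t)%R -> Clog (RtoC t) = RtoC (ln t).
Proof.
  intros H. unfold Clog. rewrite Carg_pos_real, Cmod_R, Rabs_pos_eq by lra.
  reflexivity.
Qed.

Lemma slit_of_Re_pos (z : C) : (0 < Re z)%R -> slit_plane z.
Proof.
  intros H. assert (Hz := Re_pos_neq_0 _ H). split; [exact Hz|].
  assert (B := proj2 (Carg_lt_PI2 z Hz) H). assert (HPI := PI_RGT_0). lra.
Qed.

Lemma slit_of_Im (z : C) : Im z <> 0%R -> slit_plane z.
Proof.
  intros H. assert (Hz : z <> 0) by (intros E; rewrite E, im_RtoC in H; lra).
  split; [exact Hz|].
  assert (HB := Re_div_Cmod_bound z Hz).
  assert (EA := Rabs_Carg z). rewrite EA. destruct (acos_bound (Re z / Cmod z)) as [B1 [B2|B2]]; [exact B2|].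
  exfalso. assert (S := sin_Carg z Hz).
  assert (S0 : sin (Rabs (Carg z)) = 0%R) by (rewrite EA, B2; apply sin_PI).
  assert (Hp := Cmod_pos _ Hz).
  assert (sin (Carg z) = 0)%R.
  { unfold Rabs in S0. destruct (Rcase_abs (Carg z)); [rewrite sin_neg in S0; lra|auto]. }
  apply H. replace (Im z) with (Im z / Cmod z * Cmod z)%R by (field; lra). rewrite <- S, H0. ring.
Qed.

Lemma Cmod_scal_pos (r : R) (e : C) : (0 < r)%R -> Cmod (r * e) = (r * Cmod e)%R.
Proof. intros H. rewrite Cmod_mult, Cmod_R, Rabs_pos_eq; lra. Qed.

Lemma Carg_scal (r : R) (e : C) : (0 < r)%R -> e <> 0 -> Carg (r * e) = Carg e.
Proof.
  intros H He. assert (Hp := Cmod_pos _ He). unfold Carg.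
  rewrite Cmod_scal_pos, re_scal_l, im_scal_l by auto.
  replace (r * Re e / (r * Cmod e))%R with (Re e / Cmod e)%R by (field; lra).
  destruct (Rlt_dec (r * Im e) 0), (Rlt_dec (Im e) 0); auto; exfalso; nra.
Qed.

Lemma continuous_ln (x : R) : (0 < x)%R -> continuous ln x.
Proof.
  intros H. apply (ex_derive_continuous (V := R_NormedModule)).
  exists (/ x)%R. now apply is_derive_ln.
Qed.

Lemma clim_Cmod {X} (F : (X -> Prop) -> Prop) {FF : Filter F} (f : X -> C) (l : C) :
  clim F f l -> clim F (fun x => RtoC (Cmod (f x))) (RtoC (Cmod l)).
Proof.
  intros H eps He. generalize (H eps He). apply filter_imp. intros x Hx.
  rewrite <- RtoC_minus, Cmod_R.
  apply Rabs_def1.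
  - eapply Rle_lt_trans; [apply Cmod_triangle_rev|exact Hx].
  - rewrite Cmod_minus_sym in Hx. assert (h := Cmod_triangle_rev l (f x)). lra.
Qed.

Lemma clim_real_fun {X} (F : (X -> Prop) -> Prop) {FF : Filter F} (h : R -> R)
  (f : X -> R) (l : R) :
  continuous h l -> clim F (fun x => RtoC (f x)) (RtoC l) ->
  clim F (fun x => RtoC (h (f x))) (RtoC (h l)).
Proof.
  intros Hh Hf. apply (clim_comp F RtoC f l (fun y => RtoC (h y))); [exact Hf|].
  now apply RtoC_cont.
Qed.

(** [Carg] is glued from two branches of [acos] along the real axis, which hides its continuity; on
    the right half-plane it equals [atan (Im / Re)]. *)
Lemma clim_Clog (z : C) : (0 < Re z)%R -> clim (nb idC z) Clog (Clog z).
Proof.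
  intros H. assert (Hz := Re_pos_neq_0 _ H). assert (Hp := Cmod_pos _ Hz).
  assert (Hid : clim (nb idC z) (fun y => y) z) by apply (clim_io idC).
  apply (clim_ext _ (fun y => RtoC (ln (Cmod y)) + Ci * RtoC (atan (Im y / Re y)))).
  - generalize (clim_Re _ _ _ Hid (Re z) H). apply filter_imp.
    intros y Hy. rewrite <- RtoC_minus, Cmod_R in Hy. apply Rabs_def2 in Hy.
    rewrite <- Carg_atan by lra. unfold Clog.
    apply C_eq; unfold Re, Im, RtoC, Ci, Cplus, Cmult; simpl; ring.
  - replace (Clog z) with (RtoC (ln (Cmod z)) + Ci * RtoC (atan (Im z / Re z))).
    2: { rewrite <- Carg_atan by lra. unfold Clog.
      apply C_eq; unfold Re, Im, RtoC, Ci, Cplus, Cmult; simpl; ring. }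
    apply (clim_plus _).
    + apply (clim_real_fun _ ln (fun y => Cmod y)); [now apply continuous_ln|].
      now apply (clim_Cmod _).
    + apply (clim_mult _); [apply (clim_const _)|].
      apply (clim_real_fun _ atan (fun y => Im y / Re y)%R).
      { apply continuity_pt_filterlim, derivable_continuous_pt, derivable_pt_atan. }
      apply (clim_ext _ (fun y => RtoC (Im y) / RtoC (Re y))).
      * generalize (clim_Re _ _ _ Hid (Re z) H). apply filter_imp.
        intros y Hy. rewrite <- RtoC_minus, Cmod_R in Hy. apply Rabs_def2 in Hy.
        rewrite RtoC_div; auto. lra.
      * rewrite RtoC_div by lra. apply (clim_div _).
        -- intros E. apply RtoC_inj in E. lra.
        -- now apply (clim_Im _).
        -- now apply (clim_Re _).
Qed.

(** Inverse function rule: since [Cexp (Clog y) = y], the slope of [Clog] is the reciprocal of the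
    slope [p] of [Cexp] taken at [Clog y], and continuity of [Clog] carries this to the limit. *)
Lemma cder_Clog (z : C) : (0 < Re z)%R -> cderC Clog z (/ z).
Proof.
  intros H. assert (Hz := Re_pos_neq_0 _ H).
  assert (HL := clim_Clog z H).
  destruct (cder_Cexp (Clog z)) as [p [H1 H2]].
  assert (H1' := clim_comp (nb idC z) idC Clog (Clog z) p _ HL H1).
  rewrite (Cexp_Clog z Hz) in H1'.
  exists (fun y => / p (Clog y)). split.
  - now apply (clim_inv _).
  - destruct H2 as [d [Hd H2]].
    assert (Hid : clim (nb idC z) (fun y => y) z) by apply (clim_io idC).
    generalize (filter_and _ _ (filter_and _ _ (clim_away _ _ _ Hz H1') (HL d Hd))
      (clim_Re _ _ _ Hid (Re z) H)).
    apply filter_imp. intros y [[Hy1 Hy2] Hy3].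
    rewrite <- RtoC_minus, Cmod_R in Hy3. apply Rabs_def2 in Hy3.
    assert (Hy : y <> 0) by (apply Re_pos_neq_0; lra).
    assert (Hpy : p (Clog y) <> 0).
    { apply Cmod_neq_0. assert (h := Cmod_ge_0 z). lra. }
    specialize (H2 (Clog y) Hy2). rewrite !Cexp_Clog in H2 by auto.
    unfold idC in *.
    assert (E : y - z = p (Clog y) * (Clog y - Clog z)) by (rewrite H2 at 1; ring).
    rewrite E. field. exact Hpy.
Qed.

Lemma cder_Cpower (a z : C) : (0 < Re z)%R ->
  cderC (fun y => Cpower y a) z (a * Cpower z a / z).
Proof.
  intros H. unfold Cpower.
  eapply cder_eq; [|apply (cder_comp idC idC (fun y => a * Clog y) Cexp)].
  2: { apply (cder_scal idC a Clog). now apply cder_Clog. }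
  2: apply cder_Cexp.
  cbv beta. unfold Cdiv. ring.
Qed.

Lemma Cpower_plus (z a b : C) : Cpower z (a + b) = Cpower z a * Cpower z b.
Proof. unfold Cpower. rewrite <- Cexp_plus. f_equal. ring. Qed.

Lemma Cpower_neq_0 (z a : C) : Cpower z a <> 0.
Proof. apply Cexp_neq_0. Qed.

Lemma Cpower_0 (z : C) : Cpower z 0 = 1.
Proof. unfold Cpower. rewrite Cmult_0_l. apply Cexp_0. Qed.

Lemma Cpower_1 (z : C) : z <> 0 -> Cpower z 1 = z.
Proof. intros H. unfold Cpower. rewrite Cmult_1_l. now apply Cexp_Clog. Qed.

Lemma Cpower_opp (z a : C) : Cpower z (- a) = / Cpower z a.
Proof.
  unfold Cpower. replace (- a * Clog z) with (- (a * Clog z)) by ring. apply Cexp_opp.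
Qed.

Lemma Cpower_minus (z a b : C) : Cpower z (a - b) = Cpower z a / Cpower z b.
Proof. unfold Cminus. rewrite Cpower_plus, Cpower_opp. reflexivity. Qed.

Lemma Cpower_INR (z : C) (n : nat) : z <> 0 -> Cpower z (INR n) = z ^ n.
Proof.
  intros H. induction n as [|n IH]; [apply Cpower_0|].
  rewrite S_INR, RtoC_plus, Cpower_plus, IH, Cpower_1, Cpow_S by auto. ring.
Qed.

Lemma Cpower_mult_pos (s t : R) (a : C) : (0 < s)%R -> (0 < t)%R ->
  Cpower (s * t)%R a = Cpower s a * Cpower t a.
Proof.
  intros Hs Ht. unfold Cpower.
  rewrite !Clog_pos_real, ln_mult, RtoC_plus, <- Cexp_plus by (auto; now apply Rmult_lt_0_compat).
  f_equal. ring.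
Qed.

Lemma Cpower_inv_pos (s : R) (a : C) : (0 < s)%R -> Cpower (/ s)%R a = / Cpower s a.
Proof.
  intros Hs. unfold Cpower.
  rewrite !Clog_pos_real, ln_Rinv, RtoC_opp, <- Cexp_opp by (auto; now apply Rinv_0_lt_compat).
  f_equal. ring.
Qed.

Lemma Cpower_RtoC (t x : R) : (0 < t)%R -> Cpower t x = RtoC (Rpower t x).
Proof.
  intros H. unfold Cpower, Rpower. rewrite Clog_pos_real, <- RtoC_mult by auto.
  apply Cexp_RtoC.
Qed.

Lemma Cmod_Cpower_pos (t : R) (a : C) : (0 < t)%R -> Cmod (Cpower t a) = Rpower t (Re a).
Proof.
  intros H. unfold Cpower, Rpower. rewrite Clog_pos_real, Cmod_Cexp, re_scal_r; auto.
Qed.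

Lemma Cmod_Cpower_half (z : C) : z <> 0 -> Cmod (Cpower z (1 / 2)) = sqrt (Cmod z).
Proof.
  intros H. rewrite <- Rpower_sqrt by now apply Cmod_pos.
  unfold Cpower, Rpower. rewrite Cmod_Cexp. f_equal.
  replace (1 / 2) with (RtoC (/ 2)) by (rewrite RtoC_inv by lra; unfold Cdiv; ring).
  rewrite re_scal_l. reflexivity.
Qed.

(** The argument is constant on a ray, so even a non-real exponent contributes only a factor that
    does not depend on [r]. *)
Lemma Cmod_Cpower_ray (r : R) (e a : C) : (0 < r)%R -> e <> 0 ->
  Cmod (Cpower (r * e) a) = (Rpower r (Re a) * Cmod (Cpower e a))%R.
Proof.
  intros Hr He. unfold Cpower, Rpower. rewrite !Cmod_Cexp, <- exp_plus. f_equal.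
  rewrite !re_mult. unfold Clog. rewrite Cmod_scal_pos, Carg_scal by auto.
  unfold Re, Im; simpl. rewrite ln_mult by (auto; now apply Cmod_pos). ring.
Qed.

Lemma cder_Cpower_real (a : C) (t : R) : (0 < t)%R ->
  cderR (fun s : R => Cpower s a) t (a * Cpower t a / t).
Proof.
  intros H.
  eapply cder_eq; [|apply (cder_comp RtoC idC (fun s : R => RtoC s) (fun y => Cpower y a))].
  2: apply cder_io. 2: { apply cder_Cpower. rewrite re_RtoC; auto. }
  ring.
Qed.

Lemma cder_Cexp_real (t : R) : cderR (fun s : R => RtoC (exp (- s))) t (RtoC (- exp (- t))).
Proof.
  apply cderR_of_is_derive. auto_derive; auto. ring.
Qed.

(** * Improper integrals over the positive half-line *)

Definition ccont (f : R -> C) : Prop :=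
  forall t : R, (0 < t)%R -> clim (nb RtoC t) f (f t).

Definition cI (f : R -> C) (a b : R) : C :=
  (RInt (fun t => Re (f t)) a b, RInt (fun t => Im (f t)) a b).

Lemma Re_cI (f : R -> C) (a b : R) : Re (cI f a b) = RInt (fun t => Re (f t)) a b.
Proof. reflexivity. Qed.

Lemma Im_cI (f : R -> C) (a b : R) : Im (cI f a b) = RInt (fun t => Im (f t)) a b.
Proof. reflexivity. Qed.

Definition ends : (R * R -> Prop) -> Prop :=
  filter_prod (at_right 0) (Rbar_locally p_infty).

Global Instance ends_filter : ProperFilter ends.
Proof.
  apply filter_prod_proper.
Qed.

(** Continuity is part of the notion because [RInt] is total: it guarantees that the integrals in
    [cI] exist, on which linearity and the change of bounds rest. *)
Definition improper (f : R -> C) (J : C) : Prop :=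
  ccont f /\ clim ends (fun ab => cI f (fst ab) (snd ab)) J.

Lemma at_right_0 (P : R -> Prop) (d : R) : (0 < d)%R ->
  (forall t, (0 < t < d)%R -> P t) -> at_right 0 P.
Proof.
  intros Hd H. exists (mkposreal d Hd). intros y Hy Hy0. apply H. split; [exact Hy0|].
  assert (Hy' : (Rabs (y - 0) < d)%R) by exact Hy.
  rewrite Rminus_0_r in Hy'. apply Rabs_def2 in Hy'. lra.
Qed.

Lemma ends_intro (P : R * R -> Prop) (d M : R) : (0 < d)%R ->
  (forall a b, (0 < a < d)%R -> (M < b)%R -> P (a, b)) -> ends P.
Proof.
  intros Hd H. apply (Filter_prod _ _ _ (fun a => (0 < a < d)%R) (fun b => (M < b)%R)).
  - apply (at_right_0 _ d Hd). auto.
  - exists M. auto.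
  - intros a b. apply H.
Qed.

Lemma ends_le : ends (fun ab => (0 < fst ab <= snd ab)%R).
Proof. apply (ends_intro _ 1 1); [lra|]. simpl. intros. lra. Qed.

Lemma ccont_re_im (f : R -> C) (t : R) : clim (nb RtoC t) f (f t) ->
  continuous (fun s => Re (f s)) t /\ continuous (fun s => Im (f s)) t.
Proof.
  intros H. split; apply RtoC_cont.
  - now apply (clim_Re _).
  - now apply (clim_Im _).
Qed.

Lemma ccont_ex_RInt (f : R -> C) (a b : R) : ccont f -> (0 < a)%R -> (0 < b)%R ->
  ex_RInt (fun t => Re (f t)) a b /\ ex_RInt (fun t => Im (f t)) a b.
Proof.
  intros H Ha Hb.
  assert (K : forall t, (Rmin a b <= t <= Rmax a b)%R -> (0 < t)%R).
  { intros t Ht. unfold Rmin in Ht. destruct (Rle_dec a b); lra. }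
  split; apply (ex_RInt_continuous (V := R_CompleteNormedModule)); intros t Ht;
    apply (ccont_re_im f t (H t (K t Ht))).
Qed.

Lemma cI_Chasles (f : R -> C) (a b c : R) : ccont f -> (0 < a)%R -> (0 < b)%R -> (0 < c)%R ->
  cI f a b + cI f b c = cI f a c.
Proof.
  intros H Ha Hb Hc.
  destruct (ccont_ex_RInt f a b H Ha Hb). destruct (ccont_ex_RInt f b c H Hb Hc).
  unfold cI, Cplus; simpl. f_equal; now apply (RInt_Chasles (V := R_CompleteNormedModule)).
Qed.

Lemma cI_bound (f : R -> C) (g : R -> R) (a b : R) : ccont f -> (0 < a <= b)%R ->
  (forall t, (0 < t)%R -> continuous g t) ->
  (forall t, (a <= t <= b)%R -> (Cmod (f t) <= g t)%R) ->
  (Cmod (cI f a b) <= 2 * RInt g a b)%R.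
Proof.
  intros H Hab Hg Hfg.
  destruct (ccont_ex_RInt f a b H) as [E1 E2]; try lra.
  assert (E3 : ex_RInt g a b).
  { apply (ex_RInt_continuous (V := R_CompleteNormedModule)). intros t Ht. apply Hg.
    rewrite Rmin_left in Ht; lra. }
  eapply Rle_trans; [apply Cmod_le_Re_Im|]. unfold cI, Re at 1, Im at 1; simpl.
  assert (K : forall h : R -> R, ex_RInt h a b ->
    (forall t, (a <= t <= b)%R -> (Rabs (h t) <= Cmod (f t))%R) ->
    (Rabs (RInt h a b) <= RInt g a b)%R).
  { intros h Hh Hb. eapply Rle_trans; [apply abs_RInt_le; [lra|exact Hh]|].
    apply RInt_le; [lra| |exact E3|].
    - now apply ex_RInt_norm.
    - intros t Ht. eapply Rle_trans; [apply Hb|apply Hfg]; lra. }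
  assert (K1 := K _ E1 (fun t _ => re_le_Cmod (f t))).
  assert (K2 := K _ E2 (fun t _ => im_le_Cmod (f t))).
  lra.
Qed.

Lemma cI_ftc (F f : R -> C) (a b : R) : ccont f ->
  (forall t, (0 < t)%R -> cderR F t (f t)) -> (0 < a)%R -> (0 < b)%R ->
  cI f a b = F b - F a.
Proof.
  intros H HF Ha Hb.
  assert (K : forall t, (Rmin a b <= t <= Rmax a b)%R -> (0 < t)%R).
  { intros t Ht. unfold Rmin in Ht. destruct (Rle_dec a b); lra. }
  apply C_eq; [rewrite Re_minus|rewrite Im_minus]; unfold cI, Re at 1, Im at 1; simpl;
    apply is_RInt_unique.
  - apply (is_RInt_derive (V := R_CompleteNormedModule) (fun t => Re (F t))).
    + intros t Ht. apply cderR_is_derive_re_im. apply HF. auto.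
    + intros t Ht. apply ccont_re_im. apply H. auto.
  - apply (is_RInt_derive (V := R_CompleteNormedModule) (fun t => Im (F t))).
    + intros t Ht. apply cderR_is_derive_re_im. apply HF. auto.
    + intros t Ht. apply ccont_re_im. apply H. auto.
Qed.

Lemma cI_plus (f g : R -> C) (a b : R) : ccont f -> ccont g -> (0 < a)%R -> (0 < b)%R ->
  cI (fun t => f t + g t) a b = cI f a b + cI g a b.
Proof.
  intros Hf Hg Ha Hb.
  destruct (ccont_ex_RInt f a b Hf Ha Hb). destruct (ccont_ex_RInt g a b Hg Ha Hb).
  apply C_eq; [rewrite re_plus|rewrite im_plus]; rewrite ?Re_cI, ?Im_cI.
  - rewrite <- (RInt_plus (V := R_CompleteNormedModule)) by auto.
    apply RInt_ext. intros. apply re_plus.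
  - rewrite <- (RInt_plus (V := R_CompleteNormedModule)) by auto.
    apply RInt_ext. intros. apply im_plus.
Qed.

Lemma cI_scal (c : C) (f : R -> C) (a b : R) : ccont f -> (0 < a)%R -> (0 < b)%R ->
  cI (fun t => c * f t) a b = c * cI f a b.
Proof.
  intros Hf Ha Hb. destruct (ccont_ex_RInt f a b Hf Ha Hb) as [E1 E2].
  assert (K : forall k l : R,
    (RInt (fun t => k * Re (f t) + l * Im (f t)) a b =
     k * RInt (fun t => Re (f t)) a b + l * RInt (fun t => Im (f t)) a b)%R).
  { intros k l.
    rewrite (RInt_plus (V := R_CompleteNormedModule) (fun t => k * Re (f t))%R
      (fun t => l * Im (f t))%R).
    - unfold plus; simpl. f_equal.
      + apply (RInt_scal (V := R_CompleteNormedModule)). exact E1.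
      + apply (RInt_scal (V := R_CompleteNormedModule)). exact E2.
    - apply (ex_RInt_scal (V := R_NormedModule)). exact E1.
    - apply (ex_RInt_scal (V := R_NormedModule)). exact E2. }
  apply C_eq; [rewrite re_mult|rewrite im_mult]; rewrite ?Re_cI, ?Im_cI.
  - transitivity (RInt (fun t => Re c * Re (f t) + - Im c * Im (f t))%R a b).
    + assert (E : forall t, (Re (c * f t) = Re c * Re (f t) + - Im c * Im (f t))%R)
        by (intros; rewrite re_mult; ring).
      apply RInt_ext. intros; apply E.
    + rewrite K. ring.
  - transitivity (RInt (fun t => Im c * Re (f t) + Re c * Im (f t))%R a b).
    + assert (E : forall t, (Im (c * f t) = Im c * Re (f t) + Re c * Im (f t))%R)
        by (intros; rewrite im_mult; ring).
      apply RInt_ext. intros; apply E.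
    + rewrite K. ring.
Qed.

Lemma cI_ext (f g : R -> C) (a b : R) : (0 < a)%R -> (0 < b)%R ->
  (forall t, (0 < t)%R -> f t = g t) -> cI f a b = cI g a b.
Proof.
  intros Ha Hb H. assert (0 < Rmin a b)%R by now apply Rmin_glb_lt.
  unfold cI. f_equal; apply RInt_ext; intros t Ht; rewrite H; auto; lra.
Qed.

Lemma ccont_ext (f g : R -> C) : (forall t, (0 < t)%R -> f t = g t) -> ccont f -> ccont g.
Proof.
  intros E H t Ht. rewrite <- E by auto.
  apply (clim_ext _ f); [|apply H; auto].
  exists t. split; [exact Ht|]. intros y Hy. apply E.
  rewrite <- RtoC_minus, Cmod_R in Hy. apply Rabs_def2 in Hy. lra.
Qed.

Lemma ccont_plus (f g : R -> C) : ccont f -> ccont g -> ccont (fun t => f t + g t).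
Proof. intros Hf Hg t Ht. apply (clim_plus _); auto. Qed.

Lemma ccont_minus (f g : R -> C) : ccont f -> ccont g -> ccont (fun t => f t - g t).
Proof. intros Hf Hg t Ht. apply (clim_minus _); auto. Qed.

Lemma ccont_mult (f g : R -> C) : ccont f -> ccont g -> ccont (fun t => f t * g t).
Proof. intros Hf Hg t Ht. apply (clim_mult _); auto. Qed.

Lemma ccont_const (c : C) : ccont (fun _ => c).
Proof. intros t Ht. apply (clim_const _). Qed.

Lemma ccont_io : ccont (fun t => RtoC t).
Proof. intros t Ht. apply (clim_io RtoC). Qed.

Lemma ccont_pow (f : R -> C) (n : nat) : ccont f -> ccont (fun t => f t ^ n).
Proof.
  intros H. induction n as [|n IH]; [exact (ccont_const 1)|].
  apply (ccont_mult f (fun t => f t ^ n)); auto.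
Qed.

Lemma ccont_cder (f f' : R -> C) :
  (forall t, (0 < t)%R -> cderR f t (f' t)) -> ccont f.
Proof. intros H t Ht. apply (cder_cont _ _ _ _ (H t Ht)). Qed.

Lemma ccont_Cpower (a : C) : ccont (fun t : R => Cpower t a).
Proof. apply (ccont_cder _ (fun t => a * Cpower t a / t)). apply cder_Cpower_real. Qed.

Lemma improper_ext (f g : R -> C) (J : C) :
  (forall t, (0 < t)%R -> f t = g t) -> improper f J -> improper g J.
Proof.
  intros E [H1 H2]. split; [now apply (ccont_ext f)|].
  apply (clim_ext _ (fun ab => cI f (fst ab) (snd ab))); [|exact H2].
  generalize ends_le. apply filter_imp. intros [a b]; simpl. intros Hab.
  apply cI_ext; auto; lra.
Qed.

Lemma improper_plus (f g : R -> C) (J I : C) :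
  improper f J -> improper g I -> improper (fun t => f t + g t) (J + I).
Proof.
  intros [F1 F2] [G1 G2]. split; [now apply ccont_plus|].
  apply (clim_ext _ (fun ab => cI f (fst ab) (snd ab) + cI g (fst ab) (snd ab))).
  - generalize ends_le. apply filter_imp. intros [a b]; simpl. intros Hab.
    symmetry. apply cI_plus; auto; lra.
  - now apply (clim_plus _).
Qed.

Lemma improper_scal (c : C) (f : R -> C) (J : C) :
  improper f J -> improper (fun t => c * f t) (c * J).
Proof.
  intros [F1 F2]. split; [apply ccont_mult; [apply ccont_const|exact F1]|].
  apply (clim_ext _ (fun ab => c * cI f (fst ab) (snd ab))).
  - generalize ends_le. apply filter_imp. intros [a b]; simpl. intros Hab.
    symmetry. apply cI_scal; auto; lra.
  - apply (clim_mult _); [apply (clim_const _)|exact F2].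
Qed.

Lemma improper_minus (f g : R -> C) (J I : C) :
  improper f J -> improper g I -> improper (fun t => f t - g t) (J - I).
Proof.
  intros Hf Hg. replace (J - I) with (J + (- (1)) * I) by ring.
  apply (improper_ext (fun t => f t + (- (1)) * g t)); [intros; ring|].
  apply improper_plus; [exact Hf|now apply improper_scal].
Qed.

Lemma improper_unique (f : R -> C) (J I : C) : improper f J -> improper f I -> J = I.
Proof. intros [_ H] [_ H']. now apply (clim_unique ends _ _ _ H). Qed.

Lemma improper_ftc (F f : R -> C) (la lb : C) : ccont f ->
  (forall t, (0 < t)%R -> cderR F t (f t)) ->
  clim (at_right 0) F la -> clim (Rbar_locally p_infty) F lb ->
  improper f (lb - la).
Proof.
  intros Hf HF Ha Hb. split; [exact Hf|].
  apply (clim_ext _ (fun ab => F (snd ab) - F (fst ab))).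
  - generalize ends_le. apply filter_imp. intros [a b]; simpl. intros Hab.
    symmetry. apply cI_ftc; auto; lra.
  - apply (clim_minus _).
    + intros eps He. apply (Filter_prod _ _ _ (fun _ => True) (fun b => (Cmod (F b - lb) < eps)%R)).
      * apply filter_true.
      * apply Hb; exact He.
      * auto.
    + intros eps He. apply (Filter_prod _ _ _ (fun a => (Cmod (F a - la) < eps)%R) (fun _ => True)).
      * apply Ha; exact He.
      * apply filter_true.
      * auto.
Qed.

(** Comparison with a majorant that is itself an improper integral of known value; needed for
    Chebyshev's inequality. *)
Lemma improper_le (f g : R -> C) (J I : C) : improper f J -> improper g I ->
  (forall t, (0 < t)%R -> (Cmod (f t) <= Re (g t))%R) -> (Cmod J <= 2 * Re I)%R.
Proof.
  intros [F1 F2] [G1 G2] H. apply Rnot_lt_le. intros Hlt.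
  (* An error [e] in [J] and [2 e] in [2 Re I] together use up the assumed gap [3 e]. *)
  set (e := ((Cmod J - 2 * Re I) / 3)%R). assert (He : (0 < e)%R) by (unfold e; lra).
  destruct (filter_ex _ (filter_and _ _ ends_le (filter_and _ _ (F2 e He) (G2 e He))))
    as [[a b] [Hab [H1 H2]]]. simpl in *.
  assert (B : (Cmod (cI f a b) <= 2 * Re (cI g a b))%R).
  { apply (cI_bound f (fun t => Re (g t))); auto.
    - intros t Ht. apply ccont_re_im. auto.
    - intros t Ht. apply H. lra. }
  assert (B1 := re_le_Cmod (cI g a b - I)). rewrite Re_minus in B1.
  apply Rabs_le_between in B1.
  rewrite Cmod_minus_sym in H1. assert (B2 := Cmod_triangle_rev J (cI f a b)).
  unfold e in *. lra.
Qed.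

(** * Domination by the weights [om e] *)

(* [om e] is integrable on the half-line, with bounded primitive [Om e]; it is
   comparable to [t^(e-1)] at [0] and to [t^(-e-1)] at infinity. *)
Definition om (e t : R) : R := (Rpower t (e - 1) / (1 + Rpower t e) ^ 2)%R.

Definition Om (e t : R) : R := (/ e * (1 - / (1 + Rpower t e)))%R.

Lemma Rpower_pos (x y : R) : (0 < Rpower x y)%R.
Proof. apply exp_pos. Qed.

Lemma om_pos (e t : R) : (0 < om e t)%R.
Proof.
  unfold om. apply Rdiv_lt_0_compat; [apply Rpower_pos|].
  apply pow_lt. assert (h := Rpower_pos t e). lra.
Qed.

Lemma is_derive_Rpower (e t : R) : (0 < t)%R ->
  is_derive (fun s => Rpower s e) t (e * Rpower t (e - 1))%R.
Proof. intros H. apply is_derive_Reals. now apply derivable_pt_lim_power. Qed.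

Lemma is_derive_Om (e t : R) : (0 < e)%R -> (0 < t)%R -> is_derive (Om e) t (om e t).
Proof.
  intros He Ht. assert (h := Rpower_pos t e). unfold Om.
  assert (D := is_derive_Rpower e t Ht).
  assert (Ex : ex_derive (fun s => Rpower s e) t) by (eexists; exact D).
  auto_derive.
  - repeat split; auto. lra.
  - unfold om.
    replace (Derive (fun x : R => Rpower x e) t) with (e * Rpower t (e - 1))%R
      by (symmetry; now apply is_derive_unique).
    field. lra.
Qed.

Lemma continuous_om (e t : R) : (0 < t)%R -> continuous (om e) t.
Proof.
  intros Ht. assert (h := Rpower_pos t e).
  apply (ex_derive_continuous (V := R_NormedModule)).
  assert (Ex : ex_derive (fun s => Rpower s e) t) by (eexists; now apply is_derive_Rpower).
  assert (Ex' : ex_derive (fun s => Rpower s (e - 1)) t) by (eexists; now apply is_derive_Rpower).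
  unfold om. auto_derive. repeat split; auto. apply Rgt_not_eq. nra.
Qed.

Lemma RInt_om (e a b : R) : (0 < e)%R -> (0 < a <= b)%R ->
  RInt (om e) a b = (Om e b - Om e a)%R.
Proof.
  intros He Hab. apply is_RInt_unique.
  apply (is_RInt_derive (V := R_CompleteNormedModule) (Om e)); intros t Ht;
    rewrite Rmin_left in Ht by lra.
  - apply is_derive_Om; lra.
  - apply continuous_om; lra.
Qed.

Lemma Om_bounds (e t : R) : (0 < e)%R -> (0 < Om e t < / e)%R.
Proof.
  intros He. assert (h := Rpower_pos t e). assert (h' := Rinv_0_lt_compat _ He).
  assert (h2 : (0 < / (1 + Rpower t e) < 1)%R).
  { split; [apply Rinv_0_lt_compat; lra|]. rewrite <- Rinv_1 at 2.
    apply Rinv_lt_contravar; lra. }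
  unfold Om. split; nra.
Qed.

Lemma Rpower_small (e eps : R) : (0 < e)%R -> (0 < eps)%R ->
  exists d, (0 < d)%R /\ forall t, (0 < t < d)%R -> (Rpower t e < eps)%R.
Proof.
  intros He Heps. exists (Rpower eps (/ e)). split; [apply Rpower_pos|].
  intros t Ht. replace eps with (Rpower (Rpower eps (/ e)) e).
  - apply Rlt_Rpower_l; auto.
  - rewrite Rpower_mult, Rinv_l, Rpower_1 by lra. reflexivity.
Qed.

Lemma Rpower_large (e B : R) : (0 < e)%R -> (0 < B)%R ->
  exists M, (0 < M)%R /\ forall t, (M < t)%R -> (B < Rpower t e)%R.
Proof.
  intros He HB. exists (Rpower B (/ e)). split; [apply Rpower_pos|].
  intros t Ht. replace B with (Rpower (Rpower B (/ e)) e).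
  - apply Rlt_Rpower_l; auto. split; [apply Rpower_pos|auto].
  - rewrite Rpower_mult, Rinv_l, Rpower_1 by lra. reflexivity.
Qed.

Lemma Om_0 (e eps : R) : (0 < e)%R -> (0 < eps)%R ->
  exists d, (0 < d)%R /\ forall t, (0 < t < d)%R -> (Om e t < eps)%R.
Proof.
  intros He Heps. destruct (Rpower_small e (e * eps)) as [d [Hd H]]; auto; [nra|].
  exists d. split; [exact Hd|]. intros t Ht. specialize (H t Ht).
  assert (h := Rpower_pos t e). assert (h' := Rinv_0_lt_compat _ He).
  unfold Om. replace (1 - / (1 + Rpower t e))%R with (Rpower t e / (1 + Rpower t e))%R by (field; lra).
  apply Rmult_lt_reg_l with e; [exact He|]. rewrite <- Rmult_assoc, Rinv_r, Rmult_1_l by lra.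
  eapply Rle_lt_trans; [|exact H].
  apply Rmult_le_reg_r with (1 + Rpower t e)%R; [lra|].
  unfold Rdiv. rewrite Rmult_assoc, Rinv_l by lra. nra.
Qed.

Lemma Om_oo (e eps : R) : (0 < e)%R -> (0 < eps)%R ->
  exists M, (0 < M)%R /\ forall t, (M < t)%R -> (/ e - eps < Om e t)%R.
Proof.
  intros He Heps. assert (h' := Rinv_0_lt_compat _ He).
  assert (Hee : (0 < e * eps)%R) by nra. assert (hee := Rinv_0_lt_compat _ Hee).
  destruct (Rpower_large e (/ (e * eps))) as [M [HM H]]; auto.
  exists M. split; [exact HM|]. intros t Ht. specialize (H t Ht).
  assert (h := Rpower_pos t e). unfold Om.
  assert (/ (1 + Rpower t e) < e * eps)%R.
  { rewrite <- (Rinv_inv (e * eps)). apply Rinv_lt_contravar; nra. }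
  assert (/ e * / (1 + Rpower t e) < / e * (e * eps))%R by (apply Rmult_lt_compat_l; auto).
  replace (/ e * (e * eps))%R with eps in * by (field; lra). lra.
Qed.

Lemma cI_bound_om (f : R -> C) (e D a b : R) : ccont f -> (0 < e)%R -> (0 < a <= b)%R ->
  (forall t, (0 < t)%R -> (Cmod (f t) <= D * om e t)%R) ->
  (Cmod (cI f a b) <= 2 * (D * (Om e b - Om e a)))%R.
Proof.
  intros Hf He Hab H. rewrite <- RInt_om by auto.
  replace (D * RInt (om e) a b)%R with (RInt (fun t => D * om e t)%R a b).
  - apply cI_bound; auto.
    + intros t Ht. apply (continuous_scal_r (V := R_NormedModule)). now apply continuous_om.
    + intros t Ht. apply H. lra.
  - apply (RInt_scal (V := R_CompleteNormedModule)).
    apply (ex_RInt_continuous (V := R_CompleteNormedModule)). intros t Ht.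
    apply continuous_om. rewrite Rmin_left in Ht; lra.
Qed.

Definition integr (e : R) (f : R -> C) : Prop :=
  ccont f /\ exists D, forall t, (0 < t)%R -> (Cmod (f t) <= D * om e t)%R.

Lemma integr_pos (e : R) (f : R -> C) : integr e f ->
  exists D, (0 < D)%R /\ forall t, (0 < t)%R -> (Cmod (f t) <= D * om e t)%R.
Proof.
  intros [_ [D H]]. assert (h := Rabs_pos D). exists (Rabs D + 1)%R. split; [lra|].
  intros t Ht. eapply Rle_trans; [apply H; auto|]. apply Rmult_le_compat_r; [left; apply om_pos|].
  assert (h' := Rle_abs D). lra.
Qed.

(** Two integrals differ by pieces near 0 and near infinity, on which the primitive [Om e] varies
    little: it tends to 0 at one end and to [1 / e] at the other. Each piece costs
    [2 D (eps / (8 D)) = eps / 4]. *)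
Lemma cI_cauchy (f : R -> C) (e eps : R) : (0 < e)%R -> integr e f -> (0 < eps)%R ->
  exists P, ends P /\ forall u v, P u -> P v ->
    (Cmod (cI f (fst u) (snd u) - cI f (fst v) (snd v)) < eps)%R.
Proof.
  intros He HI Heps. destruct (integr_pos e f HI) as [D [HD H]]. destruct HI as [Hf _].
  assert (Hq : (0 < eps / (8 * D))%R) by (apply Rdiv_lt_0_compat; lra).
  destruct (Om_0 e _ He Hq) as [d [Hd H1]].
  destruct (Om_oo e _ He Hq) as [M [HM H2]].
  assert (K : forall a b B, (0 < a)%R -> (0 < b)%R -> (Rabs (Om e b - Om e a) < B)%R ->
    (Cmod (cI f a b) < 2 * (D * B))%R).
  { intros a b B Ha Hb HB. destruct (Rle_dec a b) as [L|L].
    - eapply Rle_lt_trans; [apply (cI_bound_om f e D); auto|].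
      apply Rmult_lt_compat_l; [lra|]. apply Rmult_lt_compat_l; [lra|].
      apply Rabs_def2 in HB. lra.
    - replace (cI f a b) with (- cI f b a).
      + rewrite Cmod_opp. eapply Rle_lt_trans; [apply (cI_bound_om f e D); auto; lra|].
        apply Rmult_lt_compat_l; [lra|]. apply Rmult_lt_compat_l; [lra|].
        apply Rabs_def2 in HB. lra.
      + assert (E := cI_Chasles f a b a Hf Ha Hb Ha).
        assert (E' : cI f a a = 0) by (unfold cI; rewrite !RInt_point; reflexivity).
        rewrite E' in E. replace (cI f a b) with (cI f a b + cI f b a - cI f b a) by ring.
        rewrite E. ring. }
  exists (fun ab => (0 < fst ab < d /\ M < snd ab)%R). split.
  { apply (ends_intro _ d M Hd). simpl. auto. }
  intros [a b] [a' b']; simpl. intros [Ha Hb] [Ha' Hb'].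
  assert (E : cI f a b - cI f a' b' = cI f a a' - cI f b b').
  { rewrite <- (cI_Chasles f a a' b), <- (cI_Chasles f a' b b') by (auto; lra). ring. }
  rewrite E.
  assert (O1 := Om_bounds e a He). assert (O2 := Om_bounds e a' He).
  assert (O3 := Om_bounds e b He). assert (O4 := Om_bounds e b' He).
  assert (P1 := H1 a Ha). assert (P2 := H1 a' Ha').
  assert (P3 := H2 b Hb). assert (P4 := H2 b' Hb').
  assert (Q1 : (Cmod (cI f a a') < 2 * (D * (eps / (8 * D))))%R).
  { apply K; try lra. apply Rabs_def1; lra. }
  assert (Q2 : (Cmod (cI f b b') < 2 * (D * (eps / (8 * D))))%R).
  { apply K; try lra. apply Rabs_def1; lra. }
  replace (2 * (D * (eps / (8 * D))))%R with (eps / 4)%R in Q1, Q2 by (field; lra).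
  eapply Rle_lt_trans; [apply Cmod_triangle|]. rewrite Cmod_opp. lra.
Qed.

Lemma improper_ex (f : R -> C) (e : R) : (0 < e)%R -> integr e f -> exists J, improper f J.
Proof.
  intros He Hf.
  assert (K : forall pr : C -> R, (forall a b : C, pr (a - b) = (pr a - pr b)%R) ->
    (forall a : C, (Rabs (pr a) <= Cmod a)%R) ->
    exists l, filterlim (fun ab => pr (cI f (fst ab) (snd ab))) ends (locally l)).
  { intros pr Hm Hb.
    apply (filterlim_locally_cauchy (U := R_CompleteSpace) (F := ends)).
    intros eps. destruct (cI_cauchy f e eps He Hf (cond_pos eps)) as [P [HP H]].
    exists P. split; [exact HP|]. intros u v Hu Hv.
    change (Rabs (pr (cI f (fst v) (snd v)) - pr (cI f (fst u) (snd u))) < eps)%R.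
    rewrite <- Hm. eapply Rle_lt_trans; [apply Hb|]. auto. }
  destruct (K Re Re_minus re_le_Cmod) as [l1 L1].
  destruct (K Im Im_minus im_le_Cmod) as [l2 L2].
  exists (l1, l2). split; [apply Hf|].
  intros eps Heps. assert (He2 : (0 < eps / 2)%R) by lra.
  rewrite filterlim_locally in L1, L2.
  generalize (filter_and _ _ (L1 (mkposreal _ He2)) (L2 (mkposreal _ He2))).
  apply filter_imp. intros ab [B1 B2].
  change (Rabs (Re (cI f (fst ab) (snd ab)) - l1) < eps / 2)%R in B1.
  change (Rabs (Im (cI f (fst ab) (snd ab)) - l2) < eps / 2)%R in B2.
  eapply Rle_lt_trans; [apply Cmod_le_Re_Im|]. rewrite Re_minus, Im_minus.
  change (Re (l1, l2)) with l1. change (Im (l1, l2)) with l2. lra.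
Qed.

Lemma improper_bound (f : R -> C) (J : C) (e D : R) : (0 < e)%R -> (0 <= D)%R -> improper f J ->
  (forall t, (0 < t)%R -> (Cmod (f t) <= D * om e t)%R) -> (Cmod J <= 2 * (D * / e))%R.
Proof.
  intros He HD [F1 F2] H. apply (clim_Cmod_le ends _ _ _ F2).
  generalize ends_le. apply filter_imp. intros [a b]; simpl. intros Hab.
  eapply Rle_trans; [apply (cI_bound_om f e D); auto|].
  assert (O1 := Om_bounds e a He). assert (O2 := Om_bounds e b He).
  apply Rmult_le_compat_l; [lra|]. apply Rmult_le_compat_l; lra.
Qed.

(** A total function is wanted, so that a transform can be differentiated in its parameter; the
    value is unspecified when the integral diverges. *)
Definition impI (f : R -> C) : C := epsilon (inhabits (RtoC 0)) (improper f).

Lemma impI_unique (f : R -> C) (J : C) : improper f J -> impI f = J.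
Proof.
  intros H. apply (improper_unique f); [|exact H].
  unfold impI. apply epsilon_spec. now exists J.
Qed.

Lemma impI_correct (f : R -> C) (e : R) : (0 < e)%R -> integr e f -> improper f (impI f).
Proof.
  intros He H. destruct (improper_ex f e He H) as [J HJ]. now rewrite (impI_unique f J HJ).
Qed.

Lemma improper_is_RInt_gen (f : R -> C) (J : C) : improper f J ->
  is_RInt_gen (V := C_R_NormedModule) f (at_right 0) (Rbar_locally p_infty) J.
Proof.
  intros [F1 F2] P [eps HP].
  generalize (filter_and _ _ ends_le (F2 eps (cond_pos eps))).
  unfold filtermapi. apply filter_imp. intros [a b] [Hab HJ]. simpl in *.
  exists (cI f a b). split.
  - destruct (ccont_ex_RInt f a b F1) as [E1 E2]; try lra.
    apply (is_RInt_fct_extend_pair (U := R_NormedModule) (V := R_NormedModule)).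
    + exact (RInt_correct _ _ _ E1).
    + exact (RInt_correct _ _ _ E2).
  - apply HP. apply C_NormedModule_mixin_compat1. exact HJ.
Qed.

(** * Mellin and Stieltjes transforms of rapidly decreasing functions *)

(** One family of bounds describes both ends: a singularity of order at most [rho] at 0, and decay
    faster than every power at infinity. *)
Definition rapid (rho : R) (f : R -> C) : Prop :=
  ccont f /\ forall m : nat, exists D : R, forall t : R, (0 < t)%R ->
    (Cmod (f t) * (1 + t) ^ m <= D * Rpower t (- rho))%R.

Lemma rapid_mult (rho : R) (f g : R -> C) (B : R) (k : nat) :
  ccont g -> (0 <= B)%R -> (forall t, (0 < t)%R -> (Cmod (g t) <= B * (1 + t) ^ k)%R) ->
  rapid rho f -> rapid rho (fun t => g t * f t).
Proof.
  intros Hg HB H [F1 F2]. split; [now apply ccont_mult|].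
  intros m. destruct (F2 (k + m)%nat) as [D HD]. exists (B * D)%R. intros t Ht.
  specialize (HD t Ht). specialize (H t Ht). rewrite Cmod_mult.
  rewrite pow_add in HD.
  assert (Hp : (0 <= (1 + t) ^ m)%R) by (apply pow_le; lra).
  assert (h := Cmod_ge_0 (f t)).
  apply Rle_trans with (B * (1 + t) ^ k * (Cmod (f t) * (1 + t) ^ m))%R.
  - rewrite Rmult_assoc. apply Rmult_le_compat_r; [now apply Rmult_le_pos|exact H].
  - replace (B * (1 + t) ^ k * (Cmod (f t) * (1 + t) ^ m))%R
      with (B * (Cmod (f t) * ((1 + t) ^ k * (1 + t) ^ m)))%R by ring.
    rewrite Rmult_assoc. now apply Rmult_le_compat_l.
Qed.

Lemma rapid_quad (rho : R) (f : R -> C) (c : C) :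
  rapid rho f -> rapid rho (fun t => (RtoC t ^ 2 + c) * f t).
Proof.
  apply (rapid_mult rho f (fun t => RtoC t ^ 2 + c) (1 + Cmod c) 2).
  - apply ccont_plus; [apply (ccont_pow _ 2), ccont_io|apply ccont_const].
  - assert (h := Cmod_ge_0 c). lra.
  - intros t Ht. eapply Rle_trans; [apply Cmod_triangle|].
    rewrite Cmod_pow, Cmod_R, Rabs_pos_eq by lra. assert (h := Cmod_ge_0 c). simpl. nra.
Qed.

Lemma rapid_dom (rho : R) (f : R -> C) (a : C) : rapid rho f -> (0 < Re a - rho + 1)%R ->
  exists D, (0 <= D)%R /\ forall t, (0 < t)%R ->
    (Cmod (Cpower t a * f t) <= D * om (Re a - rho + 1) t)%R.
Proof.
  intros [F1 F2] He. set (e := (Re a - rho + 1)%R) in *.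
  (* [m >= 2 e] gives [(1 + t^e)^2 <= 4 (1 + t)^(2 e) <= 4 (1 + t)^m], which turns the decay of [f]
     into the denominator of [om e]. *)
  destruct (nfloor_ex (2 * e)%R) as [n [_ Hn]]; [lra|].
  set (m := (n + 1)%nat). destruct (F2 m) as [D0 H0].
  assert (Hm : (2 * e <= INR m)%R) by (unfold m; rewrite plus_INR; simpl; lra).
  exists (4 * Rabs D0)%R. split; [assert (h := Rabs_pos D0); lra|].
  intros t Ht. specialize (H0 t Ht).
  assert (H1 : (Cmod (f t) * (1 + t) ^ m <= Rabs D0 * Rpower t (- rho))%R).
  { eapply Rle_trans; [exact H0|]. apply Rmult_le_compat_r; [left; apply Rpower_pos|apply Rle_abs]. }
  assert (Hp : (0 < (1 + t) ^ m)%R) by (apply pow_lt; lra).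
  rewrite Cmod_mult, Cmod_Cpower_pos by auto. unfold om.
  assert (hp := Rpower_pos t e).
  assert (K : ((1 + Rpower t e) ^ 2 <= 4 * (1 + t) ^ m)%R).
  { assert (A1 : (Rpower t e <= Rpower (1 + t) e)%R) by (apply Rle_Rpower_l; lra).
    assert (A2 : (1 <= Rpower (1 + t) e)%R).
    { apply Rle_trans with (Rpower (1 + t) 0); [right; symmetry; apply Rpower_O; lra|].
      apply Rle_Rpower; lra. }
    assert (A3 : (Rpower (1 + t) e ^ 2 <= (1 + t) ^ m)%R).
    { rewrite <- Rpower_pow, <- Rpower_pow by (try apply Rpower_pos; lra).
      rewrite Rpower_mult. apply Rle_Rpower; [lra|]. simpl INR at 1. lra. }
    nra. }
  assert (Hq : (0 < (1 + Rpower t e) ^ 2)%R) by (apply pow_lt; lra).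
  apply Rmult_le_reg_r with ((1 + t) ^ m)%R; [exact Hp|].
  apply Rle_trans with (Rpower t (Re a) * (Rabs D0 * Rpower t (- rho)))%R.
  { rewrite Rmult_assoc. apply Rmult_le_compat_l; [left; apply Rpower_pos|exact H1]. }
  replace (Rpower t (Re a) * (Rabs D0 * Rpower t (- rho)))%R with (Rabs D0 * Rpower t (e - 1))%R.
  2: { replace (e - 1)%R with (Re a + - rho)%R by (unfold e; ring). rewrite Rpower_plus. ring. }
  apply Rmult_le_reg_r with ((1 + Rpower t e) ^ 2)%R; [exact Hq|].
  replace (4 * Rabs D0 * (Rpower t (e - 1) / (1 + Rpower t e) ^ 2) * (1 + t) ^ m * (1 + Rpower t e) ^ 2)%R
    with (Rabs D0 * Rpower t (e - 1) * (4 * (1 + t) ^ m))%R by (field; lra).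
  apply Rmult_le_compat_l; [|exact K].
  apply Rmult_le_pos; [apply Rabs_pos|left; apply Rpower_pos].
Qed.

Lemma rapid_integr (rho : R) (f g : R -> C) (a : C) (B : R) :
  rapid rho f -> (0 < Re a - rho + 1)%R -> ccont g ->
  (forall t, (0 < t)%R -> (Cmod (g t) <= B)%R) ->
  integr (Re a - rho + 1) (fun t => Cpower t a * f t * g t).
Proof.
  intros Hf He Hg HB. destruct (rapid_dom rho f a Hf He) as [D [HD H]]. split.
  - apply ccont_mult; [apply ccont_mult; [apply ccont_Cpower|apply Hf]|exact Hg].
  - exists (D * B)%R. intros t Ht. rewrite Cmod_mult.
    replace (D * B * om (Re a - rho + 1) t)%R with (D * om (Re a - rho + 1) t * B)%R by ring.
    apply Rmult_le_compat; auto; apply Cmod_ge_0.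
Qed.

(** * Integration by parts for [theta] *)

Definition is_theta (h k : R -> C) : Prop :=
  forall t : R, (0 < t)%R -> cderR h t (k t / t).

(** These are the boundary terms of the integration by parts: [t * om e t = t^e / (1 + t^e)^2]
    vanishes at both ends. *)
Lemma om_ends (h : R -> C) (e : R) : (0 < e)%R -> integr e h ->
  clim (at_right 0) (fun t => t * h t) 0 /\ clim (Rbar_locally p_infty) (fun t => t * h t) 0.
Proof.
  intros He HI. destruct (integr_pos e h HI) as [D [HD H0]].
  assert (H : forall t, (0 < t)%R ->
    (Cmod (t * h t - 0) <= D * (Rpower t e / (1 + Rpower t e) ^ 2))%R).
  { intros t Ht. replace (t * h t - 0) with (t * h t) by ring. rewrite Cmod_scal_pos by auto.
    apply Rle_trans with (t * (D * om e t))%R.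
    - apply Rmult_le_compat_l; [lra|]. now apply H0.
    - right. unfold om. assert (hp := Rpower_pos t e).
      replace (Rpower t e) with (Rpower t (1 + (e - 1))) at 2 by (f_equal; ring).
      rewrite Rpower_plus, Rpower_1 by auto. field. lra. }
  split.
  - intros eps Heps. destruct (Rpower_small e (eps / D)) as [d [Hd Hs]]; auto.
    { now apply Rdiv_lt_0_compat. }
    apply (at_right_0 _ d Hd). intros t Ht. specialize (Hs t Ht).
    eapply Rle_lt_trans; [apply H; lra|]. assert (hp := Rpower_pos t e).
    apply Rle_lt_trans with (D * Rpower t e)%R.
    + apply Rmult_le_compat_l; [lra|].
      apply Rmult_le_reg_r with ((1 + Rpower t e) ^ 2)%R; [nra|].
      unfold Rdiv. rewrite Rmult_assoc, Rinv_l by nra. nra.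
    + apply (Rmult_lt_compat_l D) in Hs; [|exact HD].
      replace (D * (eps / D))%R with eps in Hs by (field; lra). exact Hs.
  - intros eps Heps. destruct (Rpower_large e (D / eps)) as [M [HM Hs]]; auto.
    { now apply Rdiv_lt_0_compat. }
    exists M. intros t Ht. specialize (Hs t Ht).
    eapply Rle_lt_trans; [apply H; lra|]. assert (hp := Rpower_pos t e).
    apply Rmult_lt_reg_r with ((1 + Rpower t e) ^ 2)%R; [nra|].
    replace (D * (Rpower t e / (1 + Rpower t e) ^ 2) * (1 + Rpower t e) ^ 2)%R
      with (D * Rpower t e)%R by (field; lra).
    apply (Rmult_lt_compat_l eps) in Hs; [|exact Heps].
    replace (eps * (D / eps))%R with D in Hs by (field; lra).
    apply Rlt_le_trans with (eps * Rpower t e * Rpower t e)%R.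
    + apply Rmult_lt_compat_r; auto.
    + rewrite Rmult_assoc. apply Rmult_le_compat_l; [lra|]. nra.
Qed.

Lemma is_theta_cont (h k : R -> C) : is_theta h k -> ccont h.
Proof. apply ccont_cder. Qed.

Lemma RtoC_neq_0 (t : R) : (0 < t)%R -> RtoC t <> 0.
Proof. intros Ht. apply Re_pos_neq_0. now rewrite re_RtoC. Qed.

(** [(t h)' = h + theta h], and [t h] vanishes at both ends. *)
Lemma theta_ibp (h k : R -> C) (e : R) (J : C) : (0 < e)%R -> is_theta h k ->
  integr e h -> integr e k -> improper h J -> improper k (- J).
Proof.
  intros He Hth Hh Hk HJ.
  destruct (om_ends h e He Hh) as [E0 E1].
  assert (I0 : improper (fun t => h t + k t) (0 - 0)).
  { apply (improper_ftc (fun t => t * h t)); auto.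
    - apply ccont_plus; [apply Hh|apply Hk].
    - intros t Ht. eapply cder_eq; [|apply cder_mult; [apply cder_io|apply Hth; auto]].
      assert (H := RtoC_neq_0 t Ht). field. exact H. }
  replace (- J) with (0 - 0 - J) by ring.
  apply (improper_ext (fun t => h t + k t - h t)); [intros; ring|].
  now apply improper_minus.
Qed.

Lemma is_theta_power (f k : R -> C) (a : C) : is_theta f k ->
  is_theta (fun t => Cpower t a * f t) (fun t => Cpower t a * (a * f t + k t)).
Proof.
  intros H t Ht. assert (H0 := RtoC_neq_0 t Ht).
  eapply cder_eq; [|apply cder_mult; [apply cder_Cpower_real; auto|apply H; auto]].
  cbv beta. field. exact H0.
Qed.

Lemma rapid_integr1 (rho : R) (f : R -> C) (a : C) :
  rapid rho f -> (0 < Re a - rho + 1)%R ->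
  integr (Re a - rho + 1) (fun t => Cpower t a * f t).
Proof.
  intros Hf He. destruct (rapid_dom rho f a Hf He) as [D [HD H]]. split.
  - apply ccont_mult; [apply ccont_Cpower|apply Hf].
  - now exists D.
Qed.

Lemma rapid_plus (rho : R) (f g : R -> C) :
  rapid rho f -> rapid rho g -> rapid rho (fun t => f t + g t).
Proof.
  intros [F1 F2] [G1 G2]. split; [now apply ccont_plus|].
  intros m. destruct (F2 m) as [D HD], (G2 m) as [E HE]. exists (D + E)%R.
  intros t Ht. specialize (HD t Ht). specialize (HE t Ht).
  rewrite Rmult_plus_distr_r. eapply Rle_trans; [|apply Rplus_le_compat; [exact HD|exact HE]].
  rewrite <- Rmult_plus_distr_r. apply Rmult_le_compat_r; [apply pow_le; lra|apply Cmod_triangle].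
Qed.

Lemma rapid_scal (rho : R) (c : C) (f : R -> C) :
  rapid rho f -> rapid rho (fun t => c * f t).
Proof.
  apply (rapid_mult rho f (fun _ => c) (Cmod c) 0).
  - apply ccont_const.
  - apply Cmod_ge_0.
  - intros t Ht. simpl. lra.
Qed.

(** Under the Mellin transform [theta] becomes multiplication by [-(a + 1)]; this turns the Bessel
    equation into a recurrence in [a]. *)
Lemma mellin_theta (rho : R) (f k : R -> C) (a J : C) :
  rapid rho f -> rapid rho k -> is_theta f k -> (0 < Re a - rho + 1)%R ->
  improper (fun t => Cpower t a * f t) J ->
  improper (fun t => Cpower t a * k t) (- (a + 1) * J).
Proof.
  intros Hf Hk Hth He HJ.
  assert (H : improper (fun t => Cpower t a * (a * f t + k t)) (- J)).
  { eapply theta_ibp; [exact He|apply is_theta_power; exact Hth| | |exact HJ].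
    - now apply rapid_integr1.
    - apply rapid_integr1; auto. apply rapid_plus; auto. now apply rapid_scal. }
  replace (- (a + 1) * J) with (- J - a * J) by ring.
  apply (improper_ext (fun t => Cpower t a * (a * f t + k t) - a * (Cpower t a * f t))).
  { intros; ring. }
  apply improper_minus; [exact H|now apply improper_scal].
Qed.

(** The transform is a function of [s = z^2]; the kernel with [n = 2] arises as minus the derivative
    in [s] of the one with [n = 1]. *)
Definition stieltjes (n : nat) (f : R -> C) (a s : C) : C :=
  impI (fun t => Cpower t a * f t * (/ (s + RtoC t ^ 2)) ^ n).

Definition away (s : C) (d : R) : Prop :=
  forall t : R, (0 < t)%R -> (d <= Cmod (s + RtoC t ^ 2))%R.

Lemma away_neq (s : C) (d t : R) : (0 < d)%R -> away s d -> (0 < t)%R -> s + RtoC t ^ 2 <> 0.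
Proof. intros Hd H Ht. apply Cmod_neq_0. specialize (H t Ht). lra. Qed.

Lemma away_near (s s' : C) (d : R) : away s d -> (Cmod (s' - s) < d / 2)%R -> away s' (d / 2).
Proof.
  intros H Hs t Ht. specialize (H t Ht).
  assert (T := Cmod_triangle_rev (s + RtoC t ^ 2) (s' + RtoC t ^ 2)).
  replace (s + RtoC t ^ 2 - (s' + RtoC t ^ 2)) with (- (s' - s)) in T by ring.
  rewrite Cmod_opp in T. lra.
Qed.

Lemma ccont_kernel (s : C) (d : R) (n : nat) : (0 < d)%R -> away s d ->
  ccont (fun t => (/ (s + RtoC t ^ 2)) ^ n).
Proof.
  intros Hd H. apply (ccont_pow (fun t => / (s + RtoC t ^ 2))).
  intros t Ht. apply (clim_inv _ (fun t => s + RtoC t ^ 2)).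
  - now apply (away_neq s d).
  - refine (ccont_plus (fun _ => s) (fun t => RtoC t ^ 2) _ _ t Ht).
    + apply ccont_const.
    + apply (ccont_pow _ 2), ccont_io.
Qed.

Lemma kernel_bound (s : C) (d t : R) (n : nat) : (0 < d)%R -> away s d -> (0 < t)%R ->
  (Cmod ((/ (s + RtoC t ^ 2)) ^ n) <= (/ d) ^ n)%R.
Proof.
  intros Hd H Ht. rewrite Cmod_pow. apply pow_incr. split; [apply Cmod_ge_0|].
  rewrite Cmod_inv by now apply (away_neq s d). apply Rinv_le_contravar; auto.
Qed.

Lemma stieltjes_integr (rho : R) (f : R -> C) (a s : C) (d : R) (n : nat) :
  rapid rho f -> (0 < Re a - rho + 1)%R -> (0 < d)%R -> away s d ->
  integr (Re a - rho + 1) (fun t => Cpower t a * f t * (/ (s + RtoC t ^ 2)) ^ n).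
Proof.
  intros Hf He Hd Hs. apply (rapid_integr rho f _ a ((/ d) ^ n)); auto.
  - now apply (ccont_kernel s d).
  - intros t Ht. now apply kernel_bound.
Qed.

Lemma stieltjes_correct (rho : R) (f : R -> C) (a s : C) (d : R) (n : nat) :
  rapid rho f -> (0 < Re a - rho + 1)%R -> (0 < d)%R -> away s d ->
  improper (fun t => Cpower t a * f t * (/ (s + RtoC t ^ 2)) ^ n) (stieltjes n f a s).
Proof.
  intros Hf He Hd Hs. apply (impI_correct _ (Re a - rho + 1) He).
  now apply (stieltjes_integr rho f a s d).
Qed.

(** The second-order remainder of [1 / (s + t^2)] is exactly
    [(s' - s)^2 / ((s + t^2)^2 (s' + t^2))], so domination by [om e] gives an error of order
    [|s' - s|^2] with no interchange of limits. *)
Lemma cder_stieltjes (rho : R) (f : R -> C) (a s : C) (d : R) :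
  rapid rho f -> (0 < Re a - rho + 1)%R -> (0 < d)%R -> away s d ->
  cderC (stieltjes 1 f a) s (- stieltjes 2 f a s).
Proof.
  intros Hf He Hd Hs. set (e := (Re a - rho + 1)%R) in *.
  destruct (rapid_dom rho f a Hf He) as [D [HD H]]. fold e in H.
  set (E := (2 * (D * ((/ d) ^ 2 * (/ (d / 2)) ^ 1) * / e))%R).
  assert (HE : (0 <= E)%R).
  { assert (A1 := Rinv_0_lt_compat _ Hd).
    assert (A2 : (0 < / (d / 2))%R) by (apply Rinv_0_lt_compat; lra).
    assert (A3 := Rinv_0_lt_compat _ He).
    unfold E. apply Rmult_le_pos; [lra|]. apply Rmult_le_pos; [|lra].
    apply Rmult_le_pos; [exact HD|]. apply Rmult_le_pos; [apply pow_le|]; lra. }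
  apply cder_of_littleo. intros eps Heps.
  (* The first bound keeps [s'] away from all [- t^2]; in the second, [E + 1] replaces [E], which
     may be 0. *)
  exists (Rmin (d / 2) (eps / (E + 1))). split.
  { apply Rmin_glb_lt; [lra|apply Rdiv_lt_0_compat; lra]. }
  unfold idC. intros s' Hs'.
  assert (Hs1 : (Cmod (s' - s) < d / 2)%R) by (eapply Rlt_le_trans; [exact Hs'|apply Rmin_l]).
  assert (Hs2 : (Cmod (s' - s) < eps / (E + 1))%R) by (eapply Rlt_le_trans; [exact Hs'|apply Rmin_r]).
  assert (Hsd := away_near s s' d Hs Hs1).
  assert (Hd2 : (0 < d / 2)%R) by lra.
  assert (I := improper_minus _ _ _ _
    (improper_minus _ _ _ _ (stieltjes_correct rho f a s' _ 1 Hf He Hd2 Hsd)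
      (stieltjes_correct rho f a s d 1 Hf He Hd Hs))
    (improper_scal (- (s' - s)) _ _ (stieltjes_correct rho f a s d 2 Hf He Hd Hs))).
  replace (stieltjes 1 f a s' - stieltjes 1 f a s - - stieltjes 2 f a s * (s' - s))
    with (stieltjes 1 f a s' - stieltjes 1 f a s - - (s' - s) * stieltjes 2 f a s) by ring.
  set (J := stieltjes 1 f a s' - stieltjes 1 f a s - - (s' - s) * stieltjes 2 f a s) in *.
  assert (B : (Cmod J <= 2 * (D * ((/ d) ^ 2 * (/ (d / 2)) ^ 1) * Cmod (s' - s) ^ 2 * / e))%R).
  { apply (improper_bound _ J e _ He) with (2 := I).
    - assert (A1 := Rinv_0_lt_compat _ Hd).
      assert (A2 : (0 < / (d / 2))%R) by (apply Rinv_0_lt_compat; lra).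
      apply Rmult_le_pos; [|apply pow_le, Cmod_ge_0].
      apply Rmult_le_pos; [exact HD|]. apply Rmult_le_pos; [apply pow_le|]; lra.
    - intros t Ht. assert (N1 := away_neq s d t Hd Hs Ht).
      assert (N2 := away_neq s' _ t Hd2 Hsd Ht).
      replace (Cpower t a * f t * (/ (s' + RtoC t ^ 2)) ^ 1 - Cpower t a * f t * (/ (s + RtoC t ^ 2)) ^ 1
        - - (s' - s) * (Cpower t a * f t * (/ (s + RtoC t ^ 2)) ^ 2))
        with (Cpower t a * f t * ((/ (s + RtoC t ^ 2)) ^ 2 * (/ (s' + RtoC t ^ 2)) ^ 1 * (s' - s) ^ 2))
        by (field; auto).
      rewrite (Cmod_mult (Cpower t a * f t)),
        (Cmod_mult ((/ (s + RtoC t ^ 2)) ^ 2 * (/ (s' + RtoC t ^ 2)) ^ 1)),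
        (Cmod_mult ((/ (s + RtoC t ^ 2)) ^ 2)), (Cmod_pow (s' - s)).
      apply Rle_trans with (D * om e t * ((/ d) ^ 2 * (/ (d / 2)) ^ 1 * Cmod (s' - s) ^ 2))%R.
      + apply Rmult_le_compat; auto; [apply Cmod_ge_0| |].
        * apply Rmult_le_pos; [apply Rmult_le_pos; apply Cmod_ge_0|apply pow_le, Cmod_ge_0].
        * apply Rmult_le_compat_r; [apply pow_le, Cmod_ge_0|].
          apply Rmult_le_compat; try apply Cmod_ge_0.
          -- now apply kernel_bound.
          -- now apply kernel_bound.
      + right. ring. }
  eapply Rle_trans; [exact B|].
  replace (2 * (D * ((/ d) ^ 2 * (/ (d / 2)) ^ 1) * Cmod (s' - s) ^ 2 * / e))%R
    with (E * Cmod (s' - s) * Cmod (s' - s))%R by (unfold E; ring).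
  apply Rmult_le_compat_r; [apply Cmod_ge_0|].
  apply Rle_trans with (E * (eps / (E + 1)))%R; [apply Rmult_le_compat_l; lra|].
  apply Rmult_le_reg_r with (E + 1)%R; [lra|].
  replace (E * (eps / (E + 1)) * (E + 1))%R with (E * eps)%R by (field; lra). nra.
Qed.

(** [z^2 + t^2 = (z - i t) (z + i t)], and both factors have real part [Re z]. *)
Lemma away_sqr (z : C) : (0 < Re z)%R -> away (z ^ 2) (Re z ^ 2).
Proof.
  intros Hz t Ht.
  replace (z ^ 2 + RtoC t ^ 2) with ((z - Ci * t) * (z + Ci * t)).
  2: { assert (E : Ci * Ci = - (1)) by (apply C_eq; unfold Ci, Cmult, Re, Im; simpl; ring).
       replace ((z - Ci * t) * (z + Ci * t)) with (z ^ 2 - Ci * Ci * RtoC t ^ 2) by ring.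
       rewrite E. ring. }
  rewrite Cmod_mult.
  assert (A1 := re_le_Cmod (z - Ci * t)). assert (A2 := re_le_Cmod (z + Ci * t)).
  assert (R0 : Re (Ci * t) = 0%R) by (unfold Ci, Re, Cmult; simpl; ring).
  rewrite Re_minus, R0 in A1. rewrite re_plus, R0 in A2.
  rewrite Rabs_pos_eq in A1, A2 by lra.
  simpl. rewrite Rmult_1_r. apply Rmult_le_compat; lra.
Qed.

(* [z^(1-a) t^a / (z^2 + t^2)] is homogeneous of degree [-1], so [z d/dz] acts on
   this transform as the adjoint of [- t d/dt - 1], that is, as [t d/dt] on [f]. *)
Definition Ptr (f : R -> C) (a z : C) : C := Cpower z (1 - a) * stieltjes 1 f a (z ^ 2).

Lemma cder_Ptr (rho : R) (f k : R -> C) (a z : C) :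
  rapid rho f -> rapid rho k -> is_theta f k -> (0 < Re a - rho + 1)%R -> (0 < Re z)%R ->
  cderC (Ptr f a) z (Ptr k a z / z).
Proof.
  intros Hf Hk Hth He Hz.
  assert (Hd : (0 < Re z ^ 2)%R) by (apply pow_lt; auto).
  assert (Hs := away_sqr z Hz). assert (Hz0 := Re_pos_neq_0 z Hz).
  set (d := (Re z ^ 2)%R) in *. set (s := z ^ 2) in *.
  assert (I1 := stieltjes_correct rho f a s d 1 Hf He Hd Hs).
  assert (I2 := stieltjes_correct rho f a s d 2 Hf He Hd Hs).
  assert (I3 := stieltjes_correct rho k a s d 1 Hk He Hd Hs).
  set (G := stieltjes 1 f a s) in *. set (G2 := stieltjes 2 f a s) in *.
  set (H := stieltjes 1 k a s) in *.
  (* Integration by parts in [t], with [t^2 / (s + t^2)^2] rewritten as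
     [1 / (s + t^2) - s / (s + t^2)^2]. The right side is what [z d/dz] produces from
     [z^(1-a) G(z^2)], up to the power of [z]. *)
  assert (E : H = (1 - a) * G - 2 * s * G2).
  { assert (I4 : improper (fun t => Cpower t a * (a * f t + k t) * (/ (s + RtoC t ^ 2)) ^ 1
        - Cpower t a * f t * (2 * RtoC t ^ 2 * (/ (s + RtoC t ^ 2)) ^ 2)) (- G)).
    { apply (theta_ibp (fun t => Cpower t a * f t * (/ (s + RtoC t ^ 2)) ^ 1) _ _ _ He); [| | |exact I1].
      - intros t Ht. assert (N := away_neq s d t Hd Hs Ht).
        assert (H0 := RtoC_neq_0 t Ht).
        eapply cder_eq; [|apply cder_mult; [apply (is_theta_power f k a Hth); auto|]].
        2: { eapply (cder_pow RtoC (fun t => / (s + RtoC t ^ 2)) t).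
             apply (cder_inv RtoC (fun t => s + RtoC t ^ 2)); [exact N|].
             apply (cder_plus RtoC (fun _ => s) (fun t => RtoC t ^ 2)); [apply cder_const|].
             apply (cder_pow RtoC (fun t => RtoC t)). apply cder_io. }
        simpl INR. replace (RtoC (1 + 1)%R) with (RtoC 2) by (f_equal; ring).
        simpl Nat.sub. cbv beta. simpl INR. field. auto.
      - now apply (stieltjes_integr rho f a s d).
      - assert (J1 : integr (Re a - rho + 1)
          (fun t => Cpower t a * (a * f t + k t) * (/ (s + RtoC t ^ 2)) ^ 1)).
        { apply (stieltjes_integr rho _ a s d); auto. apply rapid_plus; auto. now apply rapid_scal. }
        assert (J2 : integr (Re a - rho + 1)
          (fun t => Cpower t a * ((RtoC t ^ 2 + 0) * f t) * (/ (s + RtoC t ^ 2)) ^ 2)).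
        { apply (stieltjes_integr rho _ a s d); auto. now apply rapid_quad. }
        destruct J1 as [C1 [D1 B1]], J2 as [C2 [D2 B2]]. split.
        + apply (ccont_ext (fun t => Cpower t a * (a * f t + k t) * (/ (s + RtoC t ^ 2)) ^ 1
            - 2 * (Cpower t a * ((RtoC t ^ 2 + 0) * f t) * (/ (s + RtoC t ^ 2)) ^ 2))).
          { intros; ring. }
          apply ccont_minus; [exact C1|]. apply ccont_mult; [apply ccont_const|exact C2].
        + exists (D1 + 2 * D2)%R. intros t Ht. specialize (B1 t Ht). specialize (B2 t Ht).
          replace (Cpower t a * f t * (2 * RtoC t ^ 2 * (/ (s + RtoC t ^ 2)) ^ 2))
            with (2 * (Cpower t a * ((RtoC t ^ 2 + 0) * f t) * (/ (s + RtoC t ^ 2)) ^ 2)) by ring.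
          eapply Rle_trans; [apply Cmod_triangle|]. rewrite Cmod_opp, Cmod_scal_pos by lra. lra. }
    assert (I5 : improper (fun t => Cpower t a * k t * (/ (s + RtoC t ^ 2)) ^ 1)
      (- G - a * G + 2 * (G - s * G2))).
    { apply (improper_ext (fun t =>
        (Cpower t a * (a * f t + k t) * (/ (s + RtoC t ^ 2)) ^ 1
        - Cpower t a * f t * (2 * RtoC t ^ 2 * (/ (s + RtoC t ^ 2)) ^ 2))
        - a * (Cpower t a * f t * (/ (s + RtoC t ^ 2)) ^ 1)
        + 2 * (Cpower t a * f t * (/ (s + RtoC t ^ 2)) ^ 1
               - s * (Cpower t a * f t * (/ (s + RtoC t ^ 2)) ^ 2)))).
      { intros t Ht. assert (N := away_neq s d t Hd Hs Ht). field. exact N. }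
      apply improper_plus; [apply improper_minus; [exact I4|now apply improper_scal]|].
      apply improper_scal. apply improper_minus; [exact I1|now apply improper_scal]. }
    rewrite (improper_unique _ _ _ I3 I5). ring. }
  unfold Ptr. fold s. fold G H.
  eapply cder_eq; [|apply cder_mult; [apply cder_Cpower; exact Hz|]].
  2: { apply (cder_comp idC idC (fun y => y ^ 2) (stieltjes 1 f a)).
       - apply (cder_pow idC (fun y => y)). apply (cder_io idC).
       - apply (cder_stieltjes rho f a _ d); auto. }
  cbv beta. fold s. fold G G2. rewrite E. simpl INR.
  replace (RtoC (1 + 1)%R) with (RtoC 2) by (f_equal; ring).
  simpl Nat.sub. unfold s. field. exact Hz0.
Qed.

(** * Solutions of Bessel's equations *)

(** [1 + x <= exp x] at [x = c (1 + t) / j], raised to the power [j]. *)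
Lemma pow_le_exp (c : R) (j : nat) : (0 < c)%R -> exists A, (0 < A)%R /\
  forall t, (0 < t)%R -> ((1 + t) ^ j <= A * exp (c * t))%R.
Proof.
  intros Hc. destruct j as [|j].
  { exists 1%R. split; [lra|]. intros t Ht. simpl. rewrite Rmult_1_l.
    assert (h := exp_ineq1_le (c * t)). assert (0 < c * t)%R by (apply Rmult_lt_0_compat; lra). lra. }
  set (J := INR (S j)). assert (HJ : (0 < J)%R) by (apply lt_0_INR; lia).
  assert (HJc : (0 < J / c)%R) by now apply Rdiv_lt_0_compat.
  exists ((J / c) ^ S j * exp c)%R. split.
  { apply Rmult_lt_0_compat; [now apply pow_lt|apply exp_pos]. }
  intros t Ht. rewrite Rmult_assoc, <- exp_plus.
  replace (c + c * t)%R with (c * (1 + t) / J * J)%R by (field; lra).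
  change (exp (c * (1 + t) / J * J)) with (exp (c * (1 + t) / J * INR (S j))).
  assert (E : exp (c * (1 + t) / J * INR (S j)) = (exp (c * (1 + t) / J) ^ S j)%R).
  { rewrite <- Rpower_pow by apply exp_pos. unfold Rpower. rewrite ln_exp. f_equal. ring. }
  rewrite E, <- Rpow_mult_distr. apply pow_incr. split; [lra|].
  assert (h := exp_ineq1_le (c * (1 + t) / J)).
  apply Rle_trans with (J / c * (c * (1 + t) / J))%R; [right; field; lra|].
  apply Rmult_le_compat_l; lra.
Qed.

Lemma ccont_bounded (f : R -> C) (a b : R) : ccont f -> (0 < a <= b)%R ->
  exists D, forall t, (a <= t <= b)%R -> (Cmod (f t) <= D)%R.
Proof.
  intros Hf Hab.
  destruct (continuity_ab_maj (fun t => Cmod (f t)) a b) as [x [Hx _]].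
  - lra.
  - intros t Ht. apply continuity_pt_filterlim.
    apply (proj1 (RtoC_cont (fun t => Cmod (f t)) t)).
    apply (clim_Cmod _). apply Hf. lra.
  - exists (Cmod (f x)). exact Hx.
Qed.

Lemma rapid_intro (rho : R) (f : R -> C) (d D M B c : R) (k : nat) :
  ccont f -> (0 <= rho)%R -> (0 < d)%R -> (0 < M)%R -> (0 < c)%R -> (0 <= B)%R -> (0 <= D)%R ->
  (forall t, (0 < t <= d)%R -> (Cmod (f t) <= D * Rpower t (- rho))%R) ->
  (forall t, (M < t)%R -> (Cmod (f t) <= B * (1 + t) ^ k * exp (- (c * t)))%R) ->
  rapid rho f.
Proof.
  intros Hf Hrho Hd HM Hc HB HD H0 H1. split; [exact Hf|]. intros m.
  destruct (nfloor_ex rho Hrho) as [n [_ Hn]].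
  destruct (pow_le_exp c (k + m + (n + 1)) Hc) as [A [HA HA']].
  set (M' := Rmax d M).
  assert (HM1 : (d <= M')%R) by apply Rmax_l. assert (HM2 : (M <= M')%R) by apply Rmax_r.
  destruct (ccont_bounded f d M' Hf ltac:(lra)) as [Q HQ].
  (* [Z1], [Z2], [Z3] bound [|f t| (1 + t)^m t^rho] on [(0, d]], on the compact middle [[d, M']] and
     beyond [M']. *)
  set (Z1 := (D * (1 + d) ^ m)%R). set (Z2 := (Rabs Q * (1 + M') ^ m * Rpower M' rho)%R).
  set (Z3 := (B * A)%R).
  assert (P1 : (0 <= Z1)%R) by (apply Rmult_le_pos; [lra|apply pow_le; lra]).
  assert (P2 : (0 <= Z2)%R).
  { apply Rmult_le_pos; [|left; apply Rpower_pos].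
    apply Rmult_le_pos; [apply Rabs_pos|apply pow_le; lra]. }
  assert (P3 : (0 <= Z3)%R) by (apply Rmult_le_pos; lra).
  exists (Z1 + Z2 + Z3)%R. intros t Ht.
  assert (Hi : forall Z, (Cmod (f t) * (1 + t) ^ m * Rpower t rho <= Z)%R ->
    (Cmod (f t) * (1 + t) ^ m <= Z * Rpower t (- rho))%R).
  { intros Z HZ. rewrite Rpower_Ropp. assert (hp := Rpower_pos t rho).
    apply Rmult_le_reg_r with (Rpower t rho); [exact hp|].
    rewrite (Rmult_assoc Z), Rinv_l by lra. lra. }
  assert (Hm : (0 <= (1 + t) ^ m)%R) by (apply pow_le; lra).
  destruct (Rle_dec t d) as [L|L].
  - apply Rle_trans with (Z1 * Rpower t (- rho))%R.
    + unfold Z1. rewrite Rmult_assoc, (Rmult_comm _ (Rpower t (- rho))), <- Rmult_assoc.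
      apply Rmult_le_compat; [apply Cmod_ge_0|exact Hm|apply H0; lra|].
      apply pow_incr. lra.
    + apply Rmult_le_compat_r; [left; apply Rpower_pos|lra].
  - apply Hi. destruct (Rle_dec t M') as [L'|L'].
    + apply Rle_trans with Z2; [|lra]. unfold Z2.
      apply Rmult_le_compat; [apply Rmult_le_pos; [apply Cmod_ge_0|exact Hm]|left; apply Rpower_pos| |].
      * apply Rmult_le_compat; [apply Cmod_ge_0|exact Hm| |apply pow_incr; lra].
        eapply Rle_trans; [apply HQ; lra|apply Rle_abs].
      * apply Rle_Rpower_l; lra.
    + apply Rle_trans with Z3; [|lra]. unfold Z3.
      assert (Hr : (Rpower t rho <= (1 + t) ^ (n + 1))%R).
      { rewrite <- Rpower_pow by lra. apply Rle_trans with (Rpower (1 + t) rho).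
        - apply Rle_Rpower_l; lra.
        - apply Rle_Rpower; [lra|]. rewrite plus_INR. simpl. lra. }
      apply Rle_trans with (B * (1 + t) ^ k * exp (- (c * t)) * (1 + t) ^ m * (1 + t) ^ (n + 1))%R.
      * apply Rmult_le_compat; [apply Rmult_le_pos; [apply Cmod_ge_0|exact Hm]|left; apply Rpower_pos| |exact Hr].
        apply Rmult_le_compat_r; [exact Hm|apply H1; lra].
      * replace (B * (1 + t) ^ k * exp (- (c * t)) * (1 + t) ^ m * (1 + t) ^ (n + 1))%R
          with (B * ((1 + t) ^ (k + m + (n + 1)) * exp (- (c * t))))%R by (rewrite !pow_add; ring).
        apply Rmult_le_compat_l; [lra|].
        apply Rle_trans with (A * exp (c * t) * exp (- (c * t)))%R.
        -- apply Rmult_le_compat_r; [left; apply exp_pos|apply HA'; lra].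
        -- rewrite Rmult_assoc, <- exp_plus, Rplus_opp_r, exp_0. lra.
Qed.

(* Integrating [y' = p / s] over [[r, 2 r]] recovers [p r] up to the variation of [p]. *)
Lemma theta_bound (y p q : R -> C) (r B Q : R) : (0 < r)%R -> is_theta y p -> is_theta p q ->
  (forall s, (r <= s <= 2 * r)%R -> (Cmod (y s) <= B)%R) ->
  (forall s, (r <= s <= 2 * r)%R -> (Cmod (q s) <= Q)%R) ->
  (Cmod (p r) <= 4 * B + 8 * Q)%R.
Proof.
  intros Hr Hy Hp HB HQ.
  assert (HQ0 : (0 <= Q)%R) by (eapply Rle_trans; [apply Cmod_ge_0|apply (HQ r); lra]).
  assert (Hq : forall X (u : R), (r <= u)%R -> (Cmod X <= Q)%R -> (Cmod (X / u) <= Q / r)%R).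
  { intros X u Hu HX. rewrite Cmod_div, Cmod_R, Rabs_pos_eq by (try apply RtoC_neq_0; lra).
    apply Rmult_le_compat; [apply Cmod_ge_0|left; apply Rinv_0_lt_compat; lra|exact HX|].
    apply Rinv_le_contravar; lra. }
  assert (Hpp : forall s, (r <= s <= 2 * r)%R -> (Cmod (p s - p r) <= 2 * Q)%R).
  { intros s Hs. eapply Rle_trans.
    - apply (Cmod_diff_le p (fun s => q s / s) r s (Q / r)); [lra| |].
      + intros t Ht. apply Hp. lra.
      + intros t Ht. apply Hq; [lra|apply HQ; lra].
    - apply Rmult_le_compat_l; [lra|]. apply Rle_trans with (Q / r * r)%R.
      + apply Rmult_le_compat_l; [|lra]. apply Rmult_le_pos; [lra|left; apply Rinv_0_lt_compat; lra].
      + right. field. lra. }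
  (* The derivative of [g] is [(p s - p r) / s], which is small; over [[r, 2 r]] the subtracted term
     contributes [p r * ln 2], and [ln 2 > 1/2] gives the constants 4 and 8. *)
  set (g := fun s : R => y s - p r * RtoC (ln s)).
  assert (Hg : (Cmod (g (2 * r)%R - g r) <= 2 * (2 * Q / r * (2 * r - r)))%R).
  { apply (Cmod_diff_le g (fun s => (p s - p r) / s)); [lra| |].
    - intros t Ht. unfold g.
      eapply cder_eq; [|apply cder_minus; [apply Hy; lra|]].
      2: { apply cder_scal. apply (cderR_of_is_derive ln t (/ t)). apply is_derive_ln. lra. }
      rewrite RtoC_inv by lra. unfold Cdiv. ring.
    - intros t Ht. rewrite Cmod_div, Cmod_R, Rabs_pos_eq by (try apply RtoC_neq_0; lra).
      apply Rmult_le_compat; [apply Cmod_ge_0|left; apply Rinv_0_lt_compat; lra|apply Hpp; lra|].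
      apply Rinv_le_contravar; lra. }
  replace (2 * (2 * Q / r * (2 * r - r)))%R with (4 * Q)%R in Hg by (field; lra).
  unfold g in Hg. rewrite ln_mult, RtoC_plus in Hg by lra.
  replace (y (2 * r)%R - p r * (RtoC (ln 2) + RtoC (ln r)) - (y r - p r * RtoC (ln r)))
    with ((y (2 * r)%R - y r) - RtoC (ln 2) * p r) in Hg by ring.
  assert (L2 := ln_lt_2).
  rewrite Cmod_minus_sym in Hg.
  assert (T := Cmod_triangle_rev (RtoC (ln 2) * p r) (y (2 * r)%R - y r)).
  assert (T2 := Cmod_triangle (y (2 * r)%R) (- y r)). rewrite Cmod_opp in T2.
  fold (y (2 * r)%R - y r) in T2.
  rewrite Cmod_scal_pos in T by lra.
  assert (B1 := HB r ltac:(lra)). assert (B2 := HB (2 * r)%R ltac:(lra)).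
  assert (h := Cmod_ge_0 (p r)).
  assert (ln 2 * Cmod (p r) <= 2 * B + 4 * Q)%R by lra. nra.
Qed.

Lemma energy_derive (y u yt ut : R -> C) (rho : R) (t : R) : (0 < t)%R ->
  is_theta y yt -> is_theta u ut ->
  is_derive (fun s => Rpower s (2 * rho) *
      (Re (y s) * Re (y s) + Im (y s) * Im (y s) + (Re (u s) * Re (u s) + Im (u s) * Im (u s))))%R t
    (2 * Rpower t (2 * rho) / t *
      (rho * (Re (y t) * Re (y t) + Im (y t) * Im (y t) + (Re (u t) * Re (u t) + Im (u t) * Im (u t)))
       + (Re (y t) * Re (yt t) + Im (y t) * Im (yt t) + Re (u t) * Re (ut t) + Im (u t) * Im (ut t))))%R.
Proof.
  intros Ht Hy Hu.
  assert (Edv : forall c : C, Re (c / t) = (Re c / t)%R /\ Im (c / t) = (Im c / t)%R).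
  { intros c. unfold Cdiv. rewrite <- RtoC_inv, re_scal_r, im_scal_r by lra. split; reflexivity. }
  destruct (cderR_is_derive_re_im _ _ _ (Hy t Ht)) as [Y1 Y2].
  destruct (cderR_is_derive_re_im _ _ _ (Hu t Ht)) as [U1 U2].
  rewrite (proj1 (Edv _)) in Y1. rewrite (proj1 (Edv _)) in U1.
  rewrite (proj2 (Edv _)) in Y2. rewrite (proj2 (Edv _)) in U2.
  assert (D0 := is_derive_Rpower (2 * rho) t Ht).
  assert (E : (Rpower t (2 * rho - 1) = Rpower t (2 * rho) / t)%R).
  { unfold Rminus. rewrite Rpower_plus, Rpower_Ropp, Rpower_1 by auto. reflexivity. }
  rewrite E in D0.
  assert (Sq : forall (f : R -> R) l, is_derive f t l ->
    is_derive (fun s => f s * f s)%R t (2 * f t * l)%R).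
  { intros f l H. assert (Ex : ex_derive f t) by (eexists; exact H).
    auto_derive; [auto|]. change (Derive (fun x => f x) t) with (Derive f t).
    rewrite (is_derive_unique _ _ _ H). ring. }
  assert (DE := is_derive_plus _ _ _ _ _ (is_derive_plus _ _ _ _ _ (Sq _ _ Y1) (Sq _ _ Y2))
    (is_derive_plus _ _ _ _ _ (Sq _ _ U1) (Sq _ _ U2))).
  assert (DD := is_derive_mult _ _ _ _ _ D0 DE Rmult_comm).
  eapply (is_derive_ext_loc _ _ t) in DD; [|apply filter_forall; intros s; reflexivity].
  refine (eq_ind _ (fun l => is_derive _ t l) DD _ _).
  unfold plus, mult; simpl. field. lra.
Qed.

Lemma near_zero_bound (nu : C) (y v : R -> C) (d : R) : (0 < d)%R ->
  is_theta y v -> is_theta v (fun t => (RtoC t ^ 2 + nu ^ 2) * y t) ->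
  exists D, (0 <= D)%R /\ forall t, (0 < t <= d)%R ->
    (Cmod (y t) <= D * Rpower t (- (Rabs (Re nu) + d)))%R /\
    (Cmod (v t) <= D * Rpower t (- (Rabs (Re nu) + d)))%R.
Proof.
  intros Hd Hy Hv. set (rho := (Rabs (Re nu) + d)%R).
  assert (Hd0 := RtoC_neq_0 d Hd).
  set (u := fun t : R => (v t - nu * y t) / d).
  assert (Hu : is_theta u (fun t => RtoC t ^ 2 / d * y t - nu * u t)).
  { intros t Ht. assert (Ht0 := RtoC_neq_0 t Ht). unfold u.
    apply (cder_ext RtoC (fun t => / d * (v t - nu * y t))); [intros; unfold Cdiv; ring|].
    eapply cder_eq; [|apply cder_scal; apply cder_minus; [apply Hv; auto|apply cder_scal; apply Hy; auto]].
    cbv beta. field. auto. }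
  assert (Evd : forall t, v t = nu * y t + d * u t).
  { intros t. unfold u. field. exact Hd0. }
  set (E := fun s => (Re (y s) * Re (y s) + Im (y s) * Im (y s)
    + (Re (u s) * Re (u s) + Im (u s) * Im (u s)))%R).
  set (phi := fun s => (Rpower s (2 * rho) * E s)%R).
  assert (Mon : forall t, (0 < t <= d)%R -> (phi t <= phi d)%R).
  { intros t Ht.
    destruct (MVT_gen phi t d (fun t => 2 * Rpower t (2 * rho) / t *
      (rho * E t + (Re (y t) * Re (v t) + Im (y t) * Im (v t)
        + Re (u t) * Re (RtoC t ^ 2 / d * y t - nu * u t)
        + Im (u t) * Im (RtoC t ^ 2 / d * y t - nu * u t))))%R) as [c [Hc Ec]].
    - intros x Hx. rewrite Rmin_left in Hx by lra.
      apply (energy_derive y u v (fun t => RtoC t ^ 2 / d * y t - nu * u t)); auto; lra.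
    - intros x Hx. rewrite Rmin_left in Hx by lra.
      apply continuity_pt_filterlim. apply (ex_derive_continuous (V := R_NormedModule)).
      eexists. apply (energy_derive y u v (fun t => RtoC t ^ 2 / d * y t - nu * u t)); auto; lra.
    - rewrite Rmin_left, Rmax_right in Hc by lra.
      cut (0 <= phi d - phi t)%R; [lra|]. rewrite Ec.
      apply Rmult_le_pos; [|lra]. apply Rmult_le_pos.
      { assert (hp := Rpower_pos c (2 * rho)). apply Rmult_le_pos; [lra|left; apply Rinv_0_lt_compat; lra]. }
      rewrite Evd. replace (RtoC c ^ 2 / d) with (RtoC (c * c / d)).
      2: { rewrite RtoC_div, RtoC_mult by lra. field. exact Hd0. }
      set (k := (c * c / d)%R).
      assert (Hk : (0 <= k <= d)%R).
      { unfold k. split.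
        - apply Rmult_le_pos; [nra|left; apply Rinv_0_lt_compat; lra].
        - apply Rmult_le_reg_r with d; [lra|]. unfold Rdiv. rewrite Rmult_assoc, Rinv_l by lra. nra. }
      rewrite Re_minus, Im_minus, re_plus, im_plus, !re_scal_l, !im_scal_l, !re_mult, !im_mult.
      unfold E. unfold rho.
      set (y1 := Re (y c)). set (y2 := Im (y c)). set (u1 := Re (u c)). set (u2 := Im (u c)).
      set (n1 := Re nu). set (n2 := Im nu).
      assert (Hn : (- Rabs n1 <= n1 <= Rabs n1)%R).
      { split; [|apply Rle_abs]. assert (h := Rle_abs (- n1)). rewrite Rabs_Ropp in h. lra. }
      set (A := Rabs n1) in *.
      assert (Sq2 : forall p q : R, (0 <= p * p + q * q)%R) by (intros; nra).
      (* Twice the bracket in the derivative of [phi] equals [2 S1 + 2 S2 + S3 + S4 + S5]; the terms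
         with [Im nu] cancel. *)
      assert (S1 : (0 <= (A + n1) * (y1 * y1 + y2 * y2))%R) by (apply Rmult_le_pos; [lra|apply Sq2]).
      assert (S2 : (0 <= (A - n1) * (u1 * u1 + u2 * u2))%R) by (apply Rmult_le_pos; [lra|apply Sq2]).
      assert (S3 : (0 <= (d + k) * ((y1 + u1) * (y1 + u1) + (y2 + u2) * (y2 + u2)))%R)
        by (apply Rmult_le_pos; [lra|apply Sq2]).
      assert (S4 : (0 <= (d - k) * (y1 * y1 + y2 * y2))%R) by (apply Rmult_le_pos; [lra|apply Sq2]).
      assert (S5 : (0 <= (d - k) * (u1 * u1 + u2 * u2))%R) by (apply Rmult_le_pos; [lra|apply Sq2]).
      nra. }
  set (Q := sqrt (phi d)).
  assert (HE : forall t, (0 < t <= d)%R -> (sqrt (E t) <= Q * Rpower t (- rho))%R).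
  { intros t Ht. assert (hp := Rpower_pos t rho).
    rewrite Rpower_Ropp. apply Rmult_le_reg_r with (Rpower t rho); [exact hp|].
    rewrite Rmult_assoc, Rinv_l, Rmult_1_r by lra. unfold Q.
    replace (Rpower t rho) with (sqrt (Rpower t (2 * rho))).
    2: { replace (2 * rho)%R with (rho + rho)%R by ring. rewrite Rpower_plus. apply sqrt_square. lra. }
    rewrite <- sqrt_mult_alt by (unfold E; nra). apply sqrt_le_1_alt.
    rewrite Rmult_comm. apply Mon. exact Ht. }
  assert (HY : forall t, (Cmod (y t) <= sqrt (E t))%R).
  { intros t. unfold Cmod. apply sqrt_le_1_alt. unfold E, Re, Im. nra. }
  assert (HU : forall t, (Cmod (u t) <= sqrt (E t))%R).
  { intros t. unfold Cmod. apply sqrt_le_1_alt. unfold E, Re, Im. nra. }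
  assert (HQ : (0 <= Q)%R) by apply sqrt_pos.
  assert (Hn := Cmod_ge_0 nu).
  exists ((1 + Cmod nu + d) * Q)%R. split; [apply Rmult_le_pos; lra|]. intros t Ht. specialize (HE t Ht).
  specialize (HY t). specialize (HU t). assert (hs := sqrt_pos (E t)). split.
  - rewrite Rmult_assoc. eapply Rle_trans; [exact HY|].
    eapply Rle_trans; [|apply Rmult_le_compat_l; [lra|exact HE]]. nra.
  - rewrite Evd. eapply Rle_trans; [apply Cmod_triangle|].
    rewrite Cmod_mult, Cmod_scal_pos by lra. rewrite Rmult_assoc.
    eapply Rle_trans; [|apply Rmult_le_compat_l; [lra|exact HE]]. nra.
Qed.

Lemma is_theta_ray (w v : C -> C) (e : C) : e <> 0 ->
  (forall r : R, (0 < r)%R -> cderC w (r * e) (v (r * e) / (r * e))) ->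
  is_theta (fun r : R => w (r * e)) (fun r : R => v (r * e)).
Proof.
  intros He H t Ht. assert (Ht0 := RtoC_neq_0 t Ht).
  eapply cder_eq; [|apply (cder_comp RtoC idC (fun r : R => r * e) w); [|apply H; auto]].
  2: { apply cder_mult; [apply cder_io|apply cder_const]. }
  cbv beta. field. auto.
Qed.

(** * Behaviour of [K] on rays *)

Lemma BesselK_pair (nu : C) (K : C -> C) : is_BesselK nu K -> forall z, slit_plane z ->
  cderC K z (z * C_derive K z / z) /\
  cderC (fun z => z * C_derive K z) z ((z ^ 2 + nu ^ 2) * K z / z).
Proof.
  intros [H _] z Hz. destruct (H z Hz) as [E1 [E2 E3]]. assert (Hz0 := proj1 Hz).
  split.
  - eapply cder_eq; [|apply cderC_is_derive, (C_derive_correct _ _ 0 E1)]. field. exact Hz0.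
  - eapply cder_eq; [|apply cder_mult; [apply (cder_io idC)|
      apply cderC_is_derive, (C_derive_correct _ _ 0 E2)]].
    replace ((z ^ 2 + nu ^ 2) * K z)
      with (z ^ 2 * C_derive (C_derive K) z + z * C_derive K z
        - (z ^ 2 * C_derive (C_derive K) z + z * C_derive K z - (z ^ 2 + nu ^ 2) * K z)) by ring.
    rewrite E3. unfold idC. field. exact Hz0.
Qed.

Lemma BesselK_ray (nu e : C) (K : C -> C) : is_BesselK nu K -> slit_plane e ->
  exists M, (0 < M)%R /\ forall r, (M < r)%R ->
    (Cmod (K (r * e)%C) <= 3 / 2 * (sqrt (PI / (2 * (r * Cmod e))) * exp (- (Re e * r))))%R /\
    (1 / 2 * (sqrt (PI / (2 * (r * Cmod e))) * exp (- (Re e * r))) <= Cmod (K (r * e)%C))%R /\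
    K (r * e) <> 0.
Proof.
  intros [_ HS] [He Ha]. assert (Hp := Cmod_pos e He).
  (* The sector is just wide enough to contain the ray, and the relative error 1/2 gives the factors
     1/2 and 3/2. *)
  destruct (HS (PI - Rabs (Carg e))%R ltac:(lra) (1 / 2)%R ltac:(lra)) as [M HM].
  assert (HMe : (0 <= Rabs M / Cmod e)%R).
  { apply Rmult_le_pos; [apply Rabs_pos|left; now apply Rinv_0_lt_compat]. }
  exists (Rabs M / Cmod e + 1)%R. split; [lra|]. intros r Hr.
  assert (Hr0 : (0 < r)%R) by lra.
  assert (Hre : r * e <> 0) by (apply Cmult_neq_0; [now apply RtoC_neq_0|exact He]).
  specialize (HM (r * e)). rewrite Cmod_scal_pos, Carg_scal in HM by auto.
  assert (HM' : (M < r * Cmod e)%R).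
  { eapply Rle_lt_trans; [apply Rle_abs|].
    replace (Rabs M) with (Rabs M / Cmod e * Cmod e)%R by (field; lra).
    apply Rmult_lt_compat_r; lra. }
  specialize (HM HM' ltac:(lra)).
  set (g := Cpower (PI / (2 * (r * e))) (1 / 2) * Cexp (- (r * e))) in *.
  assert (Hg : Cmod g = (sqrt (PI / (2 * (r * Cmod e))) * exp (- (Re e * r)))%R).
  { assert (H2 : 2 * (r * e) <> 0) by (apply Cmult_neq_0; [apply RtoC_neq_0; lra|exact Hre]).
    assert (HPI := PI_RGT_0).
    unfold g. rewrite Cmod_mult, Cmod_Cexp, re_opp, re_scal_l, Cmod_Cpower_half.
    - rewrite Cmod_div, Cmod_R, Rabs_pos_eq, Cmod_scal_pos, Cmod_scal_pos by (auto; lra).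
      f_equal. f_equal. ring.
    - apply Cmult_neq_0; [now apply RtoC_neq_0|].
      intros E. assert (E1 := Cinv_r _ H2). rewrite E, Cmult_0_r in E1.
      apply RtoC_inj in E1. lra. }
  assert (Hg0 : (0 < Cmod g)%R).
  { apply Cmod_pos. unfold g. apply Cmult_neq_0; [apply Cpower_neq_0|apply Cexp_neq_0]. }
  rewrite <- Hg.
  assert (Hgn := Cmod_neq_0 _ Hg0).
  assert (E : (Cmod (K (r * e)%C - g)%C <= 1 / 2 * Cmod g)%R).
  { replace (K (r * e) - g) with ((K (r * e) / g - 1) * g) by (field; exact Hgn).
    rewrite Cmod_mult. apply Rmult_le_compat_r; lra. }
  assert (T1 := Cmod_triangle_rev (K (r * e)) g).
  rewrite Cmod_minus_sym in E. assert (T2 := Cmod_triangle_rev g (K (r * e))).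
  rewrite Cmod_minus_sym in T1. repeat split; try lra. apply Cmod_neq_0. lra.
Qed.

(** The asymptotics do not control the derivative; the equation recovers it from the function at the
    cost of a factor [(1 + r)^2]. On a ray of direction [e], the coefficient [s] is [e^2] for the
    modified equation and [- e^2] for Bessel's. *)
Lemma theta_bound_poly (y v : R -> C) (nu s : C) (phi : R -> R) (B M : R) :
  (0 < M)%R -> (0 <= B)%R -> is_theta y v -> is_theta v (fun t => (s * RtoC t ^ 2 + nu ^ 2) * y t) ->
  (forall r t, (M < r)%R -> (r <= t <= 2 * r)%R -> (Cmod (y t) <= B * phi r)%R) ->
  forall r, (M < r)%R ->
    (Cmod (v r) <= (4 + 32 * Cmod s + 8 * Cmod (nu ^ 2)) * B * (1 + r) ^ 2 * phi r)%R.
Proof.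
  intros HM HB Hy Hv H r Hr.
  assert (Hn := Cmod_ge_0 (nu ^ 2)). assert (Hs := Cmod_ge_0 s).
  assert (H0 : (0 <= B * phi r)%R) by (eapply Rle_trans; [apply Cmod_ge_0|apply (H r r); lra]).
  eapply Rle_trans.
  { apply (theta_bound y v (fun t => (s * RtoC t ^ 2 + nu ^ 2) * y t) r (B * phi r) ((4 * Cmod s * r ^ 2 + Cmod (nu ^ 2)) * (B * phi r))); [lra|exact Hy|exact Hv| |].
    - intros t Ht. apply H; lra.
    - intros t Ht. rewrite Cmod_mult. apply Rmult_le_compat; try apply Cmod_ge_0.
      + eapply Rle_trans; [apply Cmod_triangle|]. apply Rplus_le_compat_r.
        rewrite Cmod_mult, Cmod_pow, Cmod_R, Rabs_pos_eq by lra.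
        replace (4 * Cmod s * r ^ 2)%R with (Cmod s * (4 * r ^ 2))%R by ring.
        apply Rmult_le_compat_l; [exact Hs|]. nra.
      + apply H; lra. }
  replace ((4 + 32 * Cmod s + 8 * Cmod (nu ^ 2)) * B * (1 + r) ^ 2 * phi r)%R
    with ((4 + 32 * Cmod s + 8 * Cmod (nu ^ 2)) * (1 + r) ^ 2 * (B * phi r))%R by ring.
  replace (4 * (B * phi r) + 8 * ((4 * Cmod s * r ^ 2 + Cmod (nu ^ 2)) * (B * phi r)))%R
    with ((4 + 32 * Cmod s * r ^ 2 + 8 * Cmod (nu ^ 2)) * (B * phi r))%R by ring.
  apply Rmult_le_compat_r; [exact H0|].
  assert (h1 : (1 <= (1 + r) ^ 2)%R) by nra.
  assert (h2 : (r ^ 2 <= (1 + r) ^ 2)%R) by nra.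
  assert (Cmod s * r ^ 2 <= Cmod s * (1 + r) ^ 2)%R by (apply Rmult_le_compat_l; auto).
  assert (Cmod (nu ^ 2) * 1 <= Cmod (nu ^ 2) * (1 + r) ^ 2)%R by (apply Rmult_le_compat_l; auto).
  lra.
Qed.

Lemma BesselK_decay (nu e : C) (K : C -> C) : is_BesselK nu K -> (0 < Re e)%R ->
  exists M B, (0 < M)%R /\ (0 <= B)%R /\ forall r, (M < r)%R ->
    (Cmod (K (r * e)%C) <= B * (1 + r) ^ 2 * exp (- (Re e * r)))%R /\
    (Cmod (r * e * C_derive K (r * e))%C <= B * (1 + r) ^ 2 * exp (- (Re e * r)))%R.
Proof.
  intros HK He. assert (Hsl := slit_of_Re_pos e He). assert (He0 := proj1 Hsl).
  assert (Hp := Cmod_pos e He0).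
  destruct (BesselK_ray nu e K HK Hsl) as [M0 [HM0 H0]].
  (* [r >= 1] lets the factor [sqrt (PI / (2 r |e|))] be absorbed into the constant [B0]. *)
  set (M := Rmax M0 1). assert (HM1 : (M0 <= M)%R) by apply Rmax_l.
  assert (HM2 : (1 <= M)%R) by apply Rmax_r.
  set (B0 := (3 / 2 * sqrt (PI / (2 * Cmod e)))%R).
  assert (HPI := PI_RGT_0).
  assert (HB0 : (0 <= B0)%R) by (assert (h := sqrt_pos (PI / (2 * Cmod e))); unfold B0; lra).
  assert (H1 : forall r, (M < r)%R -> (Cmod (K (r * e)%C) <= B0 * exp (- (Re e * r)))%R).
  { intros r Hr. eapply Rle_trans; [apply H0; lra|]. unfold B0. rewrite Rmult_assoc.
    apply Rmult_le_compat_l; [lra|]. apply Rmult_le_compat_r; [left; apply exp_pos|].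
    apply sqrt_le_1_alt. apply Rmult_le_compat_l; [lra|]. apply Rinv_le_contravar; [lra|]. nra. }
  assert (HR : forall r, (0 < r)%R -> slit_plane (r * e)).
  { intros r Hr. apply slit_of_Re_pos. rewrite re_scal_l. now apply Rmult_lt_0_compat. }
  assert (T1 : is_theta (fun r : R => K (r * e)) (fun r : R => r * e * C_derive K (r * e))).
  { apply (is_theta_ray K (fun z => z * C_derive K z)); auto.
    intros r Hr. apply (BesselK_pair nu K HK). auto. }
  assert (T2 : is_theta (fun r : R => r * e * C_derive K (r * e))
    (fun r : R => (e ^ 2 * RtoC r ^ 2 + nu ^ 2) * K (r * e))).
  { intros t Ht. eapply cder_eq; [|apply (is_theta_ray (fun z => z * C_derive K z)
      (fun z => (z ^ 2 + nu ^ 2) * K z) e He0); auto].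
    - f_equal. cbv beta. ring.
    - intros r Hr. apply (BesselK_pair nu K HK). auto. }
  assert (H2 := theta_bound_poly _ _ nu (e ^ 2) (fun r => exp (- (Re e * r))) B0 M ltac:(lra) HB0 T1 T2).
  set (c := (4 + 32 * Cmod (e ^ 2) + 8 * Cmod (nu ^ 2))%R) in *.
  assert (Hc : (4 <= c)%R).
  { unfold c. assert (h1 := Cmod_ge_0 (e ^ 2)). assert (h2 := Cmod_ge_0 (nu ^ 2)). lra. }
  exists M, (c * B0)%R. split; [lra|]. split; [apply Rmult_le_pos; lra|].
  intros r Hr. split.
  - eapply Rle_trans; [apply H1; auto|]. apply Rmult_le_compat_r; [left; apply exp_pos|].
    assert (h : (1 <= (1 + r) ^ 2)%R) by nra.
    assert (h1 : (0 <= c * B0)%R) by (apply Rmult_le_pos; lra).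
    apply Rle_trans with (c * B0 * 1)%R; [nra|]. apply Rmult_le_compat_l; auto.
  - apply H2; [|exact Hr]. intros r' t Hr' Ht. eapply Rle_trans; [apply H1; lra|].
    apply Rmult_le_compat_l; [exact HB0|].
    assert (Hle : (- (Re e * t) <= - (Re e * r'))%R) by nra.
    destruct Hle as [L|L]; [left; now apply exp_increasing|right; now rewrite L].
Qed.

(** Joins the energy bound near 0 to the decay at infinity. Some loss [d] cannot be avoided in
    general, since [K_0] has a logarithmic singularity. *)
Lemma BesselK_rapid (nu : C) (K : C -> C) (d : R) : is_BesselK nu K -> (0 < d)%R ->
  rapid (Rabs (Re nu) + d) (fun t : R => K t) /\
  rapid (Rabs (Re nu) + d) (fun t : R => t * C_derive K t) /\
  is_theta (fun t : R => K t) (fun t : R => t * C_derive K t) /\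
  is_theta (fun t : R => t * C_derive K t) (fun t : R => (RtoC t ^ 2 + nu ^ 2) * K t).
Proof.
  intros HK Hd.
  assert (HR : forall r, (0 < r)%R -> slit_plane r).
  { intros r Hr. apply slit_of_Re_pos. now rewrite re_RtoC. }
  assert (T1 : is_theta (fun t : R => K t) (fun t : R => t * C_derive K t)).
  { intros t Ht. eapply cder_eq; [|apply (cder_comp RtoC idC (fun t : R => RtoC t) K);
      [apply cder_io|apply (BesselK_pair nu K HK); auto]]. ring. }
  assert (T2 : is_theta (fun t : R => t * C_derive K t) (fun t : R => (RtoC t ^ 2 + nu ^ 2) * K t)).
  { intros t Ht. eapply cder_eq; [|apply (cder_comp RtoC idC (fun t : R => RtoC t)
      (fun z => z * C_derive K z)); [apply cder_io|apply (BesselK_pair nu K HK); auto]]. ring. }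
  destruct (near_zero_bound nu _ _ d Hd T1 T2) as [D [HD0 HD]].
  destruct (BesselK_decay nu 1 K HK) as [M [B [HM [HB HMB]]]].
  { rewrite re_RtoC. lra. }
  rewrite re_RtoC in HMB.
  assert (Hrho : (0 <= Rabs (Re nu) + d)%R) by (assert (h := Rabs_pos (Re nu)); lra).
  repeat split; auto.
  - now apply (is_theta_cont _ _ T1).
  - apply (rapid_intro _ _ d D M B 1 2); auto; try lra.
    + now apply (is_theta_cont _ _ T1).
    + intros t Ht. now apply HD.
    + intros t Ht. specialize (HMB t Ht). rewrite Cmult_1_r in HMB. apply HMB.
  - now apply (is_theta_cont _ _ T2).
  - apply (rapid_intro _ _ d D M B 1 2); auto; try lra.
    + now apply (is_theta_cont _ _ T2).
    + intros t Ht. now apply HD.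
    + intros t Ht. specialize (HMB t Ht). rewrite Cmult_1_r in HMB. apply HMB.
Qed.

(** * Wronskians and uniqueness for Bessel's equation *)

Definition bessel_pair (nu : C) (w v : C -> C) : Prop :=
  forall z, (0 < Re z)%R -> cderC w z (v z / z) /\ cderC v z ((nu ^ 2 - z ^ 2) * w z / z).

(** The expression is [z] times the usual Wronskian, so this is Abel's identity. The half-plane is
    convex, so integrating along a segment is enough. *)
Lemma wronskian_const (nu : C) (w1 v1 w2 v2 : C -> C) :
  bessel_pair nu w1 v1 -> bessel_pair nu w2 v2 ->
  forall z z', (0 < Re z)%R -> (0 < Re z')%R ->
    w1 z * v2 z - v1 z * w2 z = w1 z' * v2 z' - v1 z' * w2 z'.
Proof.
  intros H1 H2 z z' Hz Hz'.
  set (T := fun z => w1 z * v2 z - v1 z * w2 z). change (T z = T z').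
  assert (HT : forall y, (0 < Re y)%R -> cderC T y 0).
  { intros y Hy. assert (Hy0 := Re_pos_neq_0 y Hy).
    eapply cder_eq; [|apply cder_minus; apply cder_mult; first [apply H1|apply H2]; auto].
    field. exact Hy0. }
  set (g := fun s : R => z + s * (z' - z)).
  assert (E : T (g 1%R) = T (g 0%R)).
  { apply (cder_0_const (fun s => T (g s))); [lra|].
    intros t Ht. eapply cder_eq; [|apply (cder_comp RtoC idC g T)].
    2: { apply (cder_plus RtoC (fun _ => z) (fun s : R => s * (z' - z))); [apply cder_const|].
         apply cder_mult; [apply cder_io|apply cder_const]. }
    2: { apply HT. unfold g. rewrite re_plus, re_scal_l, Re_minus. nra. }
    ring. }
  unfold g in E. replace (z + 1 * (z' - z)) with z' in E by ring.
  replace (z + 0 * (z' - z)) with z in E by ring. now rewrite E.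
Qed.

Lemma le_0_of_exp_decay (x A M : R) (j : nat) :
  (forall r, (M < r)%R -> (x <= A * (1 + r) ^ j * exp (- r))%R) -> (x <= 0)%R.
Proof.
  intros H. apply Rnot_lt_le. intros Hx.
  destruct (pow_le_exp 1 (S j) Rlt_0_1) as [c [Hc Hj]].
  set (y := (Rabs A * c / x)%R).
  assert (Hy : (0 <= y)%R).
  { apply Rmult_le_pos; [|left; now apply Rinv_0_lt_compat].
    apply Rmult_le_pos; [apply Rabs_pos|lra]. }
  set (r := (Rmax M 0 + 1 + y)%R).
  assert (h1 := Rmax_l M 0). assert (h2 := Rmax_r M 0).
  assert (Hr : (0 < r)%R) by (unfold r; lra).
  specialize (H r ltac:(unfold r; lra)). specialize (Hj r Hr). rewrite Rmult_1_l in Hj.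
  assert (Hb : (x * (1 + r) <= Rabs A * c)%R).
  { apply Rle_trans with (Rabs A * (1 + r) ^ S j * exp (- r))%R.
    - replace (Rabs A * (1 + r) ^ S j * exp (- r))%R
        with (Rabs A * ((1 + r) ^ j * exp (- r)) * (1 + r))%R by (simpl; ring).
      apply Rmult_le_compat_r; [lra|]. eapply Rle_trans; [exact H|]. rewrite Rmult_assoc.
      apply Rmult_le_compat_r; [|apply Rle_abs].
      apply Rmult_le_pos; [apply pow_le; lra|left; apply exp_pos].
    - rewrite Rmult_assoc. apply Rmult_le_compat_l; [apply Rabs_pos|].
      apply (Rmult_le_compat_r (exp (- r))) in Hj; [|left; apply exp_pos].
      rewrite Rmult_assoc, <- exp_plus, Rplus_opp_r, exp_0 in Hj. lra. }
  replace (Rabs A * c)%R with (x * y)%R in Hb by (unfold y; field; lra).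
  apply Rmult_le_reg_l in Hb; [unfold r in Hb; lra|exact Hx].
Qed.

Lemma Ci_sqr : Ci ^ 2 = - (1).
Proof. apply C_eq; unfold Ci, Re, Im; simpl; ring. Qed.

(** The substitution [z -> c z] with [c^2 = -1] changes the sign of [z^2] in the modified equation.
    Since [c z] is never real, it stays in the slit plane, where [K] is known to solve it. *)
Lemma BesselK_rotated (nu c : C) (K : C -> C) : is_BesselK nu K -> c ^ 2 = - (1) ->
  (forall z, (0 < Re z)%R -> Im (c * z)%C <> 0%R) ->
  bessel_pair nu (fun z => K (c * z)) (fun z => c * z * C_derive K (c * z)).
Proof.
  intros HK Hc HI z Hz. assert (Hs := slit_of_Im _ (HI z Hz)).
  assert (Hz0 := Re_pos_neq_0 z Hz). assert (Hcz := proj1 Hs).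
  assert (Hc0 : c <> 0) by (intros E; apply Hcz; rewrite E; ring).
  destruct (BesselK_pair nu K HK _ Hs) as [H1 H2].
  assert (Hl : cderC (fun y => c * y) z (c * 1)) by (apply cder_scal, (cder_io idC)).
  split.
  - eapply cder_eq; [|apply (cder_comp idC idC (fun y => c * y) K); [exact Hl|exact H1]].
    field. auto.
  - eapply cder_eq; [|apply (cder_comp idC idC (fun y => c * y) (fun z => z * C_derive K z));
      [exact Hl|exact H2]].
    replace ((c * z) ^ 2) with (c ^ 2 * z ^ 2) by ring. rewrite Hc. field. auto.
Qed.

(* [K] decays on the ray through [c e], so it is the recessive solution there. *)
Lemma wronskian_recessive (nu c e : C) (K D V : C -> C) (B M : R) (p : nat) :
  is_BesselK nu K -> c ^ 2 = - (1) -> (forall z, (0 < Re z)%R -> Im (c * z)%C <> 0%R) ->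
  Re e = 1%R -> Re (c * e)%C = 1%R -> bessel_pair nu D V ->
  (forall r, (M < r)%R -> (Cmod (D (r * e)%C) <= B * (1 + r) ^ p)%R) ->
  forall z, (0 < Re z)%R -> D z * (c * z * C_derive K (c * z)) - V z * K (c * z) = 0.
Proof.
  intros HK Hc HI He Hce HD HB z Hz.
  destruct (BesselK_decay nu (c * e) K HK) as [M1 [B1 [HM1 [HB1 H1]]]]; [lra|].
  rewrite Hce in H1.
  assert (He0 : e <> 0) by (apply Re_pos_neq_0; lra).
  assert (HR : forall r, (0 < r)%R -> (0 < Re (r * e)%C)%R).
  { intros r Hr. rewrite re_scal_l. nra. }
  set (B0 := Rabs B). set (M0 := Rmax (Rmax M M1) 1).
  assert (L1 : (M <= M0)%R) by (eapply Rle_trans; [apply Rmax_l|apply Rmax_l]).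
  assert (L2 : (M1 <= M0)%R) by (eapply Rle_trans; [apply Rmax_r|apply Rmax_l]).
  assert (L3 : (1 <= M0)%R) by apply Rmax_r.
  assert (HB0 : forall r t, (M0 < r)%R -> (r <= t <= 2 * r)%R ->
    (Cmod (D (t * e)%C) <= B0 * (1 + 2 * r) ^ p)%R).
  { intros r t Hr Ht. eapply Rle_trans; [apply HB; lra|].
    apply Rle_trans with (B0 * (1 + t) ^ p)%R.
    - apply Rmult_le_compat_r; [apply pow_le; lra|apply Rle_abs].
    - apply Rmult_le_compat_l; [apply Rabs_pos|apply pow_incr; lra]. }
  assert (T1 : is_theta (fun r : R => D (r * e)) (fun r : R => V (r * e))).
  { apply is_theta_ray; auto. intros r Hr. apply HD. auto. }
  assert (T2 : is_theta (fun r : R => V (r * e)) (fun r : R => (- e ^ 2 * RtoC r ^ 2 + nu ^ 2) * D (r * e))).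
  { intros t Ht. eapply cder_eq; [|apply (is_theta_ray V (fun z => (nu ^ 2 - z ^ 2) * D z) e He0); auto].
    - f_equal. cbv beta. ring.
    - intros r Hr. apply HD. auto. }
  assert (HV := theta_bound_poly _ _ nu (- e ^ 2) (fun r => ((1 + 2 * r) ^ p)%R) B0 M0
    ltac:(lra) (Rabs_pos _) T1 T2 HB0).
  set (A := (4 + 32 * Cmod (- e ^ 2)%C + 8 * Cmod (nu ^ 2))%R) in *.
  assert (HA : (4 <= A)%R).
  { unfold A. assert (h1 := Cmod_ge_0 (- e ^ 2)). assert (h2 := Cmod_ge_0 (nu ^ 2)). lra. }
  assert (HB0' : (0 <= B0)%R) by apply Rabs_pos.
  apply Cmod_eq_0, Rle_antisym; [|apply Cmod_ge_0].
  (* The exponent [4 + p] collects [(1 + r)^2] from the bound on [K] or its derivative, [(1 + r)^2]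
     from the bound on [V], and [(1 + 2 r)^p] from the growth of [D]. *)
  apply (le_0_of_exp_decay _ (2 * (A * B0 * 2 ^ p * B1)) M0 (4 + p)).
  intros r Hr. assert (Hr0 : (0 < r)%R) by lra.
  rewrite (wronskian_const nu D V (fun z => K (c * z)) (fun z => c * z * C_derive K (c * z)) HD
    (BesselK_rotated nu c K HK Hc HI) z (r * e) Hz (HR r Hr0)).
  replace (c * (r * e)) with (r * (c * e)) by ring.
  destruct (H1 r ltac:(lra)) as [K1 K2]. specialize (HV r Hr).
  assert (HD1 := HB0 r r Hr ltac:(lra)).
  rewrite Rmult_1_l in K1, K2.
  eapply Rle_trans; [apply Cmod_triangle|]. rewrite Cmod_opp, !(Cmod_mult (D _)), (Cmod_mult (V _)).
  assert (P2 : ((1 + 2 * r) ^ p <= 2 ^ p * (1 + r) ^ p)%R).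
  { rewrite <- Rpow_mult_distr. apply pow_incr. lra. }
  assert (P1 : (1 <= (1 + r) ^ 2)%R) by nra.
  assert (P0 : (0 <= (1 + 2 * r) ^ p)%R) by (apply pow_le; lra).
  assert (P3 : (0 <= A * B0)%R) by (apply Rmult_le_pos; lra).
  assert (HD2 : (Cmod (D (r * e)%C) <= A * B0 * (1 + r) ^ 2 * (2 ^ p * (1 + r) ^ p))%R).
  { eapply Rle_trans; [exact HD1|]. apply Rmult_le_compat; auto.
    apply Rle_trans with (A * B0 * 1)%R; [nra|]. apply Rmult_le_compat_l; auto. }
  assert (HV2 : (Cmod (V (r * e)%C) <= A * B0 * (1 + r) ^ 2 * (2 ^ p * (1 + r) ^ p))%R).
  { eapply Rle_trans; [exact HV|]. apply Rmult_le_compat_l; auto.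
    apply Rmult_le_pos; lra. }
  set (X := (A * B0 * (1 + r) ^ 2 * (2 ^ p * (1 + r) ^ p))%R) in *.
  set (Y := (B1 * (1 + r) ^ 2 * exp (- r))%R) in *.
  replace (2 * (A * B0 * 2 ^ p * B1) * (1 + r) ^ (4 + p) * exp (- r))%R with (X * Y + X * Y)%R.
  2: { unfold X, Y. rewrite pow_add. ring. }
  apply Rplus_le_compat; apply Rmult_le_compat; auto; apply Cmod_ge_0.
Qed.

Lemma Ci_opp_sqr : (- Ci) ^ 2 = - (1).
Proof. rewrite <- Ci_sqr. ring. Qed.

Lemma Im_Ci_mult (z : C) : (0 < Re z)%R -> Im (Ci * z) <> 0%R.
Proof. unfold Ci, Cmult, Re, Im; simpl. lra. Qed.

Lemma Im_Ci_opp_mult (z : C) : (0 < Re z)%R -> Im (- Ci * z) <> 0%R.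
Proof. unfold Ci, Copp, Cmult, Re, Im; simpl. lra. Qed.

(** On the ray of direction [e = 1 - i] the two rotations look at [K] along [1 + i], where it
    decays, and along [-(1 + i)], where it grows. A vanishing Wronskian would make their quotient
    constant there; it tends to 0, so [K] would vanish at a point where its asymptotics forbid
    it. *)
Lemma BesselK_rotations_independent (nu : C) (K : C -> C) : is_BesselK nu K ->
  forall z, (0 < Re z)%R ->
    K (Ci * z) * (- Ci * z * C_derive K (- Ci * z))
    - Ci * z * C_derive K (Ci * z) * K (- Ci * z) <> 0.
Proof.
  intros HK z Hz HW.
  assert (B1 := BesselK_rotated nu Ci K HK Ci_sqr Im_Ci_mult).
  assert (B2 := BesselK_rotated nu (- Ci) K HK Ci_opp_sqr Im_Ci_opp_mult).
  set (e := 1 - Ci).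
  assert (He : Re e = 1%R) by (unfold e, Ci, Re; simpl; ring).
  assert (E1 : Ci * e = 1 + Ci).
  { unfold e. replace (Ci * (1 - Ci)) with (Ci - Ci ^ 2) by ring. rewrite Ci_sqr. ring. }
  assert (E2 : - Ci * e = - (1 + Ci)) by (rewrite <- E1; ring).
  assert (S1 : slit_plane (1 + Ci)) by (apply slit_of_Im; unfold Ci, Im; simpl; lra).
  assert (S2 : slit_plane (- (1 + Ci))) by (apply slit_of_Im; unfold Ci, Im; simpl; lra).
  destruct (BesselK_ray nu _ K HK S1) as [M1 [HM1 H1]].
  destruct (BesselK_ray nu _ K HK S2) as [M2 [HM2 H2]].
  rewrite Cmod_opp in H2.
  assert (R1 : Re (1 + Ci) = 1%R) by (unfold Ci, Re; simpl; ring).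
  rewrite re_opp, R1 in H2. rewrite R1 in H1.
  assert (Hm := Cmod_pos _ (proj1 S1)). set (m := Cmod (1 + Ci)) in *.
  set (M := (Rmax M1 M2 + 1)%R).
  assert (L1 : (M1 < M)%R) by (unfold M; assert (h := Rmax_l M1 M2); lra).
  assert (L2 : (M2 < M)%R) by (unfold M; assert (h := Rmax_r M1 M2); lra).
  assert (N2 : forall r : R, (M <= r)%R -> K (r * - (1 + Ci)) <> 0).
  { intros r Hr. apply H2. lra. }
  set (k1 := fun r : R => K (r * (1 + Ci))). set (k2 := fun r : R => K (r * - (1 + Ci))).
  assert (He0 : e <> 0) by (apply Re_pos_neq_0; lra).
  assert (HR : forall r, (0 < r)%R -> (0 < Re (r * e)%C)%R).
  { intros r Hr. rewrite re_scal_l. nra. }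
  assert (Hconst : forall r : R, (M <= r)%R -> k1 r / k2 r = k1 M / k2 M).
  { intros r Hr.
    apply (cder_0_const (fun r => k1 r / k2 r) M r Hr).
    intros t Ht. assert (Ht0 : (0 < t)%R) by lra. assert (Ht1 := RtoC_neq_0 t Ht0).
    assert (D1 := is_theta_ray _ _ e He0 (fun r Hr => proj1 (B1 (r * e) (HR r Hr))) t Ht0).
    assert (D2 := is_theta_ray _ _ e He0 (fun r Hr => proj1 (B2 (r * e) (HR r Hr))) t Ht0).
    cbv beta in D1, D2.
    assert (W := wronskian_const nu _ _ _ _ B1 B2 z (t * e) Hz (HR t Ht0)).
    cbv beta in W. rewrite HW in W.
    assert (A1 : forall r : R, Ci * (r * e) = r * (1 + Ci)) by (intros; rewrite <- E1; ring).
    assert (A2 : forall r : R, - Ci * (r * e) = r * - (1 + Ci)) by (intros; rewrite <- E2; ring).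
    rewrite A1, A2 in W. rewrite A1 in D1. rewrite A2 in D2.
    assert (D1' : cderR k1 t (t * (1 + Ci) * C_derive K (t * (1 + Ci)) / t)).
    { eapply cder_ext; [|exact D1]. intros y. unfold k1. now rewrite A1. }
    assert (D2' : cderR k2 t (t * - (1 + Ci) * C_derive K (t * - (1 + Ci)) / t)).
    { eapply cder_ext; [|exact D2]. intros y. unfold k2. now rewrite A2. }
    assert (Hk2 : k2 t <> 0) by (apply N2; lra).
    eapply cder_eq; [|apply (cder_mult RtoC k1 (fun r => / k2 r)); [exact D1'|]].
    2: { apply cder_inv; [exact Hk2|exact D2']. }
    cbv beta. fold (k1 t) in W. fold (k2 t) in W.
    replace (t * (1 + Ci) * C_derive K (t * (1 + Ci)) / t * / k2 t +
      k1 t * (- (t * - (1 + Ci) * C_derive K (t * - (1 + Ci)) / t) / (k2 t * k2 t)))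
      with (- (k1 t * (t * - (1 + Ci) * C_derive K (t * - (1 + Ci))) -
        t * (1 + Ci) * C_derive K (t * (1 + Ci)) * k2 t) / (t * (k2 t * k2 t))) by (field; auto).
    rewrite <- W. field. auto. }
  assert (HZ : (Cmod (k1 M / k2 M) <= 0)%R).
  { apply (le_0_of_exp_decay _ 3 M 0). intros r Hr. rewrite <- (Hconst r) by lra.
    assert (Hk2 := N2 r ltac:(lra)). unfold k1, k2. rewrite Cmod_div by exact Hk2.
    apply Cmod_pos in Hk2.
    destruct (H1 r ltac:(lra)) as [u _]. destruct (H2 r ltac:(lra)) as [_ [l _]].
    assert (Hg := sqrt_pos (PI / (2 * (r * m)))). set (g := sqrt (PI / (2 * (r * m)))) in *.
    apply Rmult_le_reg_r with (Cmod (K (r * - (1 + Ci))%C)); [exact Hk2|].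
    unfold Rdiv. rewrite Rmult_assoc, Rinv_l, Rmult_1_r by lra.
    eapply Rle_trans; [exact u|].
    apply Rle_trans with (3 * (1 + r) ^ 0 * exp (- r) * (1 / 2 * (g * exp (- (- (1) * r)))))%R.
    - simpl. replace (- (- (1) * r))%R with r by ring. rewrite Rmult_1_l.
      assert (h := exp_pos (- r)). assert (h2 : (1 <= exp r)%R).
      { assert (h2 := exp_ineq1_le r). lra. }
      replace (3 * 1 * exp (- r) * (1 / 2 * (g * exp r)))%R
        with (3 / 2 * (g * exp (- r)) * exp r)%R by field.
      assert (0 <= 3 / 2 * (g * exp (- r)))%R by nra.
      rewrite <- (Rmult_1_r (3 / 2 * (g * exp (- r)))) at 1. now apply Rmult_le_compat_l.
    - apply Rmult_le_compat_l; [|exact l]. simpl. assert (h := exp_pos (- r)). lra. }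
  assert (Hk2 := N2 M ltac:(lra)).
  assert (Hz0 : k1 M = 0).
  { assert (E : k1 M / k2 M = 0) by (apply Cmod_eq_0, Rle_antisym; [exact HZ|apply Cmod_ge_0]).
    replace (k1 M) with (k1 M / k2 M * k2 M) by (field; exact Hk2). rewrite E. ring. }
  exact (proj2 (proj2 (H1 M L1)) Hz0).
Qed.

(** Each rotation is recessive on one of the two rays: [K (i z)] on [arg z = - PI/4], [K (- i z)] on
    [arg z = PI/4]. Both Wronskians with [D] thus vanish, and Cramer's rule with the nonzero
    determinant gives [D = V = 0]. *)
Lemma bessel_unique (nu : C) (K D V : C -> C) (B M : R) (p : nat) :
  is_BesselK nu K -> bessel_pair nu D V ->
  (forall e, Re e = 1%R -> (Im e = 1%R \/ Im e = (-1)%R) ->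
    forall r, (M < r)%R -> (Cmod (D (r * e)%C) <= B * (1 + r) ^ p)%R) ->
  forall z, (0 < Re z)%R -> D z = 0 /\ V z = 0.
Proof.
  intros HK HD HB z Hz.
  assert (W1 : D z * (Ci * z * C_derive K (Ci * z)) - V z * K (Ci * z) = 0).
  { apply (wronskian_recessive nu Ci (1 - Ci) K D V B M p HK Ci_sqr Im_Ci_mult); auto.
    - unfold Ci, Re; simpl; ring.
    - unfold Ci, Re; simpl; ring.
    - apply HB; [unfold Ci, Re; simpl; ring|right; unfold Ci, Im; simpl; ring]. }
  assert (W2 : D z * (- Ci * z * C_derive K (- Ci * z)) - V z * K (- Ci * z) = 0).
  { apply (wronskian_recessive nu (- Ci) (1 + Ci) K D V B M p HK Ci_opp_sqr Im_Ci_opp_mult); auto.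
    - unfold Ci, Re; simpl; ring.
    - unfold Ci, Re; simpl; ring.
    - apply HB; [unfold Ci, Re; simpl; ring|left; unfold Ci, Im; simpl; ring]. }
  assert (W := BesselK_rotations_independent nu K HK z Hz).
  set (a := K (Ci * z)) in *. set (b := K (- Ci * z)) in *.
  set (a' := Ci * z * C_derive K (Ci * z)) in *.
  set (b' := - Ci * z * C_derive K (- Ci * z)) in *.
  split.
  - replace (D z) with (((D z * b' - V z * b) * a - (D z * a' - V z * a) * b) / (a * b' - a' * b))
      by (field; exact W).
    rewrite W1, W2. field. exact W.
  - replace (V z) with (((D z * b' - V z * b) * a' - (D z * a' - V z * a) * b') / (a * b' - a' * b))
      by (field; exact W).
    rewrite W1, W2. field. exact W.
Qed.

(** * Euler's limit for the Gamma function *)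

Lemma exp_rapid : rapid 0 (fun t => RtoC (exp (- t))).
Proof.
  split.
  - apply (ccont_cder _ (fun t => RtoC (- exp (- t)))). intros t _. apply cder_Cexp_real.
  - intros m. destruct (pow_le_exp 1 m Rlt_0_1) as [A [HA H]]. exists A. intros t Ht.
    specialize (H t Ht). rewrite Ropp_0, Rpower_O, Rmult_1_r by auto.
    rewrite Rmult_1_l in H. assert (hp := exp_pos (- t)).
    rewrite Cmod_R, Rabs_pos_eq by lra.
    apply Rle_trans with (exp (- t) * (A * exp t))%R.
    + apply Rmult_le_compat_l; lra.
    + replace (exp (- t) * (A * exp t))%R with (A * (exp (- t) * exp t))%R by ring.
      rewrite <- exp_plus, Rplus_opp_l, exp_0. lra.
Qed.

Lemma exp_theta : is_theta (fun t => RtoC (exp (- t))) (fun t => - (t * RtoC (exp (- t)))).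
Proof.
  intros t Ht. assert (H0 := RtoC_neq_0 t Ht).
  eapply cder_eq; [|apply cder_Cexp_real]. rewrite RtoC_opp. field. exact H0.
Qed.

Lemma rapid_id_mult (rho : R) (f : R -> C) : rapid rho f -> rapid rho (fun t => t * f t).
Proof.
  apply (rapid_mult rho f (fun t => RtoC t) 1 1).
  - apply ccont_io.
  - lra.
  - intros t Ht. rewrite Cmod_R, Rabs_pos_eq by lra. simpl. lra.
Qed.

Lemma rapid_ext (rho : R) (f g : R -> C) : (forall t, f t = g t) -> rapid rho f -> rapid rho g.
Proof.
  intros E [F1 F2]. split.
  - apply (ccont_ext f); auto.
  - intros m. destruct (F2 m) as [D HD]. exists D. intros t Ht. rewrite <- E. auto.
Qed.

(** The functional equation of Gamma: [J] is [Gamma (a + 1)]. *)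
Lemma gamma_rec (a J : C) : (-1 < Re a)%R ->
  improper (fun t => Cpower t a * RtoC (exp (- t))) J ->
  improper (fun t => Cpower t (a + 1) * RtoC (exp (- t))) ((a + 1) * J).
Proof.
  intros Ha HJ.
  assert (Hr : rapid 0 (fun t => - (t * RtoC (exp (- t))))).
  { apply (rapid_ext _ (fun t => (- (1)) * (t * RtoC (exp (- t))))); [intros; ring|].
    apply rapid_scal, rapid_id_mult, exp_rapid. }
  assert (H := mellin_theta 0 _ _ a J exp_rapid Hr exp_theta ltac:(lra) HJ).
  replace ((a + 1) * J) with ((- (1)) * (- (a + 1) * J)) by ring.
  apply (improper_ext (fun t => (- (1)) * (Cpower t a * - (t * RtoC (exp (- t)))))).
  - intros t Ht. rewrite Cpower_plus, Cpower_1 by now apply RtoC_neq_0. ring.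
  - now apply improper_scal.
Qed.

Lemma gamma_moments (n : nat) :
  improper (fun t => RtoC t ^ n * RtoC (exp (- t))) (INR (fact n)).
Proof.
  assert (H : improper (fun t => Cpower t (INR n) * RtoC (exp (- t))) (INR (fact n))).
  { induction n as [|n IH].
    - apply (improper_ext (fun t => RtoC (exp (- t)))).
      { intros t Ht. simpl. rewrite Cpower_0. ring. }
      simpl. replace (RtoC 1) with (0 - - (1)) by ring.
      apply (improper_ftc (fun t => - RtoC (exp (- t)))).
      + apply exp_rapid.
      + intros t _. apply (cder_ext RtoC (fun t => (- (1)) * RtoC (exp (- t)))); [intros; ring|].
        eapply cder_eq; [|apply cder_scal, cder_Cexp_real]. rewrite RtoC_opp. ring.
      + apply (clim_opp _). intros eps He.
        assert (Hc : continuous (fun t => exp (- t)) 0).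
        { apply (ex_derive_continuous (V := R_NormedModule)). auto_derive. auto. }
        apply RtoC_cont in Hc. rewrite Ropp_0, exp_0 in Hc.
        destruct (Hc eps He) as [d [Hd H]]. apply (at_right_0 _ d Hd).
        intros t Ht. apply H. rewrite <- RtoC_minus, Cmod_R, Rabs_pos_eq; lra.
      + replace (RtoC 0) with (- RtoC 0) by ring. apply (clim_opp _). intros eps He.
        exists (/ eps)%R. intros t Ht.
        replace (RtoC (exp (- t)) - 0) with (RtoC (exp (- t))) by ring.
        rewrite Cmod_R, Rabs_pos_eq by (left; apply exp_pos).
        rewrite exp_Ropp. assert (h := exp_ineq1_le t). assert (h' := Rinv_0_lt_compat _ He).
        rewrite <- (Rinv_inv eps). apply Rinv_lt_contravar; [|lra].
        apply Rmult_lt_0_compat; [auto|apply exp_pos].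
    - rewrite S_INR, RtoC_plus. change (fact (S n)) with (S n * fact n)%nat.
      rewrite mult_INR, S_INR, RtoC_mult, RtoC_plus.
      apply gamma_rec; [|exact IH]. rewrite re_RtoC. assert (h := pos_INR n). lra. }
  revert H. apply improper_ext. intros t Ht.
  now rewrite Cpower_INR by now apply RtoC_neq_0.
Qed.

Lemma clim_inv_INR : clim eventually (fun n => RtoC (/ INR n)) 0.
Proof.
  intros eps He. destruct (nfloor_ex (/ eps)) as [n [_ Hn]].
  { left. now apply Rinv_0_lt_compat. }
  exists (S n). intros m Hm.
  replace (RtoC (/ INR m) - 0) with (RtoC (/ INR m)) by ring.
  assert (Hm' : (INR n + 1 <= INR m)%R) by (rewrite <- S_INR; now apply le_INR).
  assert (h' := Rinv_0_lt_compat _ He).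
  rewrite Cmod_R, Rabs_pos_eq by (left; apply Rinv_0_lt_compat; lra).
  rewrite <- (Rinv_inv eps). apply Rinv_lt_contravar; [apply Rmult_lt_0_compat; lra|lra].
Qed.

Lemma INR_neq_0_C (n : nat) : (0 < n)%nat -> RtoC (INR n) <> 0.
Proof. intros H. apply RtoC_neq_0. now apply lt_0_INR. Qed.

Lemma clim_shift_ratio (c : C) : clim eventually (fun n => (INR n + c) / INR n) 1.
Proof.
  apply (clim_ext _ (fun n => 1 + c * RtoC (/ INR n))).
  - exists 1%nat. intros n Hn. assert (H := INR_neq_0_C n Hn).
    rewrite RtoC_inv by (apply not_0_INR; lia). field. exact H.
  - apply (clim_eq _ _ (1 + c * 0)); [ring|]. apply (clim_plus _); [apply (clim_const _)|].
    apply (clim_mult _); [apply (clim_const _)|apply clim_inv_INR].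
Qed.

(** The [j]-th moment of [t / n] under the density [t^n e^-t / n!]. *)
Definition moment (j n : nat) : C := INR (fact (n + j)) / (INR (fact n) * INR n ^ j).

Lemma fact_neq_0_C (n : nat) : RtoC (INR (fact n)) <> 0.
Proof. apply INR_neq_0_C, lt_O_fact. Qed.

Lemma moment_lim (j : nat) : clim eventually (moment j) 1.
Proof.
  induction j as [|j IH].
  - apply (clim_ext _ (fun _ => 1)); [|apply (clim_const _)].
    apply filter_forall. intros n. unfold moment. rewrite Nat.add_0_r. simpl.
    field. apply fact_neq_0_C.
  - apply (clim_ext _ (fun n => moment j n * ((INR n + RtoC (INR (S j))) / INR n))).
    + exists 1%nat. intros n Hn. assert (H := INR_neq_0_C n Hn).
      assert (H1 := fact_neq_0_C n).
      unfold moment. replace (n + S j)%nat with (S (n + j)) by lia.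
      change (fact (S (n + j))) with (S (n + j) * fact (n + j))%nat.
      rewrite mult_INR, RtoC_mult, Cpow_S. replace (S (n + j)) with (n + S j)%nat by lia.
      rewrite plus_INR, RtoC_plus. field. repeat split; auto. now apply Cpow_nz.
    + apply (clim_eq _ _ (1 * 1)); [ring|]. apply (clim_mult _); [exact IH|apply clim_shift_ratio].
Qed.

Lemma moment_integral (j n : nat) : (0 < n)%nat ->
  improper (fun t => RtoC t ^ n * RtoC (exp (- t)) / INR (fact n) * (RtoC (t / INR n) ^ j))
    (moment j n).
Proof.
  intros Hn. assert (H := INR_neq_0_C n Hn). assert (H1 := fact_neq_0_C n).
  assert (H2 := Cpow_nz _ j H).
  replace (moment j n) with (/ (INR (fact n) * INR n ^ j) * INR (fact (n + j)))
    by (unfold moment; field; auto).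
  apply (improper_ext (fun t => / (INR (fact n) * INR n ^ j) * (RtoC t ^ (n + j) * RtoC (exp (- t))))).
  - intros t Ht. rewrite RtoC_div by (apply not_0_INR; lia).
    unfold Cdiv at 2. rewrite Cpow_mult_l, Cpow_inv, Cpow_add_r by auto. field. auto.
  - apply improper_scal, gamma_moments.
Qed.

(* Chebyshev's argument: [t^n e^-t / n!] is a probability density concentrated at
   [t = n], and the moments [E((t/n)^j)] tend to [1]. *)
Lemma gamma_concentration (h : R -> C) (hoo s : C) :
  (0 <= Re s)%R -> ccont h ->
  (forall T, exists B, forall t, (0 < t <= T)%R -> (Cmod (Cpower t s * h t) <= B)%R) ->
  clim (Rbar_locally p_infty) h hoo ->
  forall eps, (0 < eps)%R -> exists N, forall n J, (N <= n)%nat ->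
    improper (fun t => RtoC t ^ n * RtoC (exp (- t)) * (Cpower t s * h t)) J ->
    (Cmod (J / (INR (fact n) * Cpower (INR n) s) - hoo) < eps)%R.
Proof.
  intros Hs Hh HB Hlim eps Heps.
  assert (Hho := Cmod_ge_0 hoo).
  destruct (Hlim 1%R Rlt_0_1) as [T0 HT0]. set (T1 := Rmax T0 1).
  assert (HT1 : (1 <= T1)%R) by apply Rmax_r. assert (HT2 : (T0 <= T1)%R) by apply Rmax_l.
  destruct (HB T1) as [B HB']. set (B1 := (Cmod hoo + 1)%R).
  assert (HB0 : (0 <= B)%R) by (eapply Rle_trans; [apply Cmod_ge_0|apply (HB' 1%R); lra]).
  assert (HB1 : (0 <= B1)%R) by (unfold B1; lra).
  assert (HBt : forall t, (T1 < t)%R -> (Cmod (h t) <= B1)%R).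
  { intros t Ht. specialize (HT0 t ltac:(lra)).
    assert (h1 := Cmod_triangle_rev (h t) hoo). unfold B1. lra. }
  (* An integer [j >= Re s] replaces [x^(Re s)] by [1 + x^j], whose expectation is a combination of
     moments. *)
  destruct (nfloor_ex (Re s) Hs) as [j0 [_ Hj0]]. set (j := (j0 + 1)%nat).
  assert (Hj : (Re s <= INR j)%R) by (unfold j; rewrite plus_INR; simpl; lra).
  set (A := (B + B1 + Cmod hoo)%R).
  (* Pointwise bound in terms of [x = t / n]. For [|x - 1| < d] the error is at most [eps / 8];
     elsewhere Chebyshev's factor [(x - 1)^2 / d^2] is at least 1. *)
  assert (Claim : exists C1 n0, (0 <= C1)%R /\ (1 <= n0)%nat /\ forall n t, (n0 <= n)%nat -> (0 < t)%R ->
    (Cmod (Cpower t s * h t / Cpower (INR n) s - hoo) <=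
      eps / 8 + C1 * ((1 + (t / INR n) ^ j) * (t / INR n - 1) ^ 2))%R).
  { assert (Hc := cder_cont _ _ _ _ (cder_Cpower_real s 1 Rlt_0_1)).
    assert (E1 : Cpower 1%R s = 1).
    { unfold Cpower. rewrite Clog_pos_real, ln_1, Cmult_0_r by lra. apply Cexp_0. }
    cbv beta in Hc. rewrite E1 in Hc.
    set (e1 := Rmin 1 (eps / (16 * (Cmod hoo + 1)))).
    assert (He1 : (0 < e1)%R) by (apply Rmin_glb_lt; [lra|apply Rdiv_lt_0_compat; lra]).
    assert (He2 : (0 < eps / 32)%R) by lra.
    destruct (Hc e1 He1) as [d0 [Hd0 Hd]]. destruct (Hlim _ He2) as [T HT].
    set (d := Rmin d0 (1 / 2)). assert (Hdp : (0 < d)%R) by (apply Rmin_glb_lt; lra).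
    assert (Hdl : (d <= d0)%R) by apply Rmin_l. assert (Hdr : (d <= 1 / 2)%R) by apply Rmin_r.
    (* With [n > 2 T] and [x > 1/2], the point [t = n x] lies beyond [T], where [h] is near its
       limit. *)
    destruct (nfloor_ex (Rmax 0 (2 * T))) as [n0 [_ Hn0]]; [apply Rmax_l|].
    exists (A / d ^ 2)%R, (n0 + 1)%nat.
    assert (HA : (0 <= A)%R) by (unfold A; lra).
    assert (Hd2 : (0 < d ^ 2)%R) by (apply pow_lt; auto).
    split; [apply Rmult_le_pos; [auto|left; now apply Rinv_0_lt_compat]|]. split; [lia|].
    intros n t Hn Ht.
    assert (Hn1 : (1 <= INR n)%R) by (change 1%R with (INR 1); apply le_INR; lia).
    assert (Hn2 : (2 * T < INR n)%R).
    { apply Rle_lt_trans with (Rmax 0 (2 * T)); [apply Rmax_r|].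
      eapply Rlt_le_trans; [exact Hn0|]. replace (INR n0 + 1)%R with (INR (n0 + 1)).
      - now apply le_INR.
      - rewrite plus_INR. reflexivity. }
    set (x := (t / INR n)%R). assert (Hx : (0 < x)%R) by (apply Rdiv_lt_0_compat; lra).
    assert (Et : t = (INR n * x)%R) by (unfold x; field; lra).
    assert (Eq : Cpower t s * h t / Cpower (INR n) s = Cpower x s * h t).
    { rewrite Et at 1. rewrite Cpower_mult_pos by lra. field. apply Cpower_neq_0. }
    assert (Hp1 : (0 <= x ^ j)%R) by (apply pow_le; lra).
    assert (Hp2 : (0 <= (x - 1) ^ 2)%R) by apply pow2_ge_0.
    rewrite Eq. destruct (Rlt_dec (Rabs (x - 1)) d) as [L|L].
    - assert (Hx1 : (Cmod (Cpower x s - 1) < e1)%R).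
      { apply Hd. rewrite <- RtoC_minus, Cmod_R. lra. }
      apply Rabs_def2 in L.
      assert (Hht : (Cmod (h t - hoo) < eps / 32)%R).
      { apply HT. rewrite Et.
        assert (0 < INR n * (x - 1 / 2))%R by (apply Rmult_lt_0_compat; lra). lra. }
      assert (e1a : (e1 <= 1)%R) by apply Rmin_l.
      assert (e1b : (e1 * (Cmod hoo + 1) <= eps / 16)%R).
      { apply Rle_trans with (eps / (16 * (Cmod hoo + 1)) * (Cmod hoo + 1))%R.
        - apply Rmult_le_compat_r; [lra|apply Rmin_r].
        - right. field. lra. }
      assert (Hx2 := Cmod_triangle_rev (Cpower x s) 1). rewrite Cmod_1 in Hx2.
      replace (Cpower x s * h t - hoo) with (Cpower x s * (h t - hoo) + (Cpower x s - 1) * hoo) by ring.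
      eapply Rle_trans; [apply Cmod_triangle|]. rewrite !Cmod_mult.
      assert (Q1 : (Cmod (Cpower x s) * Cmod (h t - hoo) <= 2 * (eps / 32))%R).
      { apply Rmult_le_compat; try apply Cmod_ge_0; lra. }
      assert (Q2 : (Cmod (Cpower x s - 1) * Cmod hoo <= e1 * (Cmod hoo + 1))%R).
      { apply Rmult_le_compat; try apply Cmod_ge_0; lra. }
      assert (0 <= A / d ^ 2 * ((1 + x ^ j) * (x - 1) ^ 2))%R; [|lra].
      apply Rmult_le_pos; [apply Rmult_le_pos; [auto|left; now apply Rinv_0_lt_compat]|].
      apply Rmult_le_pos; lra.
    - assert (Hq : (Cmod (Cpower x s * h t) <= (B + B1) * (1 + x ^ j))%R).
      { destruct (Rle_dec t T1) as [L1|L1].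
        - rewrite <- Eq. rewrite Cmod_div by apply Cpower_neq_0.
          rewrite Cmod_Cpower_pos by lra.
          assert (Hr : (1 <= Rpower (INR n) (Re s))%R).
          { rewrite <- (Rpower_O (INR n)) by lra. apply Rle_Rpower; lra. }
          apply Rle_trans with B; [|nra].
          assert (Hb := HB' t ltac:(lra)).
          apply Rmult_le_reg_r with (Rpower (INR n) (Re s)); [lra|].
          unfold Rdiv. rewrite Rmult_assoc, Rinv_l by lra. nra.
        - rewrite Cmod_mult, Cmod_Cpower_pos by lra.
          assert (Hr : (Rpower x (Re s) <= 1 + x ^ j)%R).
          { destruct (Rle_dec x 1) as [L2|L2].
            - assert (Rpower x (Re s) <= 1)%R; [|lra].
              apply Rle_trans with (Rpower 1 (Re s)); [apply Rle_Rpower_l; lra|].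
              unfold Rpower. rewrite ln_1, Rmult_0_r, exp_0. lra.
            - assert (Rpower x (Re s) <= x ^ j)%R; [|lra].
              rewrite <- Rpower_pow by lra. apply Rle_Rpower; lra. }
          apply Rle_trans with ((1 + x ^ j) * B1)%R; [|nra].
          apply Rmult_le_compat; [left; apply Rpower_pos|apply Cmod_ge_0|exact Hr|apply HBt; lra]. }
      assert (Hd1 : (d ^ 2 <= (x - 1) ^ 2)%R).
      { rewrite <- (pow2_abs (x - 1)). apply pow_incr. lra. }
      eapply Rle_trans; [apply Cmod_triangle|]. rewrite Cmod_opp.
      apply Rle_trans with (A * (1 + x ^ j))%R; [unfold A; nra|].
      assert (Hk : (A * (1 + x ^ j) <= A / d ^ 2 * ((1 + x ^ j) * (x - 1) ^ 2))%R); [|lra].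
      replace (A / d ^ 2 * ((1 + x ^ j) * (x - 1) ^ 2))%R
        with (A * (1 + x ^ j) * ((x - 1) ^ 2 / d ^ 2))%R by (field; lra).
      rewrite <- (Rmult_1_r (A * (1 + x ^ j))) at 1. apply Rmult_le_compat_l; [apply Rmult_le_pos; lra|].
      apply Rmult_le_reg_r with (d ^ 2)%R; [exact Hd2|].
      unfold Rdiv. rewrite Rmult_assoc, Rinv_l by lra. lra. }
  destruct Claim as [C1 [n0 [HC1 [Hn0 Claim]]]].
  (* [V n] is the expectation of [(1 + x^j) (x - 1)^2] with the square expanded; as every moment
     tends to 1, it tends to 0. The final total is [2 (eps / 8 + eps / 4) < eps], the 2 coming from
     [improper_le]. *)
  set (V := fun n => (1 - 2 * moment 1 n + moment 2 n)
    + (moment j n - 2 * moment (j + 1) n + moment (j + 2) n)).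
  assert (HV : clim eventually V 0).
  { apply (clim_eq _ _ ((1 - 2 * 1 + 1) + (1 - 2 * 1 + 1))); [ring|].
    assert (K := fun j => clim_mult eventually _ _ _ _ (clim_const eventually 2) (moment_lim j)).
    apply (clim_plus _); apply (clim_plus _); try apply (clim_minus _);
      try apply moment_lim; try apply K; apply (clim_const _). }
  assert (He3 : (0 < eps / (4 * (C1 + 1)))%R) by (apply Rdiv_lt_0_compat; lra).
  destruct (HV _ He3) as [n1 Hn1].
  exists (max n0 n1). intros n J Hn HJ.
  assert (L0 : (n0 <= n)%nat) by lia. assert (L1 : (n1 <= n)%nat) by lia.
  assert (Hnp : (0 < n)%nat) by lia.
  specialize (Hn1 n L1). replace (V n - 0) with (V n) in Hn1 by ring.
  assert (N0 := INR_neq_0_C n Hnp). assert (F0 := fact_neq_0_C n).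
  assert (P0 := Cpower_neq_0 (INR n) s).
  set (w := fun t : R => RtoC t ^ n * RtoC (exp (- t)) / INR (fact n)).
  assert (M0 := moment_integral 0 n Hnp).
  assert (M00 : moment 0 n = 1).
  { unfold moment. rewrite Nat.add_0_r. simpl. field. exact F0. }
  rewrite M00 in M0. fold w in M0.
  assert (IL : improper (fun t => w t * (Cpower t s * h t / Cpower (INR n) s - hoo))
    (J / (INR (fact n) * Cpower (INR n) s) - hoo)).
  { replace (J / (INR (fact n) * Cpower (INR n) s) - hoo)
      with (/ (INR (fact n) * Cpower (INR n) s) * J - hoo * 1) by (field; auto).
    apply (improper_ext (fun t => / (INR (fact n) * Cpower (INR n) s) *
        (RtoC t ^ n * RtoC (exp (- t)) * (Cpower t s * h t)) - hoo * (w t * RtoC (t / INR n) ^ 0))).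
    - intros t Ht. unfold w. simpl Cpow at 3. field. auto.
    - apply improper_minus; apply improper_scal; auto. }
  set (pt := fun t : R => (eps / 8 + C1 * ((1 + (t / INR n) ^ j) * (t / INR n - 1) ^ 2))%R).
  assert (IR : improper (fun t => w t * RtoC (pt t)) (RtoC (eps / 8) + RtoC C1 * V n)).
  { assert (Mj := moment_integral j n Hnp). assert (Mj1 := moment_integral (j + 1) n Hnp).
    assert (Mj2 := moment_integral (j + 2) n Hnp). assert (M1 := moment_integral 1 n Hnp).
    assert (M2 := moment_integral 2 n Hnp). fold w in Mj, Mj1, Mj2, M1, M2.
    assert (G := improper_plus _ _ _ _ (improper_scal (RtoC (eps / 8)) _ _ M0)
      (improper_scal (RtoC C1) _ _ (improper_plus _ _ _ _
        (improper_plus _ _ _ _ (improper_minus _ _ _ _ M0 (improper_scal 2 _ _ M1)) M2)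
        (improper_plus _ _ _ _ (improper_minus _ _ _ _ Mj (improper_scal 2 _ _ Mj1)) Mj2)))).
    rewrite Cmult_1_r in G. fold (V n) in G. revert G. apply improper_ext.
    intros t Ht. unfold pt.
    rewrite RtoC_plus, (RtoC_mult C1), RtoC_mult, RtoC_plus, !RtoC_pow, RtoC_minus.
    rewrite !Cpow_add_r. set (X := RtoC (t / INR n)). set (Y := X ^ j). unfold w, Cdiv. ring. }
  assert (Hle := improper_le _ _ _ _ IL IR).
  assert (Hw : forall t, (0 < t)%R -> exists x, (0 <= x)%R /\ w t = RtoC x).
  { intros t Ht. exists (t ^ n * exp (- t) / INR (fact n))%R. split.
    - apply Rmult_le_pos; [apply Rmult_le_pos; [apply pow_le; lra|left; apply exp_pos]|].
      left. apply Rinv_0_lt_compat, INR_fact_lt_0.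
    - unfold w. rewrite RtoC_div, RtoC_mult, RtoC_pow; [reflexivity|]. apply INR_fact_neq_0. }
  eapply Rle_lt_trans; [apply Hle|].
  - intros t Ht. destruct (Hw t Ht) as [x [Hx Ex]]. rewrite Ex.
    rewrite <- RtoC_mult, re_RtoC, Cmod_mult, Cmod_R, Rabs_pos_eq by auto.
    apply Rmult_le_compat_l; [exact Hx|]. apply Claim; auto.
  - rewrite re_plus, re_RtoC, re_scal_l.
    assert (HRe := re_le_Cmod (V n)). assert (HRa := Rle_abs (Re (V n))).
    assert (Q : (C1 * Re (V n) <= (C1 + 1) * (eps / (4 * (C1 + 1))))%R).
    { apply Rle_trans with (C1 * (eps / (4 * (C1 + 1))))%R.
      - apply Rmult_le_compat_l; lra.
      - apply Rmult_le_compat_r; lra. }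
    replace ((C1 + 1) * (eps / (4 * (C1 + 1))))%R with (eps / 4)%R in Q by (field; lra). lra.
Qed.

Lemma clim_is_lim_seq (u : nat -> C) (l : C) : clim eventually u l ->
  is_lim_seq (fun n => Re (u n)) (Re l) /\ is_lim_seq (fun n => Im (u n)) (Im l).
Proof.
  intros H. split; apply is_lim_seq_spec; intros eps;
    generalize (H eps (cond_pos eps)); apply filter_imp; intros n Hn.
  - rewrite <- Re_minus. eapply Rle_lt_trans; [apply re_le_Cmod|exact Hn].
  - rewrite <- Im_minus. eapply Rle_lt_trans; [apply im_le_Cmod|exact Hn].
Qed.

Lemma RGamma_val (z l : C) : clim eventually (RGamma_seq z) l -> RGamma z = l.
Proof.
  intros H. destruct (clim_is_lim_seq _ _ H) as [H1 H2]. unfold RGamma.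
  rewrite (is_lim_seq_unique _ _ H1), (is_lim_seq_unique _ _ H2). simpl.
  apply C_eq; reflexivity.
Qed.

Lemma exp_integr (a : C) : (-1 < Re a)%R ->
  exists J, improper (fun t => Cpower t a * RtoC (exp (- t))) J.
Proof.
  intros Ha. apply (improper_ex _ (Re a - 0 + 1)); [lra|].
  apply rapid_integr1; [apply exp_rapid|lra].
Qed.

Lemma gamma_prod (z J : C) (n : nat) : (-1 < Re z)%R ->
  improper (fun t => Cpower t z * RtoC (exp (- t))) J ->
  improper (fun t => RtoC t ^ n * RtoC (exp (- t)) * (Cpower t z * 1))
    (Cprod (fun k => z + INR k) n * J).
Proof.
  intros Hz HJ.
  assert (H : improper (fun t => Cpower t (z + INR n) * RtoC (exp (- t)))
    (Cprod (fun k => z + INR k) n * J)).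
  { induction n as [|n IH].
    - simpl. rewrite Cmult_1_l. replace (z + 0) with z by ring. exact HJ.
    - replace (z + INR (S n)) with (z + INR n + 1) by (rewrite S_INR, RtoC_plus; ring).
      cbn [Cprod].
      replace (Cprod (fun k => z + INR k) n * (z + INR (S n)) * J)
        with ((z + INR n + 1) * (Cprod (fun k => z + INR k) n * J))
        by (rewrite S_INR, RtoC_plus; ring).
      apply gamma_rec; [|exact IH]. rewrite re_plus, re_RtoC. assert (h := pos_INR n). lra. }
  revert H. apply improper_ext. intros t Ht.
  rewrite Cpower_plus, Cpower_INR by now apply RtoC_neq_0. ring.
Qed.

(** Concentration with [h = 1] gives [(z + 1) ... (z + n) J ~ n! n^z], where [J = Gamma (z + 1)] is
    the integral of [t^z e^-t]. The limit of the quotient is 1, which also shows [J <> 0], so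
    Euler's sequence tends to [z / J]. *)
Lemma RGamma_seq_cv_pos (z : C) : (0 <= Re z)%R -> exists l, clim eventually (RGamma_seq z) l.
Proof.
  intros Hz. destruct (exp_integr z ltac:(lra)) as [J HJ].
  assert (HL : clim eventually (fun n => Cprod (fun k => z + INR k) n * J /
    (INR (fact n) * Cpower (INR n) z)) 1).
  { intros eps Heps. destruct (gamma_concentration (fun _ => 1) 1 z Hz (ccont_const 1)) with (eps := eps)
      as [N0 HN]; auto.
    - intros T. exists (Rpower T (Re z)). intros t Ht.
      rewrite Cmult_1_r, Cmod_Cpower_pos by lra. apply Rle_Rpower_l; lra.
    - apply (clim_const _).
    - exists N0. intros n Hn. apply (HN n _ Hn). apply gamma_prod; [lra|exact HJ]. }
  assert (HJ0 : J <> 0).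
  { intros E. apply C1_nz. apply (clim_unique eventually _ _ _ HL).
    apply (clim_ext _ (fun _ => 0)); [|apply (clim_const _)].
    apply filter_forall. intros n. rewrite E. unfold Cdiv. ring. }
  exists (z / J).
  apply (clim_ext _ (fun n => z / J * (Cprod (fun k => z + INR k) n * J /
    (INR (fact n) * Cpower (INR n) z)))).
  - apply filter_forall. intros n. unfold RGamma_seq. field.
    auto using Cpower_neq_0, fact_neq_0_C.
  - apply (clim_eq _ _ (z / J * 1)); [ring|].
    apply (clim_mult _); [apply (clim_const _)|exact HL].
Qed.

Lemma Cprod_shift (f : nat -> C) (n : nat) :
  Cprod (fun k => f (S k)) n * f 1%nat = Cprod f (S n).
Proof.
  induction n as [|n IH]; [simpl; ring|].
  change (Cprod f (S (S n))) with (Cprod f (S n) * f (S (S n))).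
  rewrite <- IH. simpl. ring.
Qed.

Lemma Cprod_ext (f g : nat -> C) (n : nat) : (forall k, f k = g k) -> Cprod f n = Cprod g n.
Proof. intros E. induction n as [|n IH]; simpl; [reflexivity|]. now rewrite IH, E. Qed.

(** [RGamma_seq z n] is [z * RGamma_seq (z + 1) n] times [n / (n + z + 1)]. It carries convergence
    one unit to the left, hence from [Re z >= 0] to the whole plane. *)
Lemma RGamma_seq_shift (z l : C) : clim eventually (RGamma_seq (z + 1)) l ->
  clim eventually (RGamma_seq z) (z * l).
Proof.
  intros H.
  apply (clim_ext _ (fun n => z * RGamma_seq (z + 1) n * / ((INR n + (z + 1)) / INR n))).
  - assert (A := clim_away _ _ _ C1_nz (clim_shift_ratio (z + 1))).
    generalize (filter_and _ _ A (ex_intro _ 1%nat (fun n (h : (1 <= n)%nat) => h) : eventually _)).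
    apply filter_imp. intros n [Hn1 Hn2].
    assert (N0 := INR_neq_0_C n Hn2). assert (F0 := fact_neq_0_C n).
    assert (P0 := Cpower_neq_0 (INR n) z).
    assert (Hq : INR n + (z + 1) <> 0).
    { intros E. rewrite E in Hn1. replace (0 / INR n) with (RtoC 0) in Hn1 by (field; auto).
      rewrite Cmod_0, Cmod_1 in Hn1. lra. }
    unfold RGamma_seq. rewrite Cpower_plus, Cpower_1 by exact N0.
    assert (E : (z + 1) * Cprod (fun k => z + 1 + INR k) n
      = Cprod (fun k => z + INR k) n * (INR n + (z + 1))).
    { transitivity (Cprod (fun k => z + INR k) (S n)).
      - rewrite <- Cprod_shift. rewrite Cmult_comm. f_equal.
        apply Cprod_ext. intros k. rewrite S_INR, RtoC_plus. ring.
      - cbn [Cprod]. rewrite S_INR, RtoC_plus. ring. }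
    rewrite E. field. auto.
  - apply (clim_eq _ _ (z * l * / 1)); [field|].
    apply (clim_mult _).
    + apply (clim_mult _); [apply (clim_const _)|exact H].
    + apply (clim_inv _); [apply C1_nz|apply clim_shift_ratio].
Qed.

Lemma RGamma_correct (z : C) : clim eventually (RGamma_seq z) (RGamma z).
Proof.
  assert (K : forall (n : nat) z, (0 <= Re z + INR n)%R -> exists l, clim eventually (RGamma_seq z) l).
  { intros n. induction n as [|n IH]; intros y Hy.
    - apply RGamma_seq_cv_pos. simpl in Hy. lra.
    - destruct (IH (y + 1)) as [l Hl].
      + rewrite S_INR in Hy. rewrite re_plus, re_RtoC. lra.
      + exists (y * l). now apply RGamma_seq_shift. }
  destruct (nfloor_ex (Rabs (Re z)) (Rabs_pos _)) as [n [_ Hn]].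
  destruct (K (S n) z) as [l Hl].
  - rewrite S_INR. assert (h := Rle_abs (- Re z)). rewrite Rabs_Ropp in h. lra.
  - now rewrite (RGamma_val z l Hl).
Qed.

Lemma RGamma_rec (z : C) : RGamma z = z * RGamma (z + 1).
Proof. apply RGamma_val, RGamma_seq_shift, RGamma_correct. Qed.

(** * Wallis' product *)

Definition Wn (n : nat) : R := RInt (fun t => (sin t) ^ n)%R 0 (PI / 2).

Lemma continuous_sin_pow (n : nat) (t : R) : continuous (fun t => (sin t) ^ n)%R t.
Proof.
  apply (ex_derive_continuous (V := R_NormedModule)). auto_derive. auto.
Qed.

Lemma ex_RInt_sin_pow (n : nat) : ex_RInt (fun t => (sin t) ^ n)%R 0 (PI / 2).
Proof. apply (ex_RInt_continuous (V := R_CompleteNormedModule)). intros. apply continuous_sin_pow. Qed.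

(** The integrand is the derivative of [sin^(n+1) cos], which vanishes at both ends. *)
Lemma Wn_rec (n : nat) : (INR (n + 2) * Wn (n + 2) = INR (n + 1) * Wn n)%R.
Proof.
  assert (H : is_RInt (fun t => INR (n + 1) * sin t ^ n - INR (n + 2) * sin t ^ (n + 2))%R 0 (PI / 2)
    (minus ((fun t => sin t ^ (n + 1) * cos t)%R (PI / 2)%R) ((fun t => sin t ^ (n + 1) * cos t)%R 0%R))).
  { apply (is_RInt_derive (V := R_CompleteNormedModule) (fun t => sin t ^ (n + 1) * cos t)%R).
    - intros t _. auto_derive; [auto|].
      replace (Init.Nat.pred (n + 1)) with n by lia.
      rewrite !pow_add, !plus_INR. simpl INR.
      assert (E := sin2_cos2 t). unfold Rsqr in E.
      transitivity ((INR n + 1) * sin t ^ n * (cos t * cos t) - sin t ^ n * sin t * sin t)%R;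
        [simpl; ring|].
      replace (cos t * cos t)%R with (1 - sin t * sin t)%R by lra. simpl. ring.
    - intros t _. apply (ex_derive_continuous (V := R_NormedModule)). auto_derive. auto. }
  assert (G := is_RInt_minus _ _ _ _ _ _
    (is_RInt_scal _ _ _ (INR (n + 1)) _ (RInt_correct _ _ _ (ex_RInt_sin_pow n)))
    (is_RInt_scal _ _ _ (INR (n + 2)) _ (RInt_correct _ _ _ (ex_RInt_sin_pow (n + 2))))).
  assert (U1 := is_RInt_unique _ _ _ _ H). assert (U2 := is_RInt_unique _ _ _ _ G).
  assert (E : RInt (fun t => INR (n + 1) * sin t ^ n - INR (n + 2) * sin t ^ (n + 2))%R 0 (PI / 2)
    = (INR (n + 1) * Wn n - INR (n + 2) * Wn (n + 2))%R) by exact U2.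
  rewrite U1 in E.
  change (sin (PI / 2) ^ (n + 1) * cos (PI / 2) - sin 0 ^ (n + 1) * cos 0
    = INR (n + 1) * Wn n - INR (n + 2) * Wn (n + 2))%R in E.
  rewrite cos_PI2, sin_0, pow_i in E by lia. lra.
Qed.

Lemma Wn_decr (n : nat) : (Wn (S n) <= Wn n)%R.
Proof.
  assert (HPI := PI_RGT_0).
  apply RInt_le; [lra|apply ex_RInt_sin_pow|apply ex_RInt_sin_pow|].
  intros t Ht. assert (h1 : (0 <= sin t)%R) by (apply sin_ge_0; lra).
  assert (h2 := SIN_bound t). assert (h3 := pow_le (sin t) n h1). simpl. nra.
Qed.

Lemma Wn_0 : Wn 0 = (PI / 2)%R.
Proof.
  unfold Wn. simpl. rewrite RInt_const. unfold scal; simpl. unfold mult; simpl. lra.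
Qed.

Lemma Wn_1 : Wn 1 = 1%R.
Proof.
  assert (H : is_RInt (fun t => sin t ^ 1)%R 0 (PI / 2)
    (minus ((fun t => - cos t)%R (PI / 2)%R) ((fun t => - cos t)%R 0%R))).
  { apply (is_RInt_derive (V := R_CompleteNormedModule) (fun t => - cos t)%R).
    - intros t _. auto_derive; [auto|]. ring.
    - intros t _. apply continuous_sin_pow. }
  assert (U := is_RInt_unique _ _ _ _ H). unfold Wn. etransitivity; [exact U|].
  change (- cos (PI / 2) - - cos 0 = 1)%R. rewrite cos_PI2, cos_0. ring.
Qed.

Lemma Wn_even (n : nat) : Wn (2 * n) = (PI / 2 * (INR (fact (2 * n)) / (4 ^ n * INR (fact n) ^ 2)))%R.
Proof.
  induction n as [|n IH].
  - simpl. rewrite Wn_0. field.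
  - replace (2 * S n)%nat with (2 * n + 2)%nat by lia.
    assert (R := Wn_rec (2 * n)). rewrite IH in R.
    replace (fact (2 * n + 2)) with ((2 * n + 2) * ((2 * n + 1) * fact (2 * n)))%nat.
    2: { replace (2 * n + 2)%nat with (S (S (2 * n))) by lia.
         replace (2 * n + 1)%nat with (S (2 * n)) by lia. reflexivity. }
    change (fact (S n)) with (S n * fact n)%nat.
    rewrite !mult_INR. assert (F := INR_fact_neq_0 n).
    assert (N1 : INR (2 * n + 2) <> 0%R) by (apply not_0_INR; lia).
    assert (N2 : INR (S n) <> 0%R) by (apply not_0_INR; lia).
    assert (P4 : (4 ^ n <> 0)%R) by (apply pow_nonzero; lra).
    apply Rmult_eq_reg_l with (INR (2 * n + 2)); [|exact N1]. rewrite R.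
    assert (E : INR (2 * n + 2) = (2 * INR (S n))%R).
    { replace (2 * n + 2)%nat with (2 * S n)%nat by lia. rewrite mult_INR. reflexivity. }
    rewrite E. change (4 ^ S n)%R with (4 * 4 ^ n)%R. set (sn := INR (S n)) in *. field. auto.
Qed.

Lemma Wn_product (n : nat) : (INR (2 * n + 1) * Wn (2 * n) * Wn (2 * n + 1) = PI / 2)%R.
Proof.
  induction n as [|n IH].
  - simpl. rewrite Wn_0, Wn_1. ring.
  - replace (2 * S n)%nat with (2 * n + 2)%nat by lia.
    assert (R1 := Wn_rec (2 * n)). assert (R2 := Wn_rec (2 * n + 1)).
    replace (2 * n + 1 + 2)%nat with (2 * n + 2 + 1)%nat in R2 by lia.
    replace (2 * n + 1 + 1)%nat with (2 * n + 2)%nat in R2 by lia.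
    assert (N1 : INR (2 * n + 2) <> 0%R) by (apply not_0_INR; lia).
    apply Rmult_eq_reg_l with (INR (2 * n + 2)); [|exact N1].
    transitivity (INR (2 * n + 2) * Wn (2 * n + 2) * (INR (2 * n + 2 + 1) * Wn (2 * n + 2 + 1)))%R; [ring|].
    rewrite R1, R2, <- IH. ring.
Qed.

(** The central binomial coefficient [binom (2 n, n)] divided by [4^n]. *)
Definition central (n : nat) : R := (INR (fact (2 * n)) / (4 ^ n * INR (fact n) ^ 2))%R.

Lemma central_pos (n : nat) : (0 < central n)%R.
Proof.
  apply Rdiv_lt_0_compat; [apply INR_fact_lt_0|].
  apply Rmult_lt_0_compat; apply pow_lt; [lra|apply INR_fact_lt_0].
Qed.

(** Monotonicity [Wn (2 n + 2) <= Wn (2 n + 1) <= Wn (2 n)] and the product formula squeeze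
    [x = PI n (central n)^2] between [2 n / (2 n + 1)] and 1. *)
Lemma central_bounds (n : nat) : (1 <= n)%nat ->
  (1 - / INR n <= sqrt (PI * INR n) * central n <= 1)%R.
Proof.
  intros Hn. assert (Hn' : (1 <= INR n)%R) by (change 1%R with (INR 1); now apply le_INR).
  assert (HPI := PI_RGT_0). assert (Hc := central_pos n).
  assert (W0 := Wn_even n). fold (central n) in W0.
  assert (P := Wn_product n).
  assert (D0 := Wn_decr (2 * n)). assert (D1 := Wn_decr (2 * n + 1)).
  replace (S (2 * n)) with (2 * n + 1)%nat in D0 by lia.
  replace (S (2 * n + 1)) with (2 * n + 2)%nat in D1 by lia.
  assert (Rc := Wn_rec (2 * n)).
  rewrite W0 in *.
  assert (E1 : INR (2 * n + 1) = (2 * INR n + 1)%R) by (rewrite plus_INR, mult_INR; simpl; ring).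
  assert (E2 : INR (2 * n + 2) = (2 * INR n + 2)%R) by (rewrite plus_INR, mult_INR; simpl; ring).
  rewrite E1 in P. rewrite E1, E2 in Rc.
  set (m := INR n) in *. set (c := central n) in *.
  set (w1 := Wn (2 * n + 1)) in *. set (w2 := Wn (2 * n + 2)) in *.
  set (x := (PI * m * c ^ 2)%R).
  assert (Hw1 : (w1 = / ((2 * m + 1) * c))%R).
  { apply Rmult_eq_reg_l with ((2 * m + 1) * (PI / 2 * c))%R.
    - rewrite P. field. split; [|lra]. nra.
    - apply Rmult_integral_contrapositive_currified; [lra|]. nra. }
  assert (Hx1 : (2 * m <= x * (2 * m + 1))%R).
  { assert (h : (1 <= (2 * m + 1) * c * (PI / 2 * c))%R).
    { apply Rle_trans with ((2 * m + 1) * c * w1)%R.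
      - rewrite Hw1. right. field. split; [|lra]. nra.
      - apply Rmult_le_compat_l; [nra|exact D0]. }
    unfold x. nra. }
  assert (Hx2 : (x <= 1)%R).
  { assert (h : ((2 * m + 1) * (PI / 2 * c) <= (2 * m + 2) * w1)%R).
    { rewrite <- Rc. apply Rmult_le_compat_l; lra. }
    rewrite Hw1 in h.
    assert (h2 : ((2 * m + 1) * (PI / 2 * c) * ((2 * m + 1) * c) <= 2 * m + 2)%R).
    { apply (Rmult_le_compat_r ((2 * m + 1) * c)) in h; [|nra].
      rewrite (Rmult_assoc (2 * m + 2)), Rinv_l in h by nra. lra. }
    assert (h3 : (x * ((2 * m + 1) ^ 2) <= (2 * m + 2) * (2 * m))%R).
    { replace (x * (2 * m + 1) ^ 2)%R
        with ((2 * m + 1) * (PI / 2 * c) * ((2 * m + 1) * c) * (2 * m))%R by (unfold x; field).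
      apply Rmult_le_compat_r; lra. }
    nra. }
  assert (Hx0 : (0 <= x)%R) by (unfold x; apply Rmult_le_pos; [nra|apply pow2_ge_0]).
  assert (Es : (sqrt (PI * m) * c = sqrt x)%R).
  { unfold x. rewrite (sqrt_mult_alt (PI * m)) by nra. now rewrite sqrt_pow2 by lra. }
  rewrite Es. split.
  (* [sqrt x >= x] because [0 <= x <= 1]. *)
  - apply Rle_trans with x.
    + assert (Hm : (m * / m = 1)%R) by (field; lra).
      assert (0 < / m)%R by (apply Rinv_0_lt_compat; lra).
      assert (h : ((1 - / m) * (2 * m + 1) <= x * (2 * m + 1))%R) by nra.
      apply Rmult_le_reg_r in h; lra.
    + rewrite <- (sqrt_sqrt x) at 1 by auto.
      assert (h := sqrt_pos x). assert (h2 : (sqrt x <= 1)%R) by (rewrite <- sqrt_1; now apply sqrt_le_1_alt).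
      nra.
  - rewrite <- sqrt_1. now apply sqrt_le_1_alt.
Qed.

Lemma wallis : clim eventually (fun n => RtoC (sqrt (PI * INR n) * central n)) 1.
Proof.
  apply (clim_squeeze _ _ _ (fun n => / INR n)%R).
  - exists 1%nat. intros n Hn. assert (H := central_bounds n Hn).
    rewrite <- RtoC_minus, Cmod_R. apply Rabs_le. lra.
  - intros eps He. destruct (clim_inv_INR eps He) as [N HN]. exists (max N 1). intros n Hn.
    specialize (HN n ltac:(lia)).
    replace (RtoC (/ INR n) - 0) with (RtoC (/ INR n)) in HN by ring.
    rewrite Cmod_R in HN. eapply Rle_lt_trans; [apply Rle_abs|exact HN].
Qed.

(** * The Mellin transform of the modified Bessel function *)

Lemma BesselK_scaled_limit (nu : C) (K : C -> C) : is_BesselK nu K ->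
  clim (Rbar_locally p_infty) (fun t : R => Cpower t (1 / 2) * RtoC (exp t) * K t)
    (Cpower (PI / 2)%R (1 / 2)).
Proof.
  intros [_ HS]. assert (HPI := PI_RGT_0).
  assert (HL : clim (Rbar_locally p_infty) (fun t : R =>
    K t / (Cpower (PI / (2 * t)) (1 / 2) * Cexp (- RtoC t))) 1).
  { intros eps He. destruct (HS PI HPI eps He) as [M HM]. exists (Rmax M 0). intros t Ht.
    assert (h1 := Rmax_l M 0). assert (h2 := Rmax_r M 0). apply HM.
    - rewrite Cmod_R, Rabs_pos_eq; lra.
    - rewrite Carg_pos_real by lra. rewrite Rabs_R0. lra. }
  apply (clim_ext _ (fun t : R => Cpower (PI / 2)%R (1 / 2) *
    (K t / (Cpower (PI / (2 * t)) (1 / 2) * Cexp (- RtoC t))))).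
  - exists 0%R. intros t Ht. assert (Ht0 := RtoC_neq_0 t Ht).
    assert (E : PI / (2 * t) = RtoC (PI / 2 * / t)).
    { rewrite RtoC_mult, RtoC_div, RtoC_inv by lra. field. exact Ht0. }
    rewrite E, Cpower_mult_pos, Cpower_inv_pos by (try apply Rinv_0_lt_compat; lra).
    rewrite Cexp_opp, Cexp_RtoC.
    assert (He : RtoC (exp t) <> 0) by (apply RtoC_neq_0, exp_pos).
    field. repeat split; auto; apply Cpower_neq_0.
  - apply (clim_eq _ _ (Cpower (PI / 2)%R (1 / 2) * 1)); [ring|].
    apply (clim_mult _); [apply (clim_const _)|exact HL].
Qed.

(** [theta] acts as [-(a + 1)], and [t^2] shifts [a] by 2, so the modified Bessel equation is a
    two-term recurrence. Iterated, it generates the products [lommel_a]. *)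
Lemma BesselK_mellin_rec (nu a J : C) (K : C -> C) (d : R) : is_BesselK nu K -> (0 < d)%R ->
  (0 < Re a - (Rabs (Re nu) + d) + 1)%R ->
  improper (fun t : R => Cpower t a * K t) J ->
  improper (fun t : R => Cpower t (a + 2) * K t) (((a + 1) ^ 2 - nu ^ 2) * J).
Proof.
  intros HK Hd Ha HJ. destruct (BesselK_rapid nu K d HK Hd) as [R1 [R2 [T1 T2]]].
  assert (H1 := mellin_theta _ _ _ a J R1 R2 T1 Ha HJ).
  assert (H2 := mellin_theta _ _ _ a _ R2 (rapid_quad _ _ (nu ^ 2) R1) T2 Ha H1).
  replace (((a + 1) ^ 2 - nu ^ 2) * J) with (- (a + 1) * (- (a + 1) * J) - nu ^ 2 * J) by ring.
  apply (improper_ext (fun t : R => Cpower t a * ((RtoC t ^ 2 + nu ^ 2) * K t)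
    - nu ^ 2 * (Cpower t a * K t))).
  - intros t Ht. rewrite Cpower_plus.
    assert (E2 : INR 2 = 2%R) by (simpl; ring).
    rewrite <- E2, Cpower_INR by now apply RtoC_neq_0. ring.
  - apply improper_minus; [exact H2|now apply improper_scal].
Qed.

Lemma BesselK_mellin_iter (nu a J : C) (K : C -> C) (d : R) (n : nat) : is_BesselK nu K -> (0 < d)%R ->
  (0 < Re a - (Rabs (Re nu) + d) + 1)%R ->
  improper (fun t : R => Cpower t a * K t) J ->
  improper (fun t : R => Cpower t (a + 2 * INR n) * K t)
    (lommel_a n a nu * J).
Proof.
  intros HK Hd Ha HJ. induction n as [|n IH].
  - simpl. unfold lommel_a. simpl. rewrite Cmult_1_l. replace (a + 2 * 0) with a by ring. exact HJ.
  - assert (H := BesselK_mellin_rec nu (a + 2 * INR n) (lommel_a n a nu * J) K d HK Hd).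
    assert (Hr : (0 < Re (a + 2 * INR n)%C - (Rabs (Re nu) + d) + 1)%R).
    { rewrite re_plus, re_scal_l, re_RtoC. assert (h := pos_INR n). lra. }
    specialize (H Hr IH).
    replace (a + 2 * INR (S n)) with (a + 2 * INR n + 2) by (rewrite S_INR, RtoC_plus; ring).
    unfold lommel_a in *. cbn [Cprod].
    replace (Cprod (fun k => (a + 2 * INR k - 1) ^ 2 - nu ^ 2) n * ((a + 2 * INR (S n) - 1) ^ 2 - nu ^ 2) * J)
      with (((a + 2 * INR n + 1) ^ 2 - nu ^ 2) * (Cprod (fun k => (a + 2 * INR k - 1) ^ 2 - nu ^ 2) n * J)).
    + exact H.
    + rewrite S_INR, RtoC_plus. ring.
Qed.

Lemma RtoC_INR_double (n : nat) : RtoC (INR (2 * n)) = 2 * INR n.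
Proof.
  assert (E : INR 2 = 2%R) by (simpl; ring).
  now rewrite mult_INR, RtoC_mult, E.
Qed.

(** [(a + 1 + 2 k)^2 - nu^2] splits into two linear factors, so the iterated recurrence yields the
    numerators of both Euler sequences. These have [n + 1] factors, whence [S n]. *)
Lemma gamma_factors (a nu : C) (n : nat) :
  ((a + 1 + nu) / 2 * Cprod (fun k => (a + 1 + nu) / 2 + INR k) n) *
  ((a + 1 - nu) / 2 * Cprod (fun k => (a + 1 - nu) / 2 + INR k) n) * 4 ^ S n
  = lommel_a (S n) a nu.
Proof.
  assert (H2 : RtoC 2 <> 0) by (apply RtoC_neq_0; lra).
  unfold lommel_a. induction n as [|n IH].
  - simpl. field.
  - change (Cprod (fun k => (a + 2 * INR k - 1) ^ 2 - nu ^ 2) (S (S n))) with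
      (Cprod (fun k => (a + 2 * INR k - 1) ^ 2 - nu ^ 2) (S n)
       * ((a + 2 * INR (S (S n)) - 1) ^ 2 - nu ^ 2)).
    rewrite <- IH. cbn [Cprod]. rewrite !S_INR, !RtoC_plus.
    rewrite (Cpow_S 4 (S n)). set (x := 4 ^ S n). field.
Qed.

Lemma Cpower_PI_half : Cpower PI (1 / 2) = RtoC (sqrt PI).
Proof.
  assert (HPI := PI_RGT_0).
  replace (1 / 2) with (RtoC (/ 2)) by (rewrite RtoC_inv by lra; unfold Cdiv; ring).
  rewrite Cpower_RtoC, Rpower_sqrt by auto. reflexivity.
Qed.

Lemma Cpower_2_2 (z : C) : z <> 0 -> Cpower z 2 = z ^ 2.
Proof.
  intros Hz. assert (E2 : INR 2 = 2%R) by (simpl; ring). now rewrite <- E2, Cpower_INR.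
Qed.

(** After [n + 1] steps of the recurrence the integral is [lommel_a (S n) a nu * J], and by
    concentration it is asymptotic to [sqrt (PI / 2) (2 n)! (2 n)^s]. Dividing by the denominators
    of the Euler sequences leaves [(2 n)! / (4^n n!^2)], which Wallis' product evaluates. *)
Lemma BesselK_mellin (nu a J : C) (K : C -> C) (d : R) : is_BesselK nu K -> (0 < d)%R ->
  (0 < Re a - (Rabs (Re nu) + d) + 1)%R ->
  improper (fun t : R => Cpower t a * K t) J ->
  RGamma ((a + 1 + nu) / 2) * RGamma ((a + 1 - nu) / 2) * J = Cpower 2 (a - 1).
Proof.
  intros HK Hd Ha HJ.
  assert (HPI := PI_RGT_0). assert (H2 : RtoC 2 <> 0) by (apply RtoC_neq_0; lra).
  assert (Hrn := Rabs_pos (Re nu)).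
  destruct (BesselK_rapid nu K d HK Hd) as [R1 _].
  set (rho := (Rabs (Re nu) + d)%R) in *.
  set (h := fun t : R => Cpower t (1 / 2) * RtoC (exp t) * K t).
  (* [t^(a + 2) K = e^-t t^s h]: the factor [t^(1/2) e^t] in [h], which gives it a limit at
     infinity, is compensated by [e^-t] and by [s = a + 2 - 1/2]. *)
  set (s := a + 3 / 2).
  assert (Hexp : ccont (fun t => RtoC (exp t))).
  { intros t _. apply RtoC_cont. apply (ex_derive_continuous (V := R_NormedModule)). auto_derive. auto. }
  assert (Hh : ccont h).
  { apply ccont_mult; [apply ccont_mult; [apply ccont_Cpower|exact Hexp]|apply R1]. }
  assert (Eh : forall t : R, (0 < t)%R -> Cpower t s * h t = Cpower t (a + 2) * RtoC (exp t) * K t).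
  { intros t Ht. unfold h, s. replace (a + 2) with (a + 3 / 2 + 1 / 2) by field.
    rewrite (Cpower_plus t (a + 3 / 2)). ring. }
  assert (E32 : Re (3 / 2) = (3 / 2)%R).
  { replace (3 / 2) with (RtoC (3 / 2)) by (rewrite RtoC_div by lra; reflexivity). apply re_RtoC. }
  set (I := fun n => lommel_a (S n) a nu * J).
  assert (HI : forall n, improper (fun t : R =>
    RtoC t ^ (2 * n) * RtoC (exp (- t)) * (Cpower t s * h t)) (I n)).
  { intros n. assert (G := BesselK_mellin_iter nu a J K d (S n) HK Hd Ha HJ). revert G.
    apply improper_ext. intros t Ht. assert (Ht0 := RtoC_neq_0 t Ht).
    rewrite Eh by exact Ht.
    replace (a + 2 * INR (S n)) with (a + 2 + INR (2 * n))
      by (rewrite RtoC_INR_double, S_INR, RtoC_plus; ring).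
    rewrite (Cpower_plus t (a + 2)), Cpower_INR by exact Ht0.
    replace (RtoC t ^ (2 * n) * RtoC (exp (- t)) * (Cpower t (a + 2) * RtoC (exp t) * K t))
      with (RtoC t ^ (2 * n) * (RtoC (exp (- t)) * RtoC (exp t)) * (Cpower t (a + 2) * K t)) by ring.
    rewrite <- RtoC_mult, <- exp_plus, Rplus_opp_l, exp_0. ring. }
  destruct (proj2 R1 0%nat) as [D HD].
  assert (HL : clim eventually (fun n => I n / (INR (fact (2 * n)) * Cpower (INR (2 * n)) s))
    (Cpower (PI / 2)%R (1 / 2))).
  { intros eps Heps.
    destruct (gamma_concentration h (Cpower (PI / 2)%R (1 / 2)) s) with (eps := eps)
      as [N0 HN]; auto.
    - unfold s. rewrite re_plus, E32. unfold rho in Ha. lra.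
    - intros T. exists (exp T * (Rabs D * Rpower T (Re (a + 2)%C + - rho)))%R.
      intros t Ht. specialize (HD t ltac:(lra)). simpl in HD. rewrite Rmult_1_r in HD.
      rewrite Eh, !Cmod_mult, Cmod_R, Cmod_Cpower_pos, (Rabs_pos_eq (exp t))
        by (lra || (left; apply exp_pos)).
      replace (Rpower t (Re (a + 2)) * exp t * Cmod (K t))%R
        with (exp t * (Rpower t (Re (a + 2)) * Cmod (K t)))%R by ring.
      apply Rmult_le_compat; [left; apply exp_pos| | |].
      + apply Rmult_le_pos; [left; apply Rpower_pos|apply Cmod_ge_0].
      + destruct (proj2 Ht) as [L|L]; [left; now apply exp_increasing|right; now rewrite L].
      + apply Rle_trans with (Rpower t (Re (a + 2)) * (Rabs D * Rpower t (- rho)))%R.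
        * apply Rmult_le_compat_l; [left; apply Rpower_pos|].
          eapply Rle_trans; [exact HD|]. apply Rmult_le_compat_r; [left; apply Rpower_pos|apply Rle_abs].
        * rewrite (Rmult_comm (Rabs D)), <- Rmult_assoc, <- Rpower_plus, Rmult_comm.
          apply Rmult_le_compat_l; [apply Rabs_pos|].
          apply Rle_Rpower_l; [|lra]. rewrite re_plus, re_RtoC. lra.
    - apply (BesselK_scaled_limit nu K HK).
    - exists N0. intros n Hn. apply HN; [lia|apply HI]. }
  assert (Hsp : RtoC (sqrt PI) <> 0) by (apply RtoC_neq_0, sqrt_lt_R0, HPI).
  assert (H4 : RtoC 4 <> 0) by (apply RtoC_neq_0; lra).
  (* [2^s] comes from [(2 n)^s], the 4 from [4^(n+1)] against [4^n], and [sqrt PI] is inserted to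
     match Wallis; the exponents of [n] leave [s - (a + 1) = 1/2]. *)
  assert (LL : clim eventually (fun n => RGamma_seq ((a + 1 + nu) / 2) n * RGamma_seq ((a + 1 - nu) / 2) n * J)
    (Cpower (PI / 2)%R (1 / 2) * (Cpower 2 s / 4 / RtoC (sqrt PI) * 1))).
  { apply (clim_ext _ (fun n => I n / (INR (fact (2 * n)) * Cpower (INR (2 * n)) s) *
      (Cpower 2 s / 4 / RtoC (sqrt PI) * RtoC (sqrt (PI * INR n) * central n)))).
    - exists 1%nat. intros n Hn. unfold I. rewrite <- gamma_factors.
      assert (N0 := INR_neq_0_C n Hn). assert (F0 := fact_neq_0_C n).
      assert (F2 := fact_neq_0_C (2 * n)).
      assert (Hnp : (0 < INR n)%R) by now apply lt_0_INR.
      assert (E1 : Cpower (INR (2 * n)) s = Cpower 2 s * Cpower (INR n) s).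
      { replace (INR (2 * n)) with (2 * INR n)%R by (rewrite mult_INR; simpl; ring).
        apply Cpower_mult_pos; lra. }
      assert (E2 : RtoC (sqrt (PI * INR n)) = RtoC (sqrt PI) * Cpower (INR n) (1 / 2)).
      { rewrite sqrt_mult by lra. rewrite RtoC_mult. f_equal.
        replace (1 / 2) with (RtoC (/ 2)) by (rewrite RtoC_inv by lra; unfold Cdiv; ring).
        rewrite Cpower_RtoC, Rpower_sqrt by auto. reflexivity. }
      assert (E3 : RtoC (central n) = INR (fact (2 * n)) / (4 ^ n * INR (fact n) ^ 2)).
      { unfold central. rewrite RtoC_div, RtoC_mult, !RtoC_pow; [reflexivity|].
        apply Rmult_integral_contrapositive_currified; apply pow_nonzero; [lra|apply INR_fact_neq_0]. }
      assert (E4 : Cpower (INR n) s = Cpower (INR n) ((a + 1 + nu) / 2) *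
        Cpower (INR n) ((a + 1 - nu) / 2) * Cpower (INR n) (1 / 2)).
      { rewrite <- !Cpower_plus. f_equal. unfold s. field. }
      rewrite RtoC_mult, E1, E2, E3, E4. unfold RGamma_seq. rewrite Cpow_S.
      assert (P4 := Cpow_nz _ n H4).
      field. repeat split; auto using Cpower_neq_0.
    - apply (clim_mult _); [exact HL|]. apply (clim_mult _); [apply (clim_const _)|apply wallis]. }
  assert (LR : clim eventually (fun n => RGamma_seq ((a + 1 + nu) / 2) n * RGamma_seq ((a + 1 - nu) / 2) n * J)
    (RGamma ((a + 1 + nu) / 2) * RGamma ((a + 1 - nu) / 2) * J)).
  { apply (clim_mult _); [apply (clim_mult _); apply RGamma_correct|apply (clim_const _)]. }
  rewrite (clim_unique eventually _ _ _ LR LL).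
  replace (PI / 2)%R with (PI * / 2)%R by reflexivity.
  rewrite Cpower_mult_pos, Cpower_inv_pos, Cpower_PI_half by lra.
  unfold s. replace (a + 3 / 2) with (a - 1 + 2 + 1 / 2) by field.
  rewrite (Cpower_plus 2 (a - 1 + 2)), (Cpower_plus 2 (a - 1) 2), Cpower_2_2 by exact H2.
  assert (P := Cpower_neq_0 2 (1 / 2)). field. auto.
Qed.

(** Written without division, so that it also holds when an argument on the left is a pole of Gamma;
    both sides are then 0. *)
Lemma RGamma_product_shift (mu nu : C) (N : nat) :
  4 ^ N * (RGamma ((- mu + nu + 1) / 2) * RGamma ((- mu - nu + 1) / 2)) =
  lommel_a N (- mu) nu *
    (RGamma ((- mu + nu + 1) / 2 + INR N) * RGamma ((- mu - nu + 1) / 2 + INR N)).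
Proof.
  induction N as [|N IH].
  - unfold lommel_a. simpl. rewrite !Cplus_0_r. ring.
  - rewrite Cpow_S, <- Cmult_assoc, IH, (RGamma_rec (_ + INR N)), (RGamma_rec ((- mu - nu + 1) / 2 + INR N)).
    unfold lommel_a. cbn [Cprod]. rewrite S_INR, RtoC_plus, !Cplus_assoc.
    set (X := RGamma _). set (Y := RGamma _). field.
Qed.

(** The prefactor of the theorem is exactly what turns this Mellin transform into the first omitted
    coefficient of the series. *)
Lemma lommel_a_mellin (mu nu J : C) (K : C -> C) (N : nat) (d : R) : is_BesselK nu K -> (0 < d)%R ->
  (0 < Re (2 * INR N - mu)%C - (Rabs (Re nu) + d) + 1)%R ->
  improper (fun t : R => Cpower t (2 * INR N - mu) * K t) J ->
  Cpower 2 (mu + 1) * RGamma ((- mu + nu + 1) / 2) * RGamma ((- mu - nu + 1) / 2) * J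
  = lommel_a N (- mu) nu.
Proof.
  intros HK Hd Ha HJ. assert (H2 : RtoC 2 <> 0) by (apply RtoC_neq_0; lra).
  assert (H := BesselK_mellin nu _ J K d HK Hd Ha HJ).
  replace ((2 * INR N - mu + 1 + nu) / 2) with ((- mu + nu + 1) / 2 + INR N) in H by field.
  replace ((2 * INR N - mu + 1 - nu) / 2) with ((- mu - nu + 1) / 2 + INR N) in H by field.
  assert (G := RGamma_product_shift mu nu N).
  assert (H4 : RtoC 4 <> 0) by (apply RtoC_neq_0; lra).
  assert (P4 := Cpow_nz _ N H4).
  assert (E : Cpower 2 (mu + 1) * Cpower 2 (2 * INR N - mu - 1) = 4 ^ N).
  { rewrite <- Cpower_plus. replace (mu + 1 + (2 * INR N - mu - 1)) with (RtoC (INR (2 * N))).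
    2: { rewrite RtoC_INR_double. ring. }
    rewrite Cpower_INR, Cpow_mult_r by exact H2. f_equal. ring. }
  replace (Cpower 2 (mu + 1) * RGamma ((- mu + nu + 1) / 2) * RGamma ((- mu - nu + 1) / 2) * J)
    with (Cpower 2 (mu + 1) * (4 ^ N * (RGamma ((- mu + nu + 1) / 2) * RGamma ((- mu - nu + 1) / 2))) * J / 4 ^ N)
    by (field; auto).
  rewrite G.
  replace (Cpower 2 (mu + 1) * (lommel_a N (- mu) nu * (RGamma ((- mu + nu + 1) / 2 + INR N) *
    RGamma ((- mu - nu + 1) / 2 + INR N))) * J / 4 ^ N)
    with (lommel_a N (- mu) nu * (Cpower 2 (mu + 1) * (RGamma ((- mu + nu + 1) / 2 + INR N) *
    RGamma ((- mu - nu + 1) / 2 + INR N) * J)) / 4 ^ N) by (field; auto).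
  rewrite H, E. field. auto.
Qed.

(** * The integral representation of the Lommel function *)

(** [(t^2 + nu^2) / (z^2 + t^2) = 1 + (nu^2 - z^2) / (z^2 + t^2)]; the summand 1 produces the Mellin
    transform [J]. *)
Lemma Ptr_shift (rho : R) (f : R -> C) (a nu z J : C) :
  rapid rho f -> (0 < Re a - rho + 1)%R -> (0 < Re z)%R ->
  improper (fun t : R => Cpower t a * f t) J ->
  Ptr (fun t => (RtoC t ^ 2 + nu ^ 2) * f t) a z =
    (nu ^ 2 - z ^ 2) * Ptr f a z + Cpower z (1 - a) * J.
Proof.
  intros Hf He Hz HJ.
  assert (Hd : (0 < Re z ^ 2)%R) by (apply pow_lt; auto).
  assert (Hs := away_sqr z Hz).
  assert (I1 := stieltjes_correct rho f a _ _ 1 Hf He Hd Hs).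
  assert (E : stieltjes 1 (fun t => (RtoC t ^ 2 + nu ^ 2) * f t) a (z ^ 2)
    = J + (nu ^ 2 - z ^ 2) * stieltjes 1 f a (z ^ 2)).
  { apply impI_unique.
    apply (improper_ext (fun t : R => Cpower t a * f t +
      (nu ^ 2 - z ^ 2) * (Cpower t a * f t * (/ (z ^ 2 + RtoC t ^ 2)) ^ 1))).
    - intros t Ht. assert (N := away_neq _ _ t Hd Hs Ht). field. exact N.
    - apply improper_plus; [exact HJ|now apply improper_scal]. }
  unfold Ptr. rewrite E. ring.
Qed.

(** The terms of the asymptotic series of [S]. Multiplying one by its exponent [mu - 1 - 2 n]
    applies [theta] and turns [a_n(-mu, nu)] into [b_n(-mu, nu)]. *)
Definition lommel_term (mu nu : C) (n : nat) (z : C) : C :=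
  (- (1)) ^ n * lommel_a n (- mu) nu * Cpower z (mu - 1 - 2 * INR n).

Lemma Csum_ext (f g : nat -> C) (n : nat) : (forall k, f k = g k) -> Csum f n = Csum g n.
Proof. intros E. induction n as [|n IH]; simpl; [reflexivity|]. now rewrite IH, E. Qed.

Lemma Csum_mult (f : nat -> C) (c : C) (n : nat) : Csum (fun k => f k * c) n = Csum f n * c.
Proof. induction n as [|n IH]; simpl; [ring|]. rewrite IH. ring. Qed.

Lemma cder_Csum (f f' : nat -> C -> C) (z : C) (n : nat) :
  (forall k, cderC (f k) z (f' k z / z)) ->
  cderC (fun y => Csum (fun k => f k y) n) z (Csum (fun k => f' k z) n / z).
Proof.
  intros H. induction n as [|n IH].
  - simpl. eapply cder_eq; [|apply cder_const]. unfold Cdiv. ring.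
  - simpl. eapply cder_eq; [|apply cder_plus; [exact IH|apply H]]. unfold Cdiv. ring.
Qed.

Lemma lommel_a_S (n : nat) (mu nu : C) :
  lommel_a (S n) mu nu = lommel_a n mu nu * ((mu + 2 * INR n + 1) ^ 2 - nu ^ 2).
Proof. unfold lommel_a. cbn [Cprod]. rewrite S_INR, RtoC_plus. f_equal. ring. Qed.

(** By the recurrence for [lommel_a], the operator [theta^2 - nu^2] sends term [n] to [- z^2] times
    term [n + 1]. Adding [z^2] times the sum leaves only the first power, which is the Lommel
    inhomogeneity, and the last one. *)
Lemma lommel_telescope (mu nu z : C) (N : nat) : z <> 0 ->
  Csum (fun n => (mu - 1 - 2 * INR n) ^ 2 * lommel_term mu nu n z) N =
  (nu ^ 2 - z ^ 2) * Csum (fun n => lommel_term mu nu n z) N + Cpower z (mu + 1)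
  - (- (1)) ^ N * lommel_a N (- mu) nu * Cpower z (mu + 1 - 2 * INR N).
Proof.
  intros Hz. induction N as [|N IH].
  - simpl. unfold lommel_a. simpl. replace (mu + 1 - 2 * 0) with (mu + 1) by ring. ring.
  - cbn [Csum]. rewrite IH. rewrite lommel_a_S. unfold lommel_term.
    replace (mu + 1 - 2 * INR N) with (mu - 1 - 2 * INR N + 2) by ring.
    replace (mu + 1 - 2 * INR (S N)) with (mu - 1 - 2 * INR N) by (rewrite S_INR, RtoC_plus; ring).
    rewrite (Cpower_plus z (mu - 1 - 2 * INR N) 2), (Cpower_2_2 z Hz), (Cpow_S (- (1))).
    set (X := Cpower z (mu - 1 - 2 * INR N)). ring.
Qed.

(** Growth is tested only on the rays [arg z = PI/4] and [arg z = - PI/4], in the normalization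
    [Re e = 1] required by [bessel_unique]. *)
Definition polyb (f : C -> C) : Prop := exists (B M : R) (p : nat), (0 <= B)%R /\
  forall e, Re e = 1%R -> (Im e = 1%R \/ Im e = (-1)%R) ->
    forall r, (M < r)%R -> (Cmod (f (r * e)%C) <= B * (1 + r) ^ p)%R.

Lemma polyb_plus (f g : C -> C) : polyb f -> polyb g -> polyb (fun z => f z + g z).
Proof.
  intros [B [M [p [HB H]]]] [B' [M' [p' [HB' H']]]].
  exists (B + B')%R, (Rmax (Rmax M M') 0), (p + p')%nat. split; [lra|].
  intros e He Hi r Hr. apply Rmax_Rlt in Hr as [Hr Hr0]. apply Rmax_Rlt in Hr as [Hr Hr'].
  specialize (H e He Hi r Hr). specialize (H' e He Hi r Hr').
  eapply Rle_trans; [apply Cmod_triangle|]. rewrite Rmult_plus_distr_r.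
  apply Rplus_le_compat; (eapply Rle_trans; [first [exact H|exact H']|]);
    apply Rmult_le_compat_l; auto; apply Rle_pow; lra || lia.
Qed.

Lemma polyb_scal (c : C) (f : C -> C) : polyb f -> polyb (fun z => c * f z).
Proof.
  intros [B [M [p [HB H]]]]. exists (Cmod c * B)%R, M, p.
  split; [apply Rmult_le_pos; [apply Cmod_ge_0|exact HB]|].
  intros e He Hi r Hr. rewrite Cmod_mult, Rmult_assoc.
  apply Rmult_le_compat_l; [apply Cmod_ge_0|]. auto.
Qed.

Lemma polyb_const (c : C) : polyb (fun _ => c).
Proof.
  exists (Cmod c), 0%R, 0%nat. split; [apply Cmod_ge_0|]. intros. simpl. lra.
Qed.

Lemma polyb_le (f g : C -> C) (A M : R) : polyb f -> (0 <= A)%R ->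
  (forall e, Re e = 1%R -> forall r, (M < r)%R ->
    (Cmod (g (r * e)%C) <= A * Cmod (f (r * e)%C))%R) -> polyb g.
Proof.
  intros [B [M' [p [HB H]]]] HA HG.
  exists (A * B)%R, (Rmax M M'), p. split; [now apply Rmult_le_pos|].
  intros e He Hi r Hr. assert (h1 := Rmax_l M M'). assert (h2 := Rmax_r M M').
  eapply Rle_trans; [apply HG; auto; lra|]. rewrite Rmult_assoc.
  apply Rmult_le_compat_l; [exact HA|]. apply H; auto. lra.
Qed.

Lemma polyb_Cpower (b : C) : polyb (fun z => Cpower z b).
Proof.
  destruct (nfloor_ex (Rabs (Re b)) (Rabs_pos _)) as [n [_ Hn]].
  set (Q := (Cmod (Cpower (1 + Ci) b) + Cmod (Cpower (1 - Ci) b))%R).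
  assert (q1 := Cmod_ge_0 (Cpower (1 + Ci) b)). assert (q2 := Cmod_ge_0 (Cpower (1 - Ci) b)).
  exists Q, 1%R, (S n). split; [unfold Q; lra|].
  intros e He Hi r Hr.
  assert (He0 : e <> 0) by (apply Re_pos_neq_0; lra).
  rewrite Cmod_Cpower_ray by (auto; lra). rewrite Rmult_comm.
  apply Rmult_le_compat; [apply Cmod_ge_0|left; apply Rpower_pos| |].
  - unfold Q. destruct Hi as [Hi|Hi].
    + replace e with (1 + Ci); [lra|].
      apply C_eq; [rewrite He|rewrite Hi]; unfold Ci, Re, Im; simpl; ring.
    + replace e with (1 - Ci); [lra|].
      apply C_eq; [rewrite He|rewrite Hi]; unfold Ci, Re, Im; simpl; ring.
  - rewrite <- Rpower_pow by lra. rewrite S_INR.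
    assert (Hb := Rle_abs (Re b)).
    apply Rle_trans with (Rpower r (Rabs (Re b))); [apply Rle_Rpower; lra|].
    apply Rle_trans with (Rpower (1 + r) (Rabs (Re b))); [|apply Rle_Rpower; lra].
    apply Rle_Rpower_l; [apply Rabs_pos|lra].
Qed.

Lemma polyb_Csum (f : nat -> C -> C) (n : nat) :
  (forall k, polyb (f k)) -> polyb (fun z => Csum (fun k => f k z) n).
Proof.
  intros H. induction n as [|n IH]; simpl; [apply polyb_const|].
  now apply (polyb_plus _ (f n)).
Qed.

(** On [z = r u] with [Re u = 1] and [r > 1], the kernel is at most [1 / r^2 <= 1], so the integral
    is bounded uniformly and only the power of [z] grows. *)
Lemma polyb_Ptr (rho : R) (f : R -> C) (a : C) :
  rapid rho f -> (0 < Re a - rho + 1)%R -> polyb (Ptr f a).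
Proof.
  intros Hf He. set (e := (Re a - rho + 1)%R) in *.
  destruct (rapid_dom rho f a Hf He) as [D [HD H]]. fold e in H.
  assert (A3 := Rinv_0_lt_compat _ He).
  apply (polyb_le (fun z => Cpower z (1 - a)) _ (2 * (D * / e)) 1 (polyb_Cpower (1 - a))).
  { apply Rmult_le_pos; [lra|]. apply Rmult_le_pos; lra. }
  intros u Hu r Hr. unfold Ptr. rewrite Cmod_mult, Rmult_comm.
  apply Rmult_le_compat_r; [apply Cmod_ge_0|].
  assert (Ez : Re (r * u) = r) by (rewrite re_scal_l, Hu; ring).
  assert (Hz : (0 < Re (r * u)%C)%R) by (rewrite Ez; lra).
  assert (Hs := away_sqr _ Hz). rewrite Ez in Hs.
  assert (Hd : (0 < r ^ 2)%R) by (apply pow_lt; lra).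
  apply (improper_bound _ _ e D He HD (stieltjes_correct rho f a _ _ 1 Hf He Hd Hs)).
  intros t Ht. rewrite Cmod_mult.
  rewrite <- (Rmult_1_r (D * om e t)). apply Rmult_le_compat; try apply Cmod_ge_0; auto.
  eapply Rle_trans; [apply (kernel_bound _ _ t 1 Hd Hs Ht)|].
  rewrite pow_1, <- Rinv_1. apply Rinv_le_contravar; nra.
Qed.

Lemma polyb_Lommel (mu nu : C) (S : C -> C) : is_Lommel mu nu S -> polyb S.
Proof.
  intros [_ HS]. assert (HPI := PI_RGT_0).
  (* [delta = PI / 2] covers the right half-plane, and relative error 1 gives
     [|S| <= 2 |z^(mu - 1)|]. *)
  destruct (HS (PI / 2)%R ltac:(lra) 1%R Rlt_0_1) as [M HM].
  apply (polyb_le (fun z => Cpower z (mu - 1)) _ 2 (Rmax M 0) (polyb_Cpower (mu - 1))); [lra|].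
  intros u Hu r Hr. assert (h1 := Rmax_l M 0). assert (h2 := Rmax_r M 0).
  assert (Ez : Re (r * u) = r) by (rewrite re_scal_l, Hu; ring).
  assert (Hz0 : r * u <> 0) by (apply Re_pos_neq_0; rewrite Ez; lra).
  assert (HC : (Rabs (Carg (r * u)) < PI / 2)%R) by (apply Carg_lt_PI2; [exact Hz0|rewrite Ez; lra]).
  specialize (HM (r * u)).
  assert (Hm : (M < Cmod (r * u))%R).
  { assert (h := re_le_Cmod (r * u)). rewrite Ez in h. assert (h' := Rle_abs r). lra. }
  specialize (HM Hm ltac:(lra)).
  set (g := Cpower (r * u) (mu - 1)) in *. assert (Hg : g <> 0) by apply Cpower_neq_0.
  replace (S (r * u)) with ((S (r * u) / g - 1) * g + g) by (field; exact Hg).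
  eapply Rle_trans; [apply Cmod_triangle|]. rewrite Cmod_mult.
  assert (h := Cmod_ge_0 g). nra.
Qed.

Lemma Lommel_pair (mu nu : C) (S : C -> C) : is_Lommel mu nu S -> forall z, (0 < Re z)%R ->
  cderC S z (z * C_derive S z / z) /\
  cderC (fun z => z * C_derive S z) z (((nu ^ 2 - z ^ 2) * S z + Cpower z (mu + 1)) / z).
Proof.
  intros [H _] z Hz. destruct (H z (slit_of_Re_pos z Hz)) as [E1 [E2 E3]].
  assert (Hz0 := Re_pos_neq_0 z Hz).
  split.
  - eapply cder_eq; [|apply cderC_is_derive, (C_derive_correct _ _ 0 E1)]. field. exact Hz0.
  - eapply cder_eq; [|apply cder_mult; [apply (cder_io idC)|
      apply cderC_is_derive, (C_derive_correct _ _ 0 E2)]].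
    replace (mu + 1) with (mu - 1 + 2) by ring.
    rewrite Cpower_plus, (Cpower_2_2 z Hz0), <- E3. unfold idC. field. exact Hz0.
Qed.

Lemma Lommel_derive_repr (mu nu A M : C) (S K : C -> C) (N : nat) (d : R) :
  is_Lommel mu nu S -> is_BesselK nu K -> (0 < d)%R ->
  (0 < Re (2 * INR N - mu)%C - (Rabs (Re nu) + d) + 1)%R ->
  improper (fun t : R => Cpower t (2 * INR N - mu) * K t) M ->
  A * M = lommel_a N (- mu) nu ->
  forall z, (0 < Re z)%R ->
    z * C_derive S z = Csum (fun n => (mu - 1 - 2 * INR n) * lommel_term mu nu n z) N
      + (- (1)) ^ N * A * Ptr (fun t : R => t * C_derive K t) (2 * INR N - mu) z.
Proof.
  intros HS HK Hd Ha HM HA. destruct (BesselK_rapid nu K d HK Hd) as [R1 [R2 [T1 T2]]].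
  set (rho := (Rabs (Re nu) + d)%R) in *. set (a := 2 * INR N - mu) in *.
  set (F := fun z => Csum (fun n => lommel_term mu nu n z) N
    + (- (1)) ^ N * A * Ptr (fun t : R => K t) a z).
  set (VF := fun z => Csum (fun n => (mu - 1 - 2 * INR n) * lommel_term mu nu n z) N
    + (- (1)) ^ N * A * Ptr (fun t : R => t * C_derive K t) a z).
  assert (Hterm : forall n z, (0 < Re z)%R -> cderC (lommel_term mu nu n) z
    ((mu - 1 - 2 * INR n) * lommel_term mu nu n z / z)).
  { intros n z Hz. eapply cder_eq; [|apply cder_scal, cder_Cpower; exact Hz].
    unfold lommel_term, Cdiv. ring. }
  assert (HF : forall z, (0 < Re z)%R -> cderC F z (VF z / z)).
  { intros z Hz. unfold F. eapply cder_eq; [|apply cder_plus].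
    2: { apply (cder_Csum (lommel_term mu nu) (fun n z => (mu - 1 - 2 * INR n) * lommel_term mu nu n z)).
         intros n. now apply Hterm. }
    2: { apply cder_scal. apply (cder_Ptr rho _ _ a z R1 R2 T1 Ha Hz). }
    unfold VF, Cdiv. ring. }
  assert (HVF : forall z, (0 < Re z)%R -> cderC VF z (((nu ^ 2 - z ^ 2) * F z + Cpower z (mu + 1)) / z)).
  { intros z Hz. assert (Hz0 := Re_pos_neq_0 z Hz). unfold VF. eapply cder_eq; [|apply cder_plus].
    2: { apply (cder_Csum (fun n z => (mu - 1 - 2 * INR n) * lommel_term mu nu n z)
           (fun n z => (mu - 1 - 2 * INR n) ^ 2 * lommel_term mu nu n z)).
         intros n. eapply cder_eq; [|apply cder_scal; now apply Hterm]. unfold Cdiv. ring. }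
    2: { apply cder_scal. apply (cder_Ptr rho _ _ a z R2 (rapid_quad rho _ (nu ^ 2) R1) T2 Ha Hz). }
    (* The last term of the telescoped sum and the Mellin term of [Ptr_shift] carry the same power
       [z^(mu + 1 - 2 N)] and opposite coefficients, by [HA]; only [z^(mu + 1)] survives. *)
    rewrite (Ptr_shift rho _ a nu z M R1 Ha Hz HM), (lommel_telescope mu nu z N Hz0), <- HA.
    replace (1 - a) with (mu + 1 - 2 * INR N) by (unfold a; ring).
    unfold F, Cdiv. ring. }
  assert (HD : bessel_pair nu (fun z => S z + (- (1)) * F z)
    (fun z => z * C_derive S z + (- (1)) * VF z)).
  { intros z Hz. assert (Hz0 := Re_pos_neq_0 z Hz).
    destruct (Lommel_pair mu nu S HS z Hz) as [P1 P2]. split.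
    - eapply cder_eq; [|apply cder_plus; [exact P1|apply cder_scal; now apply HF]].
      unfold Cdiv. ring.
    - eapply cder_eq; [|apply (cder_plus idC (fun z => z * C_derive S z)); [exact P2|apply cder_scal; now apply HVF]].
      unfold Cdiv. ring. }
  assert (HP : polyb (fun z => S z + (- (1)) * F z)).
  { apply polyb_plus; [now apply (polyb_Lommel mu nu)|].
    apply polyb_scal, polyb_plus.
    - apply polyb_Csum. intros k. apply polyb_scal, polyb_Cpower.
    - now apply polyb_scal, (polyb_Ptr rho). }
  destruct HP as [B [M' [p [_ HP]]]].
  intros z Hz. destruct (bessel_unique nu K _ _ B M' p HK HD HP z Hz) as [_ E].
  fold (VF z). replace (z * C_derive S z) with (z * C_derive S z + - (1) * VF z + VF z) by ring.
  rewrite E. ring.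
Qed.

Theorem theorem1p3 (N : nat) (mu nu : C) (S K : C -> C)
  (hS : is_Lommel mu nu S) (hK : is_BesselK nu K)
  (hmunu : (Re mu + Rabs (Re nu) < 2 * INR N + 1)%R)
  (z : C) (hz0 : z <> 0) (hz : (Rabs (Carg z) < PI / 2)%R) :
  exists J : C,
    is_RInt_gen (V := C_R_NormedModule)
      (fun t : R =>
         Cpower t (2 * INR N - mu + 1) * C_derive K t / (1 + (t / z) ^ 2))
      (at_right 0) (Rbar_locally p_infty) J /\
    lommel_remainder' S N z mu nu =
      (- (1)) ^ N
      * (Cpower 2 (mu + 1)
         * RGamma ((- mu + nu + 1) / 2) * RGamma ((- mu - nu + 1) / 2))
      * (1 / z ^ (2 * N)) * J.
Proof.
  assert (Hz := proj1 (Carg_lt_PI2 z hz0) hz).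
  (* Half of the gap in the hypothesis: the singularity of [K] costs [d], and the exponent in [Ha]
     is then exactly [d > 0]. *)
  set (d := ((2 * INR N + 1 - (Re mu + Rabs (Re nu))) / 2)%R).
  assert (Hd : (0 < d)%R) by (unfold d; lra).
  set (a := 2 * INR N - mu).
  assert (Ha : (0 < Re a - (Rabs (Re nu) + d) + 1)%R).
  { unfold a, d. rewrite Re_minus, re_scal_l, re_RtoC. lra. }
  destruct (BesselK_rapid nu K d hK Hd) as [R1 [R2 _]].
  destruct (improper_ex _ _ Ha (rapid_integr1 _ _ a R1 Ha)) as [M HM].
  assert (HA := lommel_a_mellin mu nu M K N d hK Hd Ha HM).
  set (A := Cpower 2 (mu + 1) * RGamma ((- mu + nu + 1) / 2) * RGamma ((- mu - nu + 1) / 2)) in *.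
  assert (E := Lommel_derive_repr mu nu A M S K N d hS hK Hd Ha HM HA z Hz).
  assert (Hs := away_sqr z Hz). assert (Hd2 : (0 < Re z ^ 2)%R) by (apply pow_lt; auto).
  assert (I1 := stieltjes_correct _ _ a _ _ 1 R2 Ha Hd2 Hs).
  fold a in E. set (G := stieltjes 1 (fun t : R => t * C_derive K t) a (z ^ 2)) in *.
  (* [1 / (1 + (t / z)^2) = z^2 / (z^2 + t^2)]. *)
  exists (z ^ 2 * G). split.
  - apply improper_is_RInt_gen.
    apply (improper_ext (fun t : R => z ^ 2 * (Cpower t a * (t * C_derive K t) * (/ (z ^ 2 + RtoC t ^ 2)) ^ 1))).
    + intros t Ht. assert (Ht0 := RtoC_neq_0 t Ht). assert (Nz := away_neq _ _ t Hd2 Hs Ht).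
      rewrite Cpower_plus, (Cpower_1 t Ht0). fold a.
      replace (1 + (t / z) ^ 2) with ((z ^ 2 + RtoC t ^ 2) / z ^ 2) by (field; exact hz0).
      field. auto.
    + now apply improper_scal.
  - unfold lommel_remainder'.
    replace (C_derive S z / Cpower z (mu - 2)) with (z * C_derive S z / Cpower z (mu - 1)).
    2: { replace (mu - 1) with (mu - 2 + 1) by ring. rewrite Cpower_plus, (Cpower_1 z hz0).
         field. auto using Cpower_neq_0. }
    assert (P0 := Cpower_neq_0 z (mu - 1)).
    (* [(mu - 1 - 2 n) a_n(-mu, nu) = b_n(-mu, nu)], so the differentiated series is the one
       subtracted in the remainder. *)
    assert (ES : Csum (fun n => (mu - 1 - 2 * INR n) * lommel_term mu nu n z) N =
      Csum (fun n => (- (1)) ^ n * (lommel_b n (- mu) nu / z ^ (2 * n))) N * Cpower z (mu - 1)).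
    { rewrite <- Csum_mult. apply Csum_ext. intros n. unfold lommel_term, lommel_b.
      assert (Pn := Cpow_nz z (2 * n) hz0).
      replace (2 * INR n) with (RtoC (INR (2 * n))).
      2: { rewrite RtoC_INR_double. ring. }
      rewrite (Cpower_minus z (mu - 1)), Cpower_INR by exact hz0. field. auto. }
    rewrite E, ES. unfold Ptr. fold G.
    (* Of the power [z^(1 - a)], the part [z^(mu - 1)] cancels the normalization, [z^2] belongs to
       the integral and [z^(- 2 N)] is the factor in the formula. *)
    replace (1 - a) with (mu - 1 + 2 - RtoC (INR (2 * N))).
    2: { unfold a. rewrite RtoC_INR_double. ring. }
    rewrite (Cpower_minus z (mu - 1 + 2)), Cpower_INR, Cpower_plus, (Cpower_2_2 z hz0) by exact hz0.
    assert (Pn := Cpow_nz z (2 * N) hz0).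
    field. auto.
Qed.
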